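(* Let $M^n$ be a $\theta$-slant proper submanifold, of dimension $n$, of a quaternionic space form $\overline{M}^{4m}(c)$ of real dimension $4m$. Then: (i) For every real number $r$ with $0<r<n(n-1)$, the generalized normalized $\delta$-Casorati curvature $\delta_C(r;n-1)$ satisfies, at every point of $M$, $$\rho\leq\frac{\delta_C(r;n-1)}{n(n-1)}+\frac{c}{4}\left(1+\frac{9}{n-1}\cos^2\theta\right).$$ (ii) For every real number $r>n(n-1)$, the generalized normalized $\delta$-Casorati curvature $\widehat{\delta}_C(r;n-1)$ satisfies, at every point of $M$, $$\rho\leq\frac{\widehat{\delta}_C(r;n-1)}{n(n-1)}+\frac{c}{4}\left(1+\frac{9}{n-1}\cos^2\theta\right).$$ Moreover, for $r$ in the corresponding range ($0<r<n(n-1)$, respectively $r>n(n-1)$), the equality sign holds (at all points of $M$) in the inequality $\rho\leq\frac{\delta_C(r;n-1)}{n(n-1)}+\frac{c}{4}\left(1+\frac{9}{n-1}\cos^2\theta\right)$, respectively $\rho\leq\frac{\widehat{\delta}_C(r;n-1)}{n(n-1)}+\frac{c}{4}\left(1+\frac{9}{n-1}\cos^2\theta\right)$, if and only if $M^n$ is an invariantly quasi-umbilical submanifold with trivial normal connection in $\overline{M}^{4m}(c)$ such that, with respect to a suitable orthonormal tangent frame $\{\xi_1,\dots,\xi_n\}$ and a suitable orthonormal normal frame $\{\xi_{n+1},\dots,\xi_{4m}\}$, the shape operators $A_k\equiv A_{\xi_k}$, $k\in\{n+1,\dots,4m\}$, take the following forms: $$A_{n+1}=\operatorname{diag}\Big(\underbrace{a,a,\dots,a}_{n-1},\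 \frac{n(n-1)}{r}\,a\Big),\qquad A_{n+2}=\dots=A_{4m}=0,$$ where $a$ is a real-valued function on $M$.
   Context: Riemannian submanifolds. Let $M^n$ be an $n$-dimensional submanifold of a Riemannian manifold $(\overline{M},\overline{g})$ of dimension $4m$, with induced metric $g$. $\overline\nabla$ and $\nabla$ are the Levi-Civita connection of $\overline M$ and the induced connection on $M$. The second fundamental form $h$, shape operators $A_N$ and normal connection $\nabla^\perp$ are given by $\overline\nabla_XY=\nabla_XY+h(X,Y)$ and $\overline\nabla_XN=-A_NX+\nabla^\perp_XN$ for $X,Y$ tangent and $N$ normal. ''Trivial normal connection'' means that $\nabla^\perp$ is flat (its curvature vanishes). For $p\in M$, let $\{e_1,\dots,e_n\}$ be an orthonormal basis of $T_pM$ and $\{e_{n+1},\dots,e_{4m}\}$ an orthonormal basis of $T_p^\perp M$. With $K$ the sectional curvature of $M$, the scalar curvature is $\tau(p)=\sum_{1\le i<j\le n}K(e_i\wedge e_j)$ and the normalized scalar curvature is $\rho=\frac{2\tau}{n(n-1)}$. Put $h_{ij}^\alpha=\overline g(h(e_i,e_j),e_\alpha)$. The Casorati curvature of $M$ is $$\mathcal C=\frac1n\sum_{\alpha=n+1}^{4m}\sum_{i,j=1}^n(h_{ij}^\alpha)^2.$$ For an $s$-dimensional subspace $L\subset T_pM$ with orthonormal basis $\{e_1,\dots,e_s\}$, its Casorati curvature is $$\mathcal C(L)=\frac1s\sum_{\alpha=n+1}^{4m}\sum_{i,j=1}^s(h_{ij}^\alpha)^2.$$ Generalized normalized $\delta$-Casorati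 curvatures (hyperplane means linear subspace of dimension $n-1$): for $0<r<n^2-n$, $$[\delta_C(r;n-1)]_p=r\,\mathcal C_p+\frac{(n-1)(n+r)(n^2-n-r)}{rn}\inf\{\mathcal C(L)\mid L\text{ a hyperplane of }T_pM\},$$ and for $r>n^2-n$, $$[\widehat\delta_C(r;n-1)]_p=r\,\mathcal C_p-\frac{(n-1)(n+r)(r-n^2+n)}{rn}\sup\{\mathcal C(L)\mid L\text{ a hyperplane of }T_pM\}.$$ $M$ is called invariantly quasi-umbilical if there exist $4m-n$ mutually orthogonal unit normal vectors $\xi_{n+1},\dots,\xi_{4m}$ such that the shape operators with respect to all directions $\xi_\alpha$ have an eigenvalue of multiplicity $n-1$ and, for each $\xi_\alpha$, the distinguished eigendirection is the same. Quaternionic geometry. $(\overline M,\sigma,\overline g)$ is almost quaternionic Hermitian if $\sigma$ is a rank 3 subbundle of $\mathrm{End}(T\overline M)$ with local basis $\{J_1,J_2,J_3\}$ satisfying, for all $\alpha\in\{1,2,3\}$ (indices mod 3), $\overline g(J_\alpha\cdot,J_\alpha\cdot)=\overline g(\cdot,\cdot)$, $J_\alpha^2=-\mathrm{Id}$, $J_\alpha J_{\alpha+1}=-J_{\alpha+1}J_\alpha=J_{\alpha+2}$; its dimension is $4m$, $m\ge1$. It is quaternionic Kähler if moreover $\sigma$ is parallel with respect to $\overline\nabla$. For a non-null $X$, $Q(X)$ is the 4-plane spanned by $X,J_1X,J_2X,J_3X$; a 2-plane in $Q(X)$ is a quaternionic plane and its sectional curvature a quaternionic sectional curvature. A quaternionic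 Kähler manifold is a quaternionic space form $\overline M(c)$ if all its quaternionic sectional curvatures equal the constant $c$; equivalently its curvature tensor is $$\overline R(X,Y)Z=\frac c4\Big\{\overline g(Z,Y)X-\overline g(X,Z)Y+\sum_{\alpha=1}^3\big[\overline g(Z,J_\alpha Y)J_\alpha X-\overline g(Z,J_\alpha X)J_\alpha Y+2\overline g(X,J_\alpha Y)J_\alpha Z\big]\Big\}$$ for any local basis $\{J_1,J_2,J_3\}$ of $\sigma$. A submanifold $M$ of a quaternionic Kähler manifold is slant if for each non-zero vector $X$ tangent to $M$ at $p$, the angle $\theta(X)$ between $J_\alpha(X)$ and $T_pM$, $\alpha\in\{1,2,3\}$, is constant, i.e. does not depend on the choice of $p\in M$ and $X\in T_pM$; its value is denoted $\theta$. Quaternionic submanifolds are slant with $\theta=0$ and totally real submanifolds are slant with $\theta=\pi/2$; a slant submanifold is proper ($\theta$-slant proper) if it is neither quaternionic nor totally real. *)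

(* Defs.v *)
From HB Require Import structures.
From mathcomp Require Import all_boot all_order all_algebra.
From mathcomp Require Import all_classical all_reals all_analysis.

Set Implicit Arguments.
Unset Strict Implicit.
Unset Printing Implicit Defensive.

Import Order.TTheory GRing.Theory Num.Theory.
Import numFieldNormedType.Exports.
Local Open Scope classical_set_scope.
Local Open Scope ring_scope.

(* Tangent vectors are row vectors, so a linear map A sends u to u *m A, the   *)
(* composition "A then B" is A *m B, and a bilinear form g is (u, v) |-> u g v^T. *)

Definition inner (R : realType) (d : nat) (g : 'M[R]_d) (u v : 'rV[R]_d) : R :=
  (u *m g *m v^T) 0 0.

Definition gnorm (R : realType) (d : nat) (g : 'M[R]_d) (u : 'rV[R]_d) : R :=
  Num.sqrt (inner g u u).

Fixpoint is_Ck (R : realType) (V W : normedModType R) (k : nat) (U : set V)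
    (F : V -> W) : Prop :=
  match k with
  | 0 => forall x, U x -> {for x, continuous F}
  | k'.+1 => (forall x, U x -> differentiable F x) /\
             (forall v, is_Ck k' U (fun x => 'D_v F x))
  end.

Definition smooth_on (R : realType) (V W : normedModType R) (U : set V)
    (F : V -> W) : Prop := forall k, is_Ck k U F.

(* The atlas is indexed by the points: chart p is a chart around p, with domain *)
(* chart_dom p and inverse chart_inv p. This loses no generality, and lets the  *)
(* tangent space at p be 'rV_d, a vector being given by its components in the   *)
(* chart indexed by p. Tensors at p are likewise given by these components.     *)
Record manifold (R : realType) (d : nat) := Manifold {
  msort :> topologicalType;
  chart_dom : msort -> set msort;
  chart : msort -> msort -> 'rV[R]_d;
  chart_inv : msort -> 'rV[R]_d -> msort;
  chart_img := fun p => chart p @` chart_dom p;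
  manifold_hausdorff : hausdorff_space msort;
  manifold_countable : @second_countable msort;
  chart_dom_mem : forall p, chart_dom p p;
  chart_dom_open : forall p, open (chart_dom p);
  chart_img_open : forall p, open (chart_img p);
  chartK : forall p q, chart_dom p q -> chart_inv p (chart p q) = q;
  chart_continuous : forall p q, chart_dom p q -> {for q, continuous (chart p)};
  chart_inv_continuous : forall p x, chart_img p x -> {for x, continuous (chart_inv p)};
  transition_smooth : forall p q,
    smooth_on (chart p @` (chart_dom p `&` chart_dom q)) (chart q \o chart_inv p)
}.

(* The matrix at x of the change of coordinates from chart q to the chart      *)
(* indexed by the point of coordinates x in chart q.                           *)
Definition frame_in (R : realType) (d : nat) (M : manifold R d) (q : M)
    (x : 'rV[R]_d) : 'M[R]_d :=
  'J (chart (chart_inv q x) \o chart_inv q) x.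

Definition form_in (R : realType) (d : nat) (M : manifold R d)
    (g : M -> 'M[R]_d) (q : M) (x : 'rV[R]_d) : 'M[R]_d :=
  frame_in q x *m g (chart_inv q x) *m (frame_in q x)^T.

Definition endo_in (R : realType) (d : nat) (M : manifold R d)
    (S : M -> 'M[R]_d) (q : M) (x : 'rV[R]_d) : 'M[R]_d :=
  frame_in q x *m S (chart_inv q x) *m invmx (frame_in q x).

Definition smooth_endo (R : realType) (d : nat) (M : manifold R d) (U : set M)
    (S : M -> 'M[R]_d) : Prop :=
  forall q, smooth_on (chart q @` (chart_dom q `&` U)) (endo_in S q).

Record riemannian (R : realType) (d : nat) := Riemannian {
  rbase :> manifold R d;
  metric : rbase -> 'M[R]_d;
  metric_sym : forall p, (metric p)^T = metric p;
  metric_pos : forall p (u : 'rV[R]_d), u != 0 -> 0 < inner (metric p) u u;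
  metric_smooth : forall q, smooth_on (chart_img q) (form_in metric q)
}.

Section LeviCivita.
Context (R : realType) (d : nat).
(* the Gram matrix of a metric in coordinates *)
Context (G : 'rV[R]_d -> 'M[R]_d).
Implicit Types (x u v w : 'rV[R]_d).

(* nabla_u v at x, for constant coordinate fields u and v, by Koszul's formula *)
Definition christoffel x u v : 'rV[R]_d :=
  2^-1 *: (\row_k (inner ('D_u G x) v (delta_mx 0 k)
                   + inner ('D_v G x) u (delta_mx 0 k)
                   - inner ('D_(delta_mx 0 k) G x) u v)) *m invmx (G x).

(* R(u, v) w = nabla_u nabla_v w - nabla_v nabla_u w for constant u, v, w *)
Definition curvature x u v w : 'rV[R]_d :=
  ('D_u (fun y => christoffel y v w) x + christoffel x u (christoffel x v w))
  - ('D_v (fun y => christoffel y u w) x + christoffel x v (christoffel x u w)).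

Definition sectional x u v : R :=
  inner (G x) (curvature x u v v) u
  / (inner (G x) u u * inner (G x) v v - inner (G x) u v ^+ 2).

(* (nabla_u S) v = nabla_u (S v) - S (nabla_u v), for an endomorphism field S *)
Definition cov_endo (S : 'rV[R]_d -> 'M[R]_d) x u : 'M[R]_d :=
  'D_u S x + S x *m lin1_mx (christoffel x u) - lin1_mx (christoffel x u) *m S x.

End LeviCivita.

Section Quaternionic.
Context (R : realType) (d : nat) (M : riemannian R d).
(* sigma p is the fibre at p of the bundle sigma, in End(T_p M) *)
Context (sigma : M -> set 'M[R]_d).

(* J_1, J_2, J_3 are indexed by 'I_3, whose addition is modulo 3. The          *)
(* composition J_a J_(a+1) of operators is the matrix J (a + 1) *m J a.        *)
Definition canonical_basis (p : M) (J : 'I_3 -> 'M[R]_d) : Prop :=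
  [/\ forall a u v, inner (metric p) (u *m J a) (v *m J a) = inner (metric p) u v,
      forall a, J a *m J a = - 1%:M,
      forall a, J (a + 1) *m J a = J (a + 2),
      forall a, J a *m J (a + 1) = - J (a + 2) &
      forall S, sigma p S <-> exists t : 'I_3 -> R, S = \sum_a t a *: J a].

Definition almost_quaternionic_hermitian : Prop :=
  forall p : M, exists (U : set M) (J : 'I_3 -> M -> 'M[R]_d),
    [/\ open U, U p, forall a, smooth_endo U (J a) &
        forall q, U q -> canonical_basis q (fun a => J a q)].

Definition sigma_parallel : Prop :=
  forall (p : M) (U : set M) (S : M -> 'M[R]_d),
    open U -> U p -> smooth_endo U S -> (forall q, U q -> sigma q (S q)) ->
    forall u, sigma p (cov_endo (form_in (@metric R d M) p) (endo_in S p)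
                                (chart p p) u).

Definition quaternionic_kaehler : Prop :=
  almost_quaternionic_hermitian /\ sigma_parallel.

Definition quaternionic_space_form (c : R) : Prop :=
  quaternionic_kaehler /\
  forall (p : M) (J : 'I_3 -> 'M[R]_d) (X Y Z : 'rV[R]_d),
    canonical_basis p J -> X != 0 ->
    (Y <= X + \sum_(a < 3) <<X *m J a>>)%MS ->
    (Z <= X + \sum_(a < 3) <<X *m J a>>)%MS ->
    row_free (col_mx Y Z) ->
    sectional (form_in (@metric R d M) p) (chart p p) Y Z = c.

End Quaternionic.

(* A submanifold is given by a smooth immersion; locally it is a parametrized  *)
(* submanifold F : 'rV_n -> 'rV_N of a coordinate domain with Gram matrix G.   *)
Section Parametrized.
Context (R : realType) (n N : nat).
Context (G : 'rV[R]_N -> 'M[R]_N) (F : 'rV[R]_n -> 'rV[R]_N).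
Implicit Types (x u v : 'rV[R]_n) (xi : 'rV[R]_N).

Definition induced x : 'M[R]_n := 'J F x *m G (F x) *m ('J F x)^T.

(* For V tangent to the ambient space at F x, tan_part x V is the tangent      *)
(* vector of the submanifold whose image by dF is the tangential part of V.    *)
Definition tan_part x (V : 'rV[R]_N) : 'rV[R]_n :=
  V *m G (F x) *m ('J F x)^T *m invmx (induced x).

Definition nor_part x (V : 'rV[R]_N) : 'rV[R]_N := V - tan_part x V *m 'J F x.

(* ambient covariant derivative, along F, of a vector field V along F *)
Definition cov (V : 'rV[R]_n -> 'rV[R]_N) x u : 'rV[R]_N :=
  'D_u V x + christoffel G (F x) (u *m 'J F x) (V x).

Definition second_form x u v : 'rV[R]_N :=
  nor_part x (cov (fun y => v *m 'J F y) x u).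

(* extension of xi, normal at x, to a normal field *)
Definition nor_ext xi : 'rV[R]_n -> 'rV[R]_N := fun y => nor_part y xi.

Definition shape x xi u : 'rV[R]_n := - tan_part x (cov (nor_ext xi) x u).

Definition nor_cov (V : 'rV[R]_n -> 'rV[R]_N) x u : 'rV[R]_N :=
  nor_part x (cov V x u).

Definition nor_curvature x u v xi : 'rV[R]_N :=
  nor_cov (fun y => nor_cov (nor_ext xi) y v) x u
  - nor_cov (fun y => nor_cov (nor_ext xi) y u) x v.

End Parametrized.

Definition local_rep (R : realType) (n N : nat) (M : manifold R n)
    (Mbar : manifold R N) (f : M -> Mbar) (p : M) : 'rV[R]_n -> 'rV[R]_N :=
  chart (f p) \o f \o chart_inv p.

Record immersion (R : realType) (n N : nat) (M : manifold R n)
    (Mbar : manifold R N) := Immersion {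
  imm :> M -> Mbar;
  imm_continuous : continuous imm;
  imm_smooth : forall p,
    smooth_on (chart p @` (chart_dom p `&` imm @^-1` chart_dom (imm p)))
              (local_rep imm p);
  imm_free : forall p, row_free ('J (local_rep imm p) (chart p p))
}.

Section Submanifold.
Context (R : realType) (n N : nat) (M : manifold R n) (Mbar : riemannian R N).
Context (f : immersion M Mbar).
Implicit Types (p : M) (u v : 'rV[R]_n) (xi : 'rV[R]_N).

Let G p := form_in (@metric R N Mbar) (f p).
Let F p := local_rep f p.

Definition df p u : 'rV[R]_N := u *m 'J (F p) (chart p p).
Definition gM p : 'M[R]_n := induced (G p) (F p) (chart p p).
Definition tan_comp p (V : 'rV[R]_N) : 'rV[R]_n :=
  tan_part (G p) (F p) (chart p p) V.
Definition nor_comp p (V : 'rV[R]_N) : 'rV[R]_N :=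
  nor_part (G p) (F p) (chart p p) V.
Definition second_fund p u v : 'rV[R]_N := second_form (G p) (F p) (chart p p) u v.
Definition shape_op p xi u : 'rV[R]_n := shape (G p) (F p) (chart p p) xi u.
Definition sec_curv p u v : R := sectional (induced (G p) (F p)) (chart p p) u v.

(* the rows of E are an orthonormal family of T_p M *)
Definition tangent_orthonormal p (s : nat) (E : 'M[R]_(s, n)) : Prop :=
  E *m gM p *m E^T = 1%:M.

(* the rows of E are an orthonormal basis of the normal space at p *)
Definition normal_frame p (E : 'M[R]_(N - n, N)) : Prop :=
  E *m metric (f p) *m E^T = 1%:M /\ forall i, tan_comp p (row i E) = 0.

(* Below, orthonormal bases are chosen; the values do not depend on the choice. *)
Definition onb p : 'M[R]_n := xget 0 [set E | tangent_orthonormal p E].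
Definition onb_sub p (L : 'M[R]_n) : 'M[R]_(\rank L, n) :=
  xget 0 [set E | tangent_orthonormal p E /\ (E :=: L)%MS].
Definition nor_onb p : 'M[R]_(N - n, N) := xget 0 [set E | normal_frame p E].

Definition tau p : R :=
  \sum_(i < n) \sum_(j < n | (i < j)%N) sec_curv p (row i (onb p)) (row j (onb p)).

Definition rho p : R := 2 * tau p / (n%:R * (n%:R - 1)).

Definition casorati_basis p (s : nat) (E : 'M[R]_(s, n)) : R :=
  s%:R^-1 * \sum_(al < N - n) \sum_(i < s) \sum_(j < s)
    inner (metric (f p)) (second_fund p (row i E) (row j E)) (row al (nor_onb p)) ^+ 2.

Definition casorati p : R := casorati_basis p (onb p).

(* a linear subspace of T_p M is represented by the row space of a matrix *)
Definition casorati_sub p (L : 'M[R]_n) : R := casorati_basis p (onb_sub p L).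

Definition hyperplane_casorati p : set R :=
  [set casorati_sub p L | L in [set L : 'M[R]_n | (\rank L).+1 = n]].

Definition deltaC (r : R) p : R :=
  r * casorati p
  + (n%:R - 1) * (n%:R + r) * (n%:R ^+ 2 - n%:R - r) / (r * n%:R)
    * inf (hyperplane_casorati p).

Definition deltaC_hat (r : R) p : R :=
  r * casorati p
  - (n%:R - 1) * (n%:R + r) * (r - n%:R ^+ 2 + n%:R) / (r * n%:R)
    * sup (hyperplane_casorati p).

Definition trivial_normal_connection : Prop :=
  forall p u v xi, tan_comp p xi = 0 ->
    nor_curvature (G p) (F p) (chart p p) u v xi = 0.

(* Each shape operator has an eigenvalue lam on the hyperplane orthogonal to   *)
(* the distinguished eigenvector u. The other eigenvalue mu may equal lam:     *)
(* totally umbilical directions are allowed.                                   *)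
Definition invariantly_quasi_umbilical : Prop :=
  forall p, exists (E : 'M[R]_(N - n, N)) (u : 'rV[R]_n),
    [/\ normal_frame p E, u != 0 &
        forall al, exists lam mu : R,
          shape_op p (row al E) u = mu *: u /\
          forall v, inner (gM p) v u = 0 -> shape_op p (row al E) v = lam *: v].

(* wrt the rows of E and E', A_(n+1) = diag(a, ..., a, b) and the other A_k = 0 *)
Definition shape_form p (E : 'M[R]_n) (E' : 'M[R]_(N - n, N)) (a b : R) : Prop :=
  forall (al : 'I_(N - n)) (i : 'I_n),
    shape_op p (row al E') (row i E) =
      (if (al == 0 :> nat)%N then (if (i.+1 == n)%N then b else a) else 0)
        *: row i E.

Context (sigma : Mbar -> set 'M[R]_N).

(* angle between a vector V at f p and the subspace df (T_p M) *)
Definition angle p (V : 'rV[R]_N) : R :=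
  acos (gnorm (metric (f p)) (df p (tan_comp p V)) / gnorm (metric (f p)) V).

Definition slant (theta : R) : Prop :=
  forall p (J : 'I_3 -> 'M[R]_N) a u, canonical_basis sigma (f p) J ->
    u != 0 -> angle p (df p u *m J a) = theta.

Definition quaternionic_sub : Prop :=
  forall p (J : 'I_3 -> 'M[R]_N) a u, canonical_basis sigma (f p) J ->
    nor_comp p (df p u *m J a) = 0.

Definition totally_real_sub : Prop :=
  forall p (J : 'I_3 -> 'M[R]_N) a u, canonical_basis sigma (f p) J ->
    tan_comp p (df p u *m J a) = 0.

Definition slant_proper (theta : R) : Prop :=
  [/\ slant theta, ~ quaternionic_sub & ~ totally_real_sub].

End Submanifold.

(* Main.v *)
(* For a unit tangent vector w, let P be the projection onto its orthogonal
   hyperplane L. By the Gauss equation and the form of the ambient curvature (which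
   the definition gives only through sectional curvatures: parallelism of sigma and
   polarization recover the full tensor), the gap between the two sides of the
   inequality, with C(L) in place of its infimum or supremum, is a positive multiple
   of the sum over an orthonormal normal basis of
     (r+n)/n tr(H^2) + (n+r)(n^2-n-r)/(rn) tr(HPHP) - (tr H)^2,
   where H is the matrix of the corresponding component of h. This is a sum of
   squares, which vanishes exactly when H = t (P + lam w^T w) with
   lam = n(n-1)/r. The infimum and the supremum are attained, as the hyperplanes are
   parametrized by the unit sphere.

   Hence equality means h(X,Y) = b(X,Y) zeta with
   b = g + (lam - 1) <., e> <., e>, and such an h yields the stated shape operators.
   If c = 0, the Ricci equation then gives a flat normal connection. The case c <> 0
   is impossible: for nu normal to M and to zeta, the Codazzi equation reads
     b(Y,Z) d(X) - b(X,Z) d(Y) = <R(X,Y)Z, nu>,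
   and evaluating it on e and its images under the tangential parts P_a of J_a,
   which form a slant quaternionic triple, forces <J_a e, nu> = 0 for all a. So the
   normal parts of J_1 e and J_2 e are multiples of zeta; they are orthogonal and
   both have norm sin theta <> 0, a contradiction. *)
Require Import Defs.
From HB Require Import structures.
From mathcomp Require Import all_boot all_order all_algebra.
From mathcomp Require Import all_classical all_reals all_analysis.
From mathcomp Require Import ring lra.
Import Order.TTheory GRing.Theory Num.Theory.
Import numFieldNormedType.Exports.
Set Implicit Arguments.
Unset Strict Implicit.
Unset Printing Implicit Defensive.
Local Open Scope classical_set_scope.
Local Open Scope ring_scope.

(** * Symmetry of second derivatives *)

(** Tensors at a point are recorded in the chart indexed by that very point, and parallelism of
    [sigma] or injectivity of the differential are stated only there. An identity known at all
    nearby points must be carried into one fixed chart before it can be differentiated, whence the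
    transformation laws for connections, second fundamental forms and endomorphism fields. The data
    (e, zeta) of the equality case have no regularity in the point. The Codazzi equation is
    therefore applied to h = phi Z with Z = h(e, e), e frozen in coordinates, near a point where
    zeta does not vanish; if there is none, h is identically zero. The full curvature tensor is
    found from its difference S with the model: S vanishes on quaternionic lines, this kills its
    commutators with the J_a, and a curvature tensor of Kaehler type without holomorphic sectional
    curvature is zero. The P_a anticommute because the slant angle is the same for rotated canonical
    bases. P_1 P_2 is not tied to P_3: the inner product of P_1 P_2 e with P_3 e is an unknown that
    has to be eliminated, and lam <> 1, that is r <> n(n-1), is used there. *)

Section NearDifferentiable.
Context (R : realType) (V W : normedModType R).
Implicit Types (f g : V -> W) (x : V).

Lemma near_eq_differentiable f g x :
  (\near x, f x = g x) -> differentiable f x -> differentiable g x.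
Proof.
move=> fg df.
suff H : g \o shift x = cst (g x) + 'd f x +o_ 0 id.
  have dE : 'd g x = 'd f x :> (V -> W).
    by apply: diff_unique => //; exact: diff_continuous.
  by apply/diff_locallyP; split; rewrite dE //; exact: diff_continuous.
apply/eqaddoE/eqaddoP => _/posnumP[e].
have /eqaddoP/(_ e%:num (gt0 e)) := diff_locally df.
move: fg => /nbhs_ballP[d /= d0 fg] H.
have fgx : f x = g x by apply: fg; exact: ballxx.
have := H; apply: filterS2; last by apply: (nbhsx_ballx (0 : V) d).
move=> h; rewrite -ball_normE /= sub0r normrN => hd.
rewrite !fctE /= fgx fg // -ball_normE /= opprD [- h - x]addrC addrA subrr.
by rewrite sub0r normrN.
Qed.
End NearDifferentiable.

Section Schwarz.
Context (R : realType) (V : normedModType R).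

Lemma is_derive_line (f : V -> R) (a u : V) (t : R) :
  derivable f (a + t *: u) u ->
  is_derive t 1 (fun s => f (a + s *: u)) ('D_u f (a + t *: u)).
Proof.
have E : (fun h : R => h^-1 *: (((fun s => f (a + s *: u)) \o shift t) (h *: 1)
            - f (a + t *: u)))
    = (fun h : R => h^-1 *: ((f \o shift (a + t *: u)) (h *: u) - f (a + t *: u))).
  apply/funext => h /=; congr (_ *: (f _ - _)).
  by rewrite scalerDl /shift /= addrCA [h *: 1]mulr1.
move=> df; apply: DeriveDef; first by rewrite /derivable E.
by rewrite /derive E.
Qed.

Lemma diff_increment (f : V -> R) (x : V) (e : R) : 0 < e -> differentiable f x ->
  exists2 d, 0 < d & forall w, `|w| < d ->
    `|f (x + w) - f x - 'd f x w| <= e * `|w|.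
Proof.
move=> e0 df.
have /eqaddoP/(_ e e0)/nbhs_ballP[d /= d0 H] := diff_locally df.
exists d => // w wd.
have /= := H w; rewrite -ball_normE /= sub0r normrN => /(_ wd).
by rewrite !fctE /= [w + x]addrC opprD addrA.
Qed.

(** The mean value theorem along [u], applied to t |-> f(x + s v + t u) - f(x + t u), turns the
    second difference into s times an increment of ['D_u f], which the differentiability of ['D_u f]
    at [x] alone controls. *)
Lemma second_difference (f : V -> R) (x u v : V) (e : R) : 0 < e ->
  (\forall y \near x, differentiable f y) -> differentiable ('D_u f) x ->
  exists2 d, 0 < d & forall s, 0 < s -> s < d ->
    `|f (x + s *: u + s *: v) - f (x + s *: u) - f (x + s *: v) + f x
      - s ^+ 2 * 'D_v ('D_u f) x| <= e * s ^+ 2.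
Proof.
move=> e0 /nbhs_ballP[d1 /= d10 H1] du.
(* [K] absorbs the two remainders, taken at xi u + s v and at xi u with xi <= s: these vectors have
   total norm at most s (2 |u| + |v|). The 1 keeps [K] positive. *)
pose K := 2 * `|u| + `|v| + 1.
have K0 : 0 < K by rewrite ltr_wpDl // addr_ge0 // mulr_ge0.
have [d2 d20 H2] := diff_increment (divr_gt0 e0 K0) du.
exists (Num.min d1 d2 / K); first by rewrite divr_gt0 // lt_min d10.
move=> s s0 sd.
have sK : s * K < Num.min d1 d2 by rewrite -ltr_pdivlMr.
have small t r : 0 <= t <= s -> 0 <= r <= s ->
    `|t *: u + r *: v| <= s * (`|u| + `|v|).
  move=> /andP[t0 ts] /andP[r0 rs]; apply: le_trans (ler_normD _ _) _.
  rewrite !normrZ !ger0_norm // mulrDr.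
  by apply: lerD; apply: ler_wpM2r.
have small2 t r : 0 <= t <= s -> 0 <= r <= s ->
    `|t *: u + r *: v| < Num.min d1 d2.
  move=> ht hr; apply: le_lt_trans (small _ _ ht hr) (le_lt_trans _ sK).
  rewrite ler_wpM2l ?ltW // /K; have := normr_ge0 u; lra.
have dfn t r : 0 <= t <= s -> 0 <= r <= s ->
    differentiable f (x + (t *: u + r *: v)).
  move=> ht hr; apply: H1; rewrite -ball_normE /= opprD addrA subrr sub0r normrN.
  by have := small2 _ _ ht hr; rewrite lt_min => /andP[].
pose g t := f (x + s *: v + t *: u) - f (x + t *: u).
have s0s : 0 <= s <= s by rewrite lexx ltW.
have O0s : 0 <= (0 : R) <= s by rewrite lexx ltW.
have dg t : 0 <= t <= s -> is_derive t 1 g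
    ('D_u f (x + s *: v + t *: u) - 'D_u f (x + t *: u)).
  move=> ht; apply: is_deriveB; apply: is_derive_line; apply: diff_derivable.
    by rewrite -addrA [s *: v + _]addrC; exact: dfn.
  by have := dfn t 0 ht O0s; rewrite scale0r addr0.
have [xi] : exists2 xi, xi \in `]0, s[ &
    g s - g 0 = ('D_u f (x + s *: v + xi *: u) - 'D_u f (x + xi *: u)) * (s - 0).
  apply: MVT => //.
    by move=> t; rewrite in_itv /= => /andP[t0 ts]; apply: dg; rewrite !ltW.
  apply: derivable_within_continuous => t; rewrite in_itv /= => ht.
  by have [] := dg t ht.
rewrite in_itv /= => /andP[/ltW xi0 /ltW xis].
have hxi : 0 <= xi <= s by rewrite xi0.
rewrite subr0 /g !scale0r !addr0 => E.
have -> : f (x + s *: u + s *: v) - f (x + s *: u) - f (x + s *: v) + f x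
   = f (x + s *: v + s *: u) - f (x + s *: u) - (f (x + s *: v) - f x).
  by rewrite [x + s *: u + s *: v]addrAC opprD opprK addrA.
rewrite E (deriveE v du).
have A1 := H2 (xi *: u + s *: v) _.
have A2 := H2 (xi *: u) _.
have m2 t r : 0 <= t <= s -> 0 <= r <= s -> `|t *: u + r *: v| < d2.
  by move=> ht hr; have := small2 _ _ ht hr; rewrite lt_min => /andP[].
have {}A1 := A1 (m2 _ _ hxi s0s).
have {}A2 : `|'D_u f (x + xi *: u) - 'D_u f x - 'd ('D_u f) x (xi *: u)| <=
    e / K * `|xi *: u|.
  by apply: A2; have := m2 _ _ hxi O0s; rewrite scale0r addr0.
have -> : x + s *: v + xi *: u = x + (xi *: u + s *: v).
  by rewrite -addrA [s *: v + _]addrC.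
rewrite linearD !linearZ /= in A1; rewrite linearZ /= in A2; move: A1 A2.
set a := 'D_u f _; set c := 'D_u f _; set b := 'D_u f _.
set p := 'd _ _ u; set q := 'd _ _ v => A1 A2.
have -> : (a - b) * s - s ^+ 2 * q = s * ((a - c - (xi *: p + s *: q)) - (b - c - xi *: p)).
  by rewrite /GRing.scale /=; ring.
have -> : e * s ^+ 2 = s * (e * s) by ring.
rewrite normrM (ger0_norm (ltW s0)).
apply: ler_wpM2l; first exact: ltW.
apply: le_trans (ler_normB _ _) _.
apply: le_trans (lerD A1 A2) _.
rewrite -mulrDr mulrAC ler_pdivrMr // -mulrA ler_wpM2l ?ltW //.
have := small _ _ hxi s0s; have := small _ _ hxi O0s.
rewrite scale0r addr0 normrZ ger0_norm // => _ B2.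
have B1 : xi * `|u| <= s * `|u| by rewrite ler_wpM2r.
rewrite /K; have := ltW s0; nra.
Qed.

(** The second difference is symmetric in [u] and [v]. Read in the two orders, it approximates s^2
    times either mixed derivative up to e s^2 / 2, and s^2 > 0 is divided out. *)
Lemma schwarz (f : V -> R) (x u v : V) :
  (\forall y \near x, differentiable f y) ->
  differentiable ('D_u f) x -> differentiable ('D_v f) x ->
  'D_u ('D_v f) x = 'D_v ('D_u f) x.
Proof.
move=> df du dv; apply/eqP; rewrite -subr_eq0 -normr_le0; apply/ler_addgt0Pl => e e0.
rewrite addr0; have e20 : 0 < e / 2 by rewrite divr_gt0.
have [d1 d10 H1] := second_difference v e20 df du.
have [d2 d20 H2] := second_difference u e20 df dv.
pose s := Num.min d1 d2 / 2.
have m0 : 0 < Num.min d1 d2 by rewrite lt_min d10.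
have s0 : 0 < s by rewrite divr_gt0.
have : s < Num.min d1 d2 by rewrite /s; lra.
rewrite lt_min => /andP[s1 s2].
have ss : 0 < s ^+ 2 by rewrite exprn_gt0.
have {H1} := H1 s s0 s1; have {H2} := H2 s s0 s2.
rewrite [x + s *: v + s *: u]addrAC.
set A := f _; set B := f _; set C := f _; set D := f _.
set p := 'D_u _ _; set q := 'D_v _ _ => H2 H1.
clearbody A B C D p q s.
rewrite -(ler_pM2l ss) -[X in X * `|_|](ger0_norm (ltW ss)) -normrM.
have -> : s ^+ 2 * (p - q) = (A - C - B + D - s ^+ 2 * q) - (A - B - C + D - s ^+ 2 * p).
  by ring.
apply: le_trans (ler_normB _ _) _.
apply: le_trans (lerD H1 H2) _; lra.
Qed.

End Schwarz.

(** * Smooth functions *)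

Section SmoothGeneral.
Context (R : realType) (V W : normedModType R) (U : set V).
Hypothesis oU : open U.
Implicit Types (f g : V -> W) (k : nat).

Lemma near_open x : U x -> \forall y \near x, U y.
Proof. by move=> Ux; exact: open_nbhs_nbhs (conj oU Ux). Qed.

Lemma smooth_differentiable f x : smooth_on U f -> U x -> differentiable f x.
Proof. by move=> /(_ 1) [] H _; exact: H. Qed.

Lemma smooth_derive f v : smooth_on U f -> smooth_on U ('D_v f).
Proof. by move=> sf k; have [_] := sf k.+1; apply. Qed.

Lemma smooth_subset f (U' : set V) : U' `<=` U -> smooth_on U f -> smooth_on U' f.
Proof.
move=> UU sf k; have := sf k; elim: k f {sf} => /= [|k IH] f.
  by move=> H x /UU; exact: H.
by move=> [d D]; split=> [x /UU|v]; [exact: d|exact: IH].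
Qed.

Lemma near_eq_open f g x : (forall y, U y -> f y = g y) -> U x -> \near x, f x = g x.
Proof. by move=> fg Ux; apply: filterS (near_open Ux). Qed.

Lemma is_Ck_eq k f g : (forall x, U x -> f x = g x) -> is_Ck k U f -> is_Ck k U g.
Proof.
elim: k f g => /= [|k IH] f g fg.
  move=> H x Ux; have := H x Ux.
  rewrite /prop_for /continuous_at (fg _ Ux); apply: cvg_trans; apply: near_eq_cvg.
  exact: near_eq_open.
move=> [d D]; split=> [x Ux|v].
  by apply: near_eq_differentiable (d _ Ux); exact: near_eq_open.
apply: IH (D v) => x Ux; apply: near_eq_derive; exact: near_eq_open.
Qed.

Lemma smooth_eq f g : (forall x, U x -> f x = g x) -> smooth_on U f -> smooth_on U g.
Proof. by move=> fg sf k; exact: is_Ck_eq (sf k). Qed.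

Lemma is_Ck_cst k (a : W) : is_Ck k U (fun=> a : W).
Proof.
elim: k a => /= [|k IH] a; first by move=> x _; exact: cvg_cst.
split=> [x _|v]; first exact: differentiable_cst.
by apply: (is_Ck_eq _ (IH 0)) => x _; rewrite (derive_cst a).
Qed.

Lemma smooth_cst (a : W) : smooth_on U (fun=> a : W).
Proof. by move=> k; exact: is_Ck_cst. Qed.

Lemma is_CkD k f g : is_Ck k U f -> is_Ck k U g -> is_Ck k U (fun x => f x + g x).
Proof.
elim: k f g => /= [|k IH] f g.
  by move=> cf cg x Ux; apply: continuousD; [exact: cf|exact: cg].
move=> [df Df] [dg Dg]; split=> [x Ux|v].
  by apply: differentiableD; [exact: df|exact: dg].
apply: is_Ck_eq (IH _ _ (Df v) (Dg v)) => x Ux.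
by rewrite (_ : (fun x => _) = f + g) // deriveD //; apply: diff_derivable; auto.
Qed.

Lemma smoothD f g : smooth_on U f -> smooth_on U g -> smooth_on U (fun x => f x + g x).
Proof. by move=> sf sg k; exact: is_CkD. Qed.

Lemma smooth_sum (I : Type) (s : seq I) (F : I -> V -> W) :
  (forall i, smooth_on U (F i)) -> smooth_on U (fun x => \sum_(i <- s) F i x).
Proof.
move=> H; elim: s => [|i s IH].
  by apply: smooth_eq (smooth_cst 0) => x _; rewrite big_nil.
by apply: smooth_eq (smoothD (H i) IH) => x _; rewrite big_cons.
Qed.

End SmoothGeneral.

Lemma smooth_id (R : realType) (V : normedModType R) (U : set V) : open U ->
  smooth_on U (id : V -> V).
Proof.
move=> oU [|k]; first by move=> x _; exact: cvg_id.
split=> [x _|v]; first by have [] := is_diff_id x.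
by apply: is_Ck_eq (is_Ck_cst oU k v) => // x _; rewrite derive_id.
Qed.

Section SmoothScalar.
Context (R : realType) (V : normedModType R) (U : set V).
Hypothesis oU : open U.
Implicit Types (f g : V -> R).

Lemma is_CkS k f : is_Ck k.+1 U f -> is_Ck k U f.
Proof.
elim: k f => [|k IH] f [d D].
  by move=> x Ux; exact: differentiable_continuous (d x Ux).
by split=> // v; exact: IH (D v).
Qed.

Lemma is_CkM k f g : is_Ck k U f -> is_Ck k U g -> is_Ck k U (fun x => f x * g x).
Proof.
elim: k f g => [|k IH] f g cf cg.
  by move=> x Ux; apply: continuousM; [exact: cf|exact: cg].
have [df Df] := cf; have [dg Dg] := cg.
split=> [x Ux|v]; first by apply: differentiableM; auto.
have H : is_Ck k U (fun x => f x * 'D_v g x + g x * 'D_v f x).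
  by apply: is_CkD => //; apply: IH => //; try exact: is_CkS; [exact: Dg|exact: Df].
apply: is_Ck_eq H => // x Ux.
by rewrite (_ : (fun x => _) = f * g) // deriveM //; apply: diff_derivable; auto.
Qed.

Lemma smoothM f g : smooth_on U f -> smooth_on U g -> smooth_on U (fun x => f x * g x).
Proof. by move=> sf sg k; exact: is_CkM. Qed.

Lemma smooth_prod (I : Type) (s : seq I) (F : I -> V -> R) :
  (forall i, smooth_on U (F i)) -> smooth_on U (fun x => \prod_(i <- s) F i x).
Proof.
move=> H; elim: s => [|i s IH].
  apply: (smooth_eq oU (f := fun=> 1 : R)); last exact: smooth_cst.
  by move=> x _; rewrite big_nil.
apply: (smooth_eq oU (f := fun x => F i x * \prod_(i <- s) F i x)).
  by move=> x _; rewrite big_cons.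
exact: smoothM.
Qed.

(** The derivative -f'/f^2 is a polynomial in 1/f and f', so the induction on the order closes on
    1/f itself. *)
Lemma smoothV f : (forall x, U x -> f x != 0) -> smooth_on U f ->
  smooth_on U (fun x => (f x)^-1).
Proof.
move=> f0 sf.
have dV x : U x -> differentiable (fun x => (f x)^-1) x.
  by move=> Ux; apply: differentiableV; [exact: smooth_differentiable Ux|exact: f0].
elim=> /= [|k IH]; first by move=> x /dV/differentiable_continuous.
split=> [|v]; first exact: dV.
have H : is_Ck k U (fun x => (-1) * ((f x)^-1 * (f x)^-1) * 'D_v f x).
  apply: is_CkM; last exact: smooth_derive.
  by apply: is_CkM; [exact: is_Ck_cst|exact: is_CkM].
apply: is_Ck_eq H => // x Ux.
rewrite deriveV ?f0 //; last exact: diff_derivable (smooth_differentiable sf Ux).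
by rewrite mulN1r -invfM expr2.
Qed.

End SmoothScalar.

Section SmoothMatrix.
Context (R : realType) (V : normedModType R) (U : set V).
Hypothesis oU : open U.

Lemma differentiable_mxP m n (A : V -> 'M[R]_(m, n)) x :
  differentiable A x <-> forall i j, differentiable (fun y => A y i j) x.
Proof.
split=> [dA i j|dA].
  rewrite (_ : (fun y => A y i j) = (fun B : 'M[R]_(m, n) => B i j : R) \o A) //.
  by apply: differentiable_comp => //; exact: differentiable_coord.
have -> : A = (fun y => \sum_i \sum_j A y i j *: delta_mx i j).
  by apply/funext => y; exact: matrix_sum_delta.
rewrite (_ : (fun y => _) = \sum_i \sum_j (fun y => A y i j *: delta_mx i j)).
  apply: differentiable_sum => i; apply: differentiable_sum => j.
  exact: differentiableZl.
apply/funext => y; rewrite fct_sumE; apply: eq_bigr => i _.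
by rewrite fct_sumE.
Qed.

Lemma derive_mxE m n (A : V -> 'M[R]_(m, n)) x v i j : differentiable A x ->
  'D_v A x i j = 'D_v (fun y => A y i j) x.
Proof. by move=> dA; rewrite derive_mx ?mxE //; exact: diff_derivable. Qed.

Lemma smooth_mxP m n (A : V -> 'M[R]_(m, n)) :
  smooth_on U A <-> forall i j, smooth_on U (fun y => A y i j).
Proof.
split=> [sA i j k|sA k].
  have := sA k; elim: k A {sA} => /= [|k IH] A.
    move=> H x Ux; apply: (@continuous_comp _ _ _ A (fun B : 'M[R]_(m, n) => B i j)).
      exact: H.
    exact: coord_continuous.
  move=> [d D]; split=> [x /d /differentiable_mxP|v]; first exact.
  apply: is_Ck_eq (IH _ (D v)) => // x Ux.
  by rewrite derive_mxE //; exact: d.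
have d (B : V -> 'M[R]_(m, n)) x : (forall i j, smooth_on U (fun y => B y i j)) ->
    U x -> differentiable B x.
  by move=> sB Ux; apply/differentiable_mxP => i j; exact: smooth_differentiable Ux.
elim: k A sA => /= [|k IH] A sA.
  by move=> x Ux; exact: differentiable_continuous (d _ _ sA Ux).
split=> [x|v]; first exact: d.
apply: IH => i j.
apply: (smooth_eq oU (f := 'D_v (fun y => A y i j))); last exact: smooth_derive.
by move=> x Ux; rewrite derive_mxE //; exact: d.
Qed.

Lemma smooth_mulmx m n p (A : V -> 'M[R]_(m, n)) (B : V -> 'M[R]_(n, p)) :
  smooth_on U A -> smooth_on U B -> smooth_on U (fun x => A x *m B x).
Proof.
move=> /smooth_mxP sA /smooth_mxP sB; apply/smooth_mxP => i j.
apply: (smooth_eq oU (f := fun x => \sum_k A x i k * B x k j)).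
  by move=> x _; rewrite mxE.
by apply: smooth_sum => // k; exact: smoothM.
Qed.

Lemma smooth_trmx m n (A : V -> 'M[R]_(m, n)) :
  smooth_on U A -> smooth_on U (fun x => (A x)^T).
Proof.
move=> /smooth_mxP sA; apply/smooth_mxP => i j.
by apply: (smooth_eq oU (f := fun x => A x j i)) => // x _; rewrite mxE.
Qed.

Lemma smooth_scale m n (f : V -> R) (A : V -> 'M[R]_(m, n)) :
  smooth_on U f -> smooth_on U A -> smooth_on U (fun x => f x *: A x).
Proof.
move=> sf /smooth_mxP sA; apply/smooth_mxP => i j.
apply: (smooth_eq oU (f := fun x => f x * A x i j)); last exact: smoothM.
by move=> x _; rewrite mxE.
Qed.

Lemma smooth_det n (A : V -> 'M[R]_n) : smooth_on U A -> smooth_on U (fun x => \det (A x)).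
Proof.
move=> /smooth_mxP sA; rewrite /determinant; apply: smooth_sum => // s.
by apply: smoothM => //; [exact: smooth_cst|exact: smooth_prod].
Qed.

Lemma smooth_invmx n (A : V -> 'M[R]_n) : (forall x, U x -> A x \in unitmx) ->
  smooth_on U A -> smooth_on U (fun x => invmx (A x)).
Proof.
move=> uA sA.
apply: (smooth_eq oU (f := fun x => (\det (A x))^-1 *: \adj (A x))).
  by move=> x Ux; rewrite /invmx uA.
apply: smooth_scale.
  apply: smoothV => //; last exact: smooth_det.
  by move=> x /uA; rewrite unitmxE unitfE.
apply/smooth_mxP => i j.
apply: (smooth_eq oU (f :=
    fun x => (-1) ^+ (j + i) * \det (row' j (col' i (A x))))).
  by move=> x _; rewrite mxE.
apply: smoothM => //; first exact: smooth_cst.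
apply: smooth_det; apply/smooth_mxP => k l; move/smooth_mxP: sA => sA.
by apply: (smooth_eq oU (f := fun x => A x (lift j k) (lift i l))) => // x _;
  rewrite !mxE.
Qed.

Lemma smooth_inner d (G : V -> 'M[R]_d) (u v : V -> 'rV[R]_d) :
  smooth_on U G -> smooth_on U u -> smooth_on U v ->
  smooth_on U (fun x => inner (G x) (u x) (v x)).
Proof.
move=> sG su sv; rewrite /inner.
have /smooth_mxP/(_ 0 0) // : smooth_on U (fun x => u x *m G x *m (v x)^T).
by apply: smooth_mulmx; [exact: smooth_mulmx|exact: smooth_trmx].
Qed.

End SmoothMatrix.

Section SmoothComp.
Context (R : realType) (V : normedModType R) (n : nat).
Context (U : set V) (W : set 'rV[R]_n).
Hypotheses (oU : open U) (oW : open W).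

Lemma derive_comp (g : V -> 'rV[R]_n) (Y : normedModType R) (f : 'rV[R]_n -> Y) x v :
  differentiable g x -> differentiable f (g x) ->
  'D_v (f \o g) x = 'D_('D_v g x) f (g x).
Proof.
move=> dg df; rewrite !deriveE //; last exact: differentiable_comp.
by rewrite diff_comp.
Qed.

Lemma derive_row_sum (Y : normedModType R) (f : 'rV[R]_n -> Y) x v :
  differentiable f x -> 'D_v f x = \sum_i v 0 i *: 'D_(delta_mx 0 i) f x.
Proof.
move=> df; rewrite deriveE // {1}[v]row_sum_delta linear_sum.
by apply: eq_bigr => i _; rewrite linearZ deriveE.
Qed.

(** The chain rule writes the derivative as a finite sum of products of components of ['D_v g] with
    partial derivatives of [f] composed with [g]; the induction on the order therefore runs over all
    [f] at once. *)
Lemma smooth_comp_scalar (g : V -> 'rV[R]_n) (f : 'rV[R]_n -> R) :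
  (forall x, U x -> W (g x)) -> smooth_on U g -> smooth_on W f ->
  smooth_on U (fun x => f (g x)).
Proof.
move=> UW sg sf k; elim: k f sf => [|k IH] f sf.
  move=> x Ux; apply: (@continuous_comp _ _ _ g f).
    exact: differentiable_continuous (smooth_differentiable sg Ux).
  exact: differentiable_continuous (smooth_differentiable sf (UW _ Ux)).
split=> [x Ux|v].
  apply: (@differentiable_comp _ _ _ _ g f).
    exact: (smooth_differentiable sg Ux).
  exact: (smooth_differentiable sf (UW _ Ux)).
have H : is_Ck k U (fun x => \sum_i 'D_v g x 0 i * 'D_(delta_mx 0 i) f (g x)).
  elim: (index_enum _) => [|i s IHs].
    by apply: is_Ck_eq (is_Ck_cst oU k 0) => // x _; rewrite big_nil.
  apply: (@is_Ck_eq _ _ _ _ oU k (fun x => 'D_v g x 0 i * 'D_(delta_mx 0 i) f (g x)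
     + \sum_(i <- s) 'D_v g x 0 i * 'D_(delta_mx 0 i) f (g x))).
    by move=> x _; rewrite big_cons.
  apply: is_CkD => //; apply: is_CkM => //.
    by have /smooth_mxP/(_ 0 i) := smooth_derive v sg; apply.
  by apply: (IH ('D_(delta_mx 0 i) f)); exact: smooth_derive.
apply: is_Ck_eq H => // x Ux.
rewrite (_ : (fun x => _) = f \o g) // derive_comp; first last.
- exact: (smooth_differentiable sf (UW _ Ux)).
- exact: (smooth_differentiable sg Ux).
rewrite derive_row_sum //.
exact: (smooth_differentiable sf (UW _ Ux)).
Qed.

Lemma smooth_comp m p (g : V -> 'rV[R]_n) (f : 'rV[R]_n -> 'M[R]_(m, p)) :
  (forall x, U x -> W (g x)) -> smooth_on U g -> smooth_on W f ->
  smooth_on U (fun x => f (g x)).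
Proof.
move=> UW sg /(smooth_mxP oW) sf; apply/smooth_mxP => // i j.
exact: (smooth_comp_scalar UW sg (sf i j)).
Qed.

Lemma smooth_jacobian m (f : 'rV[R]_n -> 'rV[R]_m) :
  smooth_on W f -> smooth_on W (fun x => 'J f x).
Proof.
move=> sf; apply/smooth_mxP => // i j.
apply: (smooth_eq oW (f := fun x => 'D_(delta_mx 0 i) f x 0 j)).
  move=> x Wx; rewrite deriveEjacobian; last exact: smooth_differentiable Wx.
  by rewrite -rowE mxE.
by have /smooth_mxP := smooth_derive (delta_mx 0 i) sf; apply.
Qed.

End SmoothComp.

(** * Inner products *)

Section Inner.
Context (R : realType) (d : nat) (G : 'M[R]_d).
Implicit Types (u v w : 'rV[R]_d).

Lemma innerDl u v w : inner G (u + v) w = inner G u w + inner G v w.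
Proof. by rewrite /inner !mulmxDl mxE. Qed.

Lemma innerDr u v w : inner G w (u + v) = inner G w u + inner G w v.
Proof. by rewrite /inner linearD /= mulmxDr mxE. Qed.

Lemma innerZl a u w : inner G (a *: u) w = a * inner G u w.
Proof. by rewrite /inner -!scalemxAl mxE. Qed.

Lemma innerZr a u w : inner G w (a *: u) = a * inner G w u.
Proof. by rewrite /inner linearZ /= -!scalemxAr mxE. Qed.

Lemma innerNl u w : inner G (- u) w = - inner G u w.
Proof. by rewrite -scaleN1r innerZl mulN1r. Qed.

Lemma innerNr u w : inner G w (- u) = - inner G w u.
Proof. by rewrite -scaleN1r innerZr mulN1r. Qed.

Lemma innerBl u v w : inner G (u - v) w = inner G u w - inner G v w.
Proof. by rewrite innerDl innerNl. Qed.

Lemma innerBr u v w : inner G w (u - v) = inner G w u - inner G w v.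
Proof. by rewrite innerDr innerNr. Qed.

Lemma inner0l w : inner G 0 w = 0.
Proof. by rewrite /inner !mul0mx mxE. Qed.

Lemma inner0r w : inner G w 0 = 0.
Proof. by rewrite /inner trmx0 mulmx0 mxE. Qed.

Lemma inner_suml (I : Type) (s : seq I) (P : pred I) (f : I -> 'rV[R]_d) w :
  inner G (\sum_(i <- s | P i) f i) w = \sum_(i <- s | P i) inner G (f i) w.
Proof. by elim/big_rec2: _ => [|i a b _ <-]; rewrite ?inner0l ?innerDl. Qed.

Lemma inner_sumr (I : Type) (s : seq I) (P : pred I) (f : I -> 'rV[R]_d) w :
  inner G w (\sum_(i <- s | P i) f i) = \sum_(i <- s | P i) inner G w (f i).
Proof. by elim/big_rec2: _ => [|i a b _ <-]; rewrite ?inner0r ?innerDr. Qed.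

Definition spd := G^T = G /\ forall u, u != 0 -> 0 < inner G u u.

Lemma inner_tr u v : inner G^T u v = inner G v u.
Proof.
rewrite /inner -[v *m G *m u^T]trmxK [in RHS]mxE.
by rewrite !trmx_mul trmxK mulmxA.
Qed.

Hypothesis spdG : spd.

Lemma innerC u v : inner G u v = inner G v u.
Proof. by rewrite -inner_tr; case: spdG => ->. Qed.

Lemma inner_ge0 u : 0 <= inner G u u.
Proof.
have [->|u0] := eqVneq u 0; first by rewrite inner0l.
by apply: ltW; apply: spdG.2.
Qed.

Lemma inner_eq0 u : inner G u u = 0 -> u = 0.
Proof.
move=> H; apply/eqP; apply: contra_eqT H => u0.
by rewrite gt_eqF //; apply: spdG.2.
Qed.

Lemma inner_inj u v : (forall w, inner G u w = inner G v w) -> u = v.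
Proof.
by move=> H; apply/eqP; rewrite -subr_eq0; apply/eqP/inner_eq0; rewrite innerBl H subrr.
Qed.

Lemma spd_unit : G \in unitmx.
Proof.
rewrite -row_free_unit -kermx_eq0; apply/eqP/row_matrixP => i.
rewrite row0; apply: inner_eq0.
by rewrite /inner -row_mul mulmx_ker row0 mul0mx mxE.
Qed.

Lemma inner_invmx (r w : 'rV[R]_d) :
  inner G (r *m invmx G) w = \sum_k r 0 k * w 0 k.
Proof.
rewrite /inner mulmxKV ?spd_unit // mxE.
by apply: eq_bigr => k _; rewrite mxE.
Qed.

Lemma inner_row_sum u w : inner G u w = \sum_k w 0 k * inner G u (delta_mx 0 k).
Proof. by rewrite {1}[w]row_sum_delta inner_sumr; apply: eq_bigr => k _; rewrite innerZr. Qed.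

End Inner.

Lemma inner_addl (R : realType) d (A B : 'M[R]_d) u v :
  inner (A + B) u v = inner A u v + inner B u v.
Proof. by rewrite /inner mulmxDr mulmxDl mxE. Qed.

Lemma inner_scalel (R : realType) d (a : R) (A : 'M[R]_d) u v :
  inner (a *: A) u v = a * inner A u v.
Proof. by rewrite /inner -scalemxAr -scalemxAl mxE. Qed.

Lemma inner_sum_mx (R : realType) d (I : Type) (s : seq I) (A : I -> 'M[R]_d) u v :
  inner (\sum_(i <- s) A i) u v = \sum_(i <- s) inner (A i) u v.
Proof.
elim: s => [|i s IH]; last by rewrite !big_cons inner_addl IH.
by rewrite !big_nil /inner mulmx0 mul0mx mxE.
Qed.

Lemma inner_rowE (R : realType) n s (G : 'M[R]_n) (E : 'M[R]_(s, n)) v i :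
  (v *m G *m E^T) 0 i = inner G v (row i E).
Proof. by rewrite /inner !mxE; apply: eq_bigr => j _; rewrite !mxE. Qed.

Lemma inner1 (R : realType) n (u : 'rV[R]_n) : inner 1%:M u u = \tr (u *m u^T).
Proof. by rewrite /inner mulmx1 trace_mx11. Qed.

Lemma innerE (R : realType) n (G : 'M[R]_n) u v : inner G u v = (u *m G *m v^T) 0 0.
Proof. by []. Qed.

Lemma inner_mulmx (R : realType) n d (A : 'M[R]_(n, d)) (g : 'M[R]_d) u v :
  inner (A *m g *m A^T) u v = inner g (u *m A) (v *m A).
Proof. by rewrite /inner trmx_mul !mulmxA. Qed.

Lemma inner_invmx_mul (R : realType) n d (A : 'M[R]_(n, d)) (g : 'M[R]_d) (I : 'M[R]_n) V w :
  I \in unitmx -> inner I (V *m g *m A^T *m invmx I) w = inner g V (w *m A).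
Proof. by move=> uI; rewrite /inner mulmxKV // trmx_mul !mulmxA. Qed.

Lemma spd_mulmx (R : realType) n d (A : 'M[R]_(n, d)) (g : 'M[R]_d) :
  row_free A -> spd g -> spd (A *m g *m A^T).
Proof.
move=> fA [gT gp]; split; first by rewrite !trmx_mul trmxK gT mulmxA.
move=> u u0; rewrite inner_mulmx; apply: gp; apply: contra_neq u0 => uA.
by apply: (row_free_inj fA); rewrite uA mul0mx.
Qed.

Section DeriveMatrix.
Context (R : realType) (V : normedModType R).
Implicit Types (x h : V).

Lemma deriveD_fun (W : normedModType R) (f g : V -> W) x h :
  differentiable f x -> differentiable g x ->
  'D_h (fun y => f y + g y) x = 'D_h f x + 'D_h g x.
Proof.
by move=> df dg; rewrite (_ : (fun y => _) = f + g) // deriveD //; exact: diff_derivable.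
Qed.

Lemma deriveZ_fun (W : normedModType R) (a : R) (f : V -> W) x h :
  differentiable f x -> 'D_h (fun y => a *: f y) x = a *: 'D_h f x.
Proof.
by move=> df; rewrite (_ : (fun y => _) = a \*: f) // deriveZ //; exact: diff_derivable.
Qed.

Lemma derive_lin_comb (W : normedModType R) (a : R) (f g : V -> W) x h :
  differentiable f x -> differentiable g x ->
  'D_h (fun y => a *: f y + g y) x = a *: 'D_h f x + 'D_h g x.
Proof.
move=> df dg; rewrite -deriveZ_fun // -deriveD_fun //; exact: differentiableZ.
Qed.

Lemma derive_sum_fun (I : Type) (s : seq I) (W : normedModType R) (f : I -> V -> W) x h :
  (forall i, differentiable (f i) x) ->
  'D_h (fun y => \sum_(i <- s) f i y) x = \sum_(i <- s) 'D_h (f i) x.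
Proof.
move=> df; elim: s => [|i s IH].
  rewrite big_nil (_ : (fun y => _) = cst 0) ?derive_cst //.
  by apply/funext => y; rewrite big_nil.
rewrite big_cons -IH -deriveD_fun //.
  by congr ('D_h _ x); apply/funext => y; rewrite big_cons.
elim: {IH} s => [|j s IH].
  rewrite (_ : (fun y => _) = cst 0); first exact: differentiable_cst.
  by apply/funext => y; rewrite big_nil.
rewrite (_ : (fun y => _) = f j + (fun y => \sum_(i <- s) f i y)).
  exact: differentiableD.
by apply/funext => y; rewrite big_cons.
Qed.

Lemma deriveM_fun (f g : V -> R) x h :
  differentiable f x -> differentiable g x ->
  'D_h (fun y => f y * g y) x = 'D_h f x * g x + f x * 'D_h g x.
Proof.
move=> df dg; rewrite (_ : (fun y => _) = f * g) // deriveM; try exact: diff_derivable.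
by rewrite addrC /GRing.scale /= [g x * _]mulrC.
Qed.

Lemma derive_mulmx m n p (A : V -> 'M[R]_(m, n)) (B : V -> 'M[R]_(n, p)) x h :
  differentiable A x -> differentiable B x ->
  'D_h (fun y => A y *m B y) x = 'D_h A x *m B x + A x *m 'D_h B x.
Proof.
move=> dA dB; have /differentiable_mxP dA' := dA; have /differentiable_mxP dB' := dB.
have E i j : (fun y => (A y *m B y) i j) = (fun y => \sum_k A y i k * B y k j).
  by apply/funext => y; rewrite mxE.
have dM i j k : differentiable (fun y => A y i k * B y k j) x.
  exact: differentiableM.
have dAB : differentiable (fun y => A y *m B y) x.
  apply/differentiable_mxP => i j; rewrite E.
  rewrite (_ : (fun y => _) = \sum_k (fun y => A y i k * B y k j)).
    by apply: differentiable_sum => k; exact: dM.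
  by apply/funext => y; rewrite fct_sumE.
apply/matrixP => i j; rewrite derive_mxE // E derive_sum_fun; last exact: dM.
rewrite !mxE -big_split; apply: eq_bigr => k _ /=.
by rewrite deriveM_fun // !derive_mxE.
Qed.

Lemma derive_mulmx_cst m n p (A : 'M[R]_(m, n)) (B : V -> 'M[R]_(n, p)) x h :
  differentiable B x -> 'D_h (fun y => A *m B y) x = A *m 'D_h B x.
Proof.
move=> dB; rewrite (@derive_mulmx _ _ _ (fun=> A)) //; first by rewrite (derive_cst A) mul0mx add0r.
Qed.

Lemma derive_scale m n (f : V -> R) (A : V -> 'M[R]_(m, n)) x h :
  differentiable f x -> differentiable A x ->
  'D_h (fun y => f y *: A y) x = 'D_h f x *: A x + f x *: 'D_h A x.
Proof.
move=> df dA; have /differentiable_mxP dA' := dA.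
have E i j : (fun y => (f y *: A y) i j) = (fun y => f y * A y i j).
  by apply/funext => y; rewrite mxE.
apply/matrixP => i j; rewrite derive_mxE ?E ?deriveM_fun // ?mxE ?derive_mxE ?mxE //.
apply/differentiable_mxP => k l; rewrite E; exact: differentiableM.
Qed.

Lemma derive_trmx m n (A : V -> 'M[R]_(m, n)) x h : differentiable A x ->
  'D_h (fun y => (A y)^T) x = ('D_h A x)^T.
Proof.
move=> dA; have /differentiable_mxP dA' := dA.
have E i j : (fun y => (A y)^T i j) = (fun y => A y j i).
  by apply/funext => y; rewrite mxE.
apply/matrixP => i j; rewrite [RHS]mxE !derive_mxE ?E //.
by apply/differentiable_mxP => k l; rewrite E.
Qed.

Lemma derive_inner d (G : V -> 'M[R]_d) (a b : V -> 'rV[R]_d) x h :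
  differentiable G x -> differentiable a x -> differentiable b x ->
  'D_h (fun y => inner (G y) (a y) (b y)) x =
    inner ('D_h G x) (a x) (b x) + inner (G x) ('D_h a x) (b x)
    + inner (G x) (a x) ('D_h b x).
Proof.
move=> dG da db; rewrite /inner.
have daG : differentiable (fun y => a y *m G y) x.
  apply/differentiable_mxP => i j.
  rewrite (_ : (fun y => _) = \sum_k (fun y => a y i k * G y k j)).
    apply: differentiable_sum => k.
    by apply: differentiableM; [move/differentiable_mxP: da|move/differentiable_mxP: dG].
  by apply/funext => y; rewrite fct_sumE mxE.
have dbT : differentiable (fun y => (b y)^T) x.
  apply/differentiable_mxP => i j; move/differentiable_mxP: db => /(_ j i).
  by rewrite (_ : (fun y => (b y)^T i j) = (fun y => b y j i)) //; apply/funext => y; rewrite mxE.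
rewrite -derive_mxE; last first.
  apply/differentiable_mxP => i j.
  rewrite (_ : (fun y => _) = \sum_k (fun y => (a y *m G y) i k * (b y)^T k j)).
    apply: differentiable_sum => k.
    by apply: differentiableM; [move/differentiable_mxP: daG|move/differentiable_mxP: dbT].
  by apply/funext => y; rewrite fct_sumE mxE.
rewrite derive_mulmx // derive_mulmx // derive_trmx // mulmxDl.
by rewrite [LHS]mxE [X in X + _]mxE; congr (_ + _); exact: addrC.
Qed.

Lemma derive_inner_cst d (G : V -> 'M[R]_d) (u v : 'rV[R]_d) x h :
  differentiable G x ->
  inner ('D_h G x) u v = 'D_h (fun y => inner (G y) u v) x.
Proof.
move=> dG; rewrite derive_inner //; try exact: differentiable_cst.
by rewrite (derive_cst u) (derive_cst v) inner0l inner0r !addr0.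
Qed.

End DeriveMatrix.

(* Otherwise unification unfolds derivatives when it compares Christoffel symbols. *)
#[local] Opaque inner derive.

(** * The Levi-Civita connection *)

Section Koszul.
Context (R : realType) (d : nat) (g : 'M[R]_d) (D : 'rV[R]_d -> 'M[R]_d).
Hypotheses (spdg : spd g) (DD : forall u v, D (u + v) = D u + D v).
Hypotheses (DZ : forall a u, D (a *: u) = a *: D u).
Hypothesis (DC : forall h u v, inner (D h) u v = inner (D h) v u).
Implicit Types (u v w : 'rV[R]_d).

(* The connection of a metric whose value is g and whose derivative is D. *)
Definition koszul_connection u v : 'rV[R]_d :=
  2^-1 *: (\row_k (inner (D u) v (delta_mx 0 k) + inner (D v) u (delta_mx 0 k)
                   - inner (D (delta_mx 0 k)) u v)) *m invmx g.
Local Notation Gam := koszul_connection.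

(** Linearity of [D] in the direction carries the formula from the basis vectors of the definition
    to an arbitrary [w]. *)
Lemma koszul u v w : inner g (Gam u v) w =
  2^-1 * (inner (D u) v w + inner (D v) u w - inner (D w) u v).
Proof.
have D0 : D 0 = 0 by rewrite -[0 in LHS](scale0r 0) DZ scale0r.
have Dsum (f : 'I_d -> 'rV[R]_d) : D (\sum_k f k) = \sum_k D (f k).
  by elim/big_rec2: _ => [|i a b _ <-].
rewrite /Gam -scalemxAl innerZl; congr (_ * _).
rewrite (inner_invmx spdg) {4}[w]row_sum_delta Dsum inner_sum_mx.
rewrite (inner_row_sum (D u) v w) (inner_row_sum (D v) u w) -big_split -sumrB.
by apply: eq_bigr => k _ /=; rewrite mxE DZ inner_scalel; ring.
Qed.

Lemma koszulC u v : Gam u v = Gam v u.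
Proof.
apply: (inner_inj spdg) => w; rewrite !koszul.
by rewrite [inner _ u v]DC [X in X - _]addrC.
Qed.

Lemma koszulDr u v w : Gam u (v + w) = Gam u v + Gam u w.
Proof.
apply: (inner_inj spdg) => z; rewrite innerDl !koszul DD inner_addl !innerDl !innerDr; ring.
Qed.

Lemma koszulZr a u v : Gam u (a *: v) = a *: Gam u v.
Proof.
apply: (inner_inj spdg) => z; rewrite innerZl !koszul DZ inner_scalel !innerZl !innerZr; ring.
Qed.

Lemma koszul_compat u v w : inner (D u) v w = inner g (Gam u v) w + inner g v (Gam u w).
Proof.
rewrite [inner g v _](innerC spdg) !koszul.
rewrite [inner (D w) u v]DC [inner (D v) u w]DC [inner (D w) v u]DC [inner (D u) w v]DC.
by field.
Qed.

(** Symmetry of [T] combines three instances of compatibility into Koszul's formula. This serves to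
    recognize the tangential part of an ambient derivative as the connection of the induced
    metric. *)
Lemma koszul_unique (T : 'rV[R]_d -> 'rV[R]_d -> 'rV[R]_d) :
  (forall u v, T u v = T v u) ->
  (forall u v w, inner (D u) v w = inner g (T u v) w + inner g v (T u w)) ->
  forall u v, T u v = Gam u v.
Proof.
move=> TC Tc u v; apply: (inner_inj spdg) => w; rewrite koszul !Tc.
rewrite [inner g v _](innerC spdg) [inner g u (T v w)](innerC spdg).
rewrite [inner g u (T w v)](innerC spdg) (TC v u) (TC w v) (TC w u).
by field.
Qed.

End Koszul.

Lemma derive_bilinear_sum (R : realType) (d : nat) (V : normedModType R)
    (C : 'I_d -> 'I_d -> 'rV[R]_d -> 'rV[R]_d) (F a b : V -> 'rV[R]_d) (x h : V) :
  (forall i j, differentiable (C i j) (F x)) -> differentiable F x ->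
  differentiable a x -> differentiable b x ->
  'D_h (fun y => \sum_i \sum_j (a y 0 i * b y 0 j) *: C i j (F y)) x =
    \sum_i \sum_j (a x 0 i * b x 0 j) *: 'D_('D_h F x) (C i j) (F x)
    + \sum_i \sum_j ('D_h a x 0 i * b x 0 j) *: C i j (F x)
    + \sum_i \sum_j (a x 0 i * 'D_h b x 0 j) *: C i j (F x).
Proof.
move=> dC dF da db.
have /differentiable_mxP da' := da; have /differentiable_mxP db' := db.
have dCF i j : differentiable (fun y => C i j (F y)) x.
  exact: (@differentiable_comp _ _ _ _ F (C i j)).
have dab i j : differentiable (fun y => a y 0 i * b y 0 j) x by exact: differentiableM.
have dM i j : differentiable (fun y => (a y 0 i * b y 0 j) *: C i j (F y)) x.
  apply/differentiable_mxP => k l; move/differentiable_mxP: (dCF i j) => dCF'.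
  rewrite (_ : (fun y => _) = (fun y => (a y 0 i * b y 0 j) * C i j (F y) k l)).
    exact: differentiableM.
  by apply/funext => y; rewrite mxE.
rewrite derive_sum_fun; last first.
  move=> i; rewrite (_ : (fun y => _) = \sum_j (fun y => (a y 0 i * b y 0 j) *: C i j (F y))).
    by apply: differentiable_sum => j; exact: dM.
  by apply/funext => y; rewrite fct_sumE.
rewrite -!big_split; apply: eq_bigr => i _ /=.
rewrite derive_sum_fun; last by move=> j; exact: dM.
rewrite -!big_split; apply: eq_bigr => j _ /=.
rewrite derive_scale // deriveM_fun // (derive_mxE _ _ _ da) (derive_mxE _ _ _ db).
rewrite (_ : 'D_h (fun y => C i j (F y)) x = 'D_('D_h F x) (C i j) (F x)); last first.
  exact: (derive_comp h dF (dC i j)).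
by rewrite addrC scalerDl -addrA addrC -addrA.
Qed.

Section LeviCivitaConnection.
Context (R : realType) (d : nat) (O : set 'rV[R]_d) (G : 'rV[R]_d -> 'M[R]_d).
Hypotheses (oO : open O) (sG : smooth_on O G) (spdG : forall x, O x -> spd (G x)).
Implicit Types (x u v w : 'rV[R]_d).

Let dG x : O x -> differentiable G x.
Proof. exact: smooth_differentiable. Qed.

Let DG x h := 'D_h G x.

Let DGD x u v : O x -> DG x (u + v) = DG x u + DG x v.
Proof. by move=> /dG dx; rewrite /DG !deriveE // linearD. Qed.

Let DGZ x a u : O x -> DG x (a *: u) = a *: DG x u.
Proof. by move=> /dG dx; rewrite /DG !deriveE // linearZ. Qed.

Let DGC x h u v : O x -> inner (DG x h) u v = inner (DG x h) v u.
Proof.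
move=> Ox; rewrite /DG; have E : 'D_h (fun y => (G y)^T) x = 'D_h G x.
  by apply: near_eq_derive; apply: near_eq_open Ox => // y Oy; case: (spdG Oy) => ->.
by rewrite -[RHS]inner_tr -derive_trmx ?E //; exact: dG.
Qed.

Lemma christoffelC x u v : O x -> christoffel G x u v = christoffel G x v u.
Proof.
by move=> Ox; apply: (@koszulC _ _ (G x) (DG x)) => *; [exact: spdG|exact: DGD|exact: DGZ|exact: DGC].
Qed.

Lemma christoffelDr x u v w : O x ->
  christoffel G x u (v + w) = christoffel G x u v + christoffel G x u w.
Proof.
by move=> Ox; apply: (@koszulDr _ _ (G x) (DG x)) => *; [exact: spdG|exact: DGD|exact: DGZ].
Qed.

Lemma christoffelZr x a u v : O x ->
  christoffel G x u (a *: v) = a *: christoffel G x u v.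
Proof.
by move=> Ox; apply: (@koszulZr _ _ (G x) (DG x)) => *; [exact: spdG|exact: DGD|exact: DGZ].
Qed.

Lemma christoffelDl x u v w : O x ->
  christoffel G x (v + w) u = christoffel G x v u + christoffel G x w u.
Proof. by move=> Ox; rewrite christoffelC // christoffelDr // !(christoffelC u). Qed.

Lemma christoffelZl x a u v : O x ->
  christoffel G x (a *: v) u = a *: christoffel G x v u.
Proof. by move=> Ox; rewrite christoffelC // christoffelZr // (christoffelC u). Qed.

Lemma christoffel_compat x u v w : O x ->
  inner ('D_u G x) v w =
  inner (G x) (christoffel G x u v) w + inner (G x) v (christoffel G x u w).
Proof.
by move=> Ox; apply: (@koszul_compat _ _ (G x) (DG x)) => *;
  [exact: spdG|exact: DGD|exact: DGZ|exact: DGC].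
Qed.

Lemma christoffel_unique x (T : 'rV[R]_d -> 'rV[R]_d -> 'rV[R]_d) : O x ->
  (forall u v, T u v = T v u) ->
  (forall u v w, inner ('D_u G x) v w = inner (G x) (T u v) w + inner (G x) v (T u w)) ->
  forall u v, T u v = christoffel G x u v.
Proof.
by move=> Ox; apply: (@koszul_unique _ _ (G x) (DG x)) => *;
  [exact: spdG|exact: DGD|exact: DGZ].
Qed.

(** Expanding in constant basis vectors reduces the smoothness and the derivatives of Christoffel
    terms with varying arguments to finitely many coefficient functions. *)
Lemma christoffel_sumE x u v : O x -> christoffel G x u v =
  \sum_i \sum_j (u 0 i * v 0 j) *: christoffel G x (delta_mx 0 i) (delta_mx 0 j).
Proof.
move=> Ox; rewrite {1}[u]row_sum_delta.
have E (f : 'I_d -> 'rV[R]_d) w : christoffel G x (\sum_i f i) w = \sum_i christoffel G x (f i) w.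
  elim: (index_enum _) => [|i s IH]; last by rewrite !big_cons christoffelDl // IH.
  by rewrite !big_nil -[0 in LHS](scale0r 0) christoffelZl // scale0r.
rewrite E; apply: eq_bigr => i _; rewrite christoffelZl // christoffelC //.
rewrite {1}[v]row_sum_delta E scaler_sumr; apply: eq_bigr => j _.
by rewrite christoffelZl // scalerA christoffelC.
Qed.

Lemma smooth_christoffel (V : normedModType R) (U : set V)
    (F a b : V -> 'rV[R]_d) : open U -> (forall y, U y -> O (F y)) ->
  smooth_on U F -> smooth_on U a -> smooth_on U b ->
  smooth_on U (fun y => christoffel G (F y) (a y) (b y)).
Proof.
move=> oU UO sF sa sb.
apply: (smooth_eq oU (f := fun y => \sum_i \sum_j (a y 0 i * b y 0 j) *:
    christoffel G (F y) (delta_mx 0 i) (delta_mx 0 j))).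
  by move=> y Uy; rewrite -christoffel_sumE //; exact: UO.
apply: smooth_sum => // i; apply: smooth_sum => // j; apply: smooth_scale => //.
  by apply: smoothM => //; [move/(smooth_mxP oU): sa|move/(smooth_mxP oU): sb].
apply: (smooth_comp oU oO UO sF (f := fun z => christoffel G z _ _)).
rewrite /christoffel; apply: smooth_mulmx => //; last first.
  by apply: smooth_invmx => // x /spdG/spd_unit.
apply: smooth_scale => //; first exact: smooth_cst.
apply/smooth_mxP => // k l.
set f := fun _ => _.
apply: (smooth_eq oO (f := fun z => inner ('D_(delta_mx 0 i) G z) (delta_mx 0 j) (delta_mx 0 l)
  + inner ('D_(delta_mx 0 j) G z) (delta_mx 0 i) (delta_mx 0 l)
  + (-1) * inner ('D_(delta_mx 0 l) G z) (delta_mx 0 i) (delta_mx 0 j))).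
  by move=> x _; rewrite /f mxE mulN1r.
by apply: smoothD => //; [apply: smoothD => //|apply: smoothM => //; first exact: smooth_cst];
  apply: smooth_inner => //; try exact: smooth_cst; exact: smooth_derive.
Qed.

Lemma derive_christoffel (V : normedModType R) (U : set V)
    (F a b : V -> 'rV[R]_d) (x h : V) : open U -> (forall y, U y -> O (F y)) ->
  smooth_on U F -> smooth_on U a -> smooth_on U b -> U x ->
  'D_h (fun y => christoffel G (F y) (a y) (b y)) x =
    'D_('D_h F x) (fun z => christoffel G z (a x) (b x)) (F x)
    + christoffel G (F x) ('D_h a x) (b x) + christoffel G (F x) (a x) ('D_h b x).
Proof.
move=> oU UO sF sa sb Ux; have OF := UO _ Ux.
have sa' := smooth_differentiable sa Ux; have sb' := smooth_differentiable sb Ux.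
pose C i j z := christoffel G z (delta_mx 0 i) (delta_mx 0 j).
have sC i j : smooth_on O (C i j).
  by apply: (smooth_christoffel (F := id)) => //; [exact: smooth_id|exact: smooth_cst|exact: smooth_cst].
have dC i j : differentiable (C i j) (F x) by exact: smooth_differentiable (sC i j) OF.
rewrite (near_eq_derive (g := fun y => \sum_i \sum_j (a y 0 i * b y 0 j) *: C i j (F y))); last first.
  by apply: near_eq_open Ux => // y Uy; rewrite christoffel_sumE //; exact: UO.
rewrite (@near_eq_derive _ _ _ (fun z => christoffel G z (a x) (b x))
  (fun z => \sum_i \sum_j (a x 0 i * b x 0 j) *: C i j z)); last first.
  by apply: near_eq_open OF => // z Oz; rewrite christoffel_sumE.
rewrite derive_bilinear_sum //; last exact: smooth_differentiable Ux.
rewrite (@derive_bilinear_sum _ _ _ C id (fun=> a x) (fun=> b x)) //; try exact: differentiable_cst; try by have [] := is_diff_id (F x).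
rewrite (derive_cst (a x)) (derive_cst (b x)) derive_id.
rewrite (christoffel_sumE ('D_h a x)) // (christoffel_sumE (a x)) //.
congr (_ + _ + _); rewrite [X in _ = _ + X + _]big1 ?[X in _ = _ + _ + X]big1 ?addr0 //.
  by move=> i _; rewrite big1 // => j _; rewrite mxE mulr0 scale0r.
by move=> i _; rewrite big1 // => j _; rewrite mxE mul0r scale0r.
Qed.

End LeviCivitaConnection.

(** * Covariant derivatives along a map and the fundamental equations *)

Lemma schwarz_mx (R : realType) (V : normedModType R) (U : set V) m n
    (A : V -> 'M[R]_(m, n)) x u v : open U -> smooth_on U A -> U x ->
  'D_u ('D_v A) x = 'D_v ('D_u A) x.
Proof.
move=> oU sA Ux; have dA y (Uy : U y) := smooth_differentiable sA Uy.
have dDA w : differentiable ('D_w A) x.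
  exact: (smooth_differentiable (smooth_derive w sA) Ux).
apply/matrixP => i j.
rewrite -> (derive_mxE u i j (dDA v)).
rewrite -> (derive_mxE v i j (dDA u)).
have sAij := (smooth_mxP oU A).1 sA i j.
have E w z : 'D_w (fun y => 'D_z A y i j) x = 'D_w ('D_z (fun y => A y i j)) x.
  apply: near_eq_derive; apply: near_eq_open Ux => // y Uy.
  by rewrite (derive_mxE z i j (dA _ Uy)).
refine (etrans (E u v) (etrans _ (esym (E v u)))); apply: schwarz.
- by apply: filterS (near_open oU Ux) => y Uy; exact: (smooth_differentiable sAij Uy).
- exact: (smooth_differentiable (smooth_derive _ sAij) Ux).
- exact: (smooth_differentiable (smooth_derive _ sAij) Ux).
Qed.

Section AlongMap.
Context (R : realType) (n d : nat) (O : set 'rV[R]_d) (G : 'rV[R]_d -> 'M[R]_d).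
Hypotheses (oO : open O) (sG : smooth_on O G) (spdG : forall x, O x -> spd (G x)).
Context (U : set 'rV[R]_n) (F : 'rV[R]_n -> 'rV[R]_d).
Hypotheses (oU : open U) (sF : smooth_on U F) (UO : forall x, U x -> O (F x)).
Implicit Types (x u v w : 'rV[R]_n) (V W : 'rV[R]_n -> 'rV[R]_d).

Lemma mul_jacobian x u : U x -> u *m 'J F x = 'D_u F x.
Proof. by move=> Ux; rewrite deriveEjacobian //; exact: smooth_differentiable Ux. Qed.

Lemma smooth_tangent v : smooth_on U (fun y => v *m 'J F y).
Proof. by apply: smooth_mulmx => //; [exact: smooth_cst|exact: smooth_jacobian]. Qed.

(** Both sides are mixed second derivatives of [F]. This symmetry makes the induced connection
    torsion-free and the second fundamental form symmetric. *)
Lemma derive_tangentC x u v : U x ->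
  'D_u (fun y => v *m 'J F y) x = 'D_v (fun y => u *m 'J F y) x.
Proof.
move=> Ux; rewrite (@near_eq_derive _ _ _ _ ('D_v F)); last first.
  by apply: near_eq_open Ux => // y Uy; exact: mul_jacobian.
rewrite (schwarz_mx _ _ oU sF Ux).
by apply: near_eq_derive; apply: near_eq_open Ux => // y Uy; rewrite mul_jacobian.
Qed.

Lemma smooth_metric_along : smooth_on U (fun y => G (F y)).
Proof. exact: (smooth_comp oU oO UO). Qed.

Lemma smooth_cov V u : smooth_on U V -> smooth_on U (fun y => cov G F V y u).
Proof.
move=> sV; rewrite /cov; apply: smoothD => //; first exact: smooth_derive.
apply: (smooth_christoffel oO sG spdG) => //; exact: smooth_tangent.
Qed.

Lemma cov_inner V W x u : smooth_on U V -> smooth_on U W -> U x ->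
  'D_u (fun y => inner (G (F y)) (V y) (W y)) x =
  inner (G (F x)) (cov G F V x u) (W x) + inner (G (F x)) (V x) (cov G F W x u).
Proof.
move=> sV sW Ux; rewrite derive_inner; first last.
- exact: (smooth_differentiable sW Ux).
- exact: (smooth_differentiable sV Ux).
- exact: (smooth_differentiable smooth_metric_along Ux).
have -> : 'D_u (fun y => G (F y)) x = 'D_('D_u F x) G (F x).
  apply: (@derive_comp _ _ _ F _ G); first exact: (smooth_differentiable sF Ux).
  by apply: smooth_differentiable sG (UO Ux).
rewrite (christoffel_compat oO sG spdG) ?UO //; last exact: UO.
rewrite /cov (mul_jacobian u Ux) innerDl innerDr.
by move: ('D_u V x) ('D_u W x) ('D_u F x) => a b c; ring.
Qed.

Lemma covD V W x u : smooth_on U V -> smooth_on U W -> U x ->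
  cov G F (fun y => V y + W y) x u = cov G F V x u + cov G F W x u.
Proof.
move=> sV sW Ux; rewrite /cov (christoffelDr sG spdG) ?UO //; last exact: UO.
rewrite deriveD_fun; [|exact: (smooth_differentiable sV Ux)|exact: (smooth_differentiable sW Ux)].
by rewrite addrACA.
Qed.

Lemma covZ (f : 'rV[R]_n -> R) V x u : smooth_on U f -> smooth_on U V -> U x ->
  cov G F (fun y => f y *: V y) x u = 'D_u f x *: V x + f x *: cov G F V x u.
Proof.
move=> sf sV Ux; rewrite /cov (christoffelZr sG spdG) ?UO //; last exact: UO.
rewrite derive_scale; [|exact: (smooth_differentiable sf Ux)|exact: (smooth_differentiable sV Ux)].
by rewrite scalerDr addrA.
Qed.

Lemma cov_linear_dir V x : smooth_on U V -> U x -> linear (cov G F V x).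
Proof.
move=> sV Ux a u v; have dV := smooth_differentiable sV Ux.
rewrite /cov !deriveE // linearP mulmxDl -scalemxAl.
rewrite (christoffelDl oO sG spdG) ?(christoffelZl oO sG spdG); try exact: UO.
by rewrite scalerDr addrACA.
Qed.

Lemma cov_near_eq V W x u : (\near x, V x = W x) -> cov G F V x u = cov G F W x u.
Proof. by move=> VW; rewrite /cov (nbhs_singleton VW) (near_eq_derive u VW). Qed.

Lemma cov_tangentC x u v : U x ->
  cov G F (fun y => v *m 'J F y) x u = cov G F (fun y => u *m 'J F y) x v.
Proof.
move=> Ux; rewrite /cov derive_tangentC //; congr (_ + _).
by apply: (christoffelC oO sG spdG); exact: UO.
Qed.

(** This is the curvature of the connection pulled back along [F]: [u] and [v] are constant
    coordinate fields, so there is no bracket term, and the second derivatives of [V] and of [F]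
    cancel by symmetry. *)
Lemma cov_curvature V x u v : smooth_on U V -> U x ->
  cov G F (fun y => cov G F V y v) x u - cov G F (fun y => cov G F V y u) x v =
  curvature G (F x) (u *m 'J F x) (v *m 'J F x) (V x).
Proof.
move=> sV Ux; have OF := UO Ux.
have E a b : cov G F (fun y => cov G F V y b) x a =
    'D_a ('D_b V) x
    + ('D_(a *m 'J F x) (fun z => christoffel G z (b *m 'J F x) (V x)) (F x)
       + christoffel G (F x) ('D_a (fun y => b *m 'J F y) x) (V x)
       + christoffel G (F x) (b *m 'J F x) ('D_a V x))
    + (christoffel G (F x) (a *m 'J F x) ('D_b V x)
       + christoffel G (F x) (a *m 'J F x) (christoffel G (F x) (b *m 'J F x) (V x))).
  have sDV := smooth_derive b sV; have sT := smooth_tangent b.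
  have sC : smooth_on U (fun y => christoffel G (F y) (b *m 'J F y) (V y)).
    by apply: (smooth_christoffel oO sG spdG).
  rewrite {1}/cov /cov deriveD_fun; first last.
  - exact: (smooth_differentiable sC Ux).
  - exact: (smooth_differentiable sDV Ux).
  rewrite (derive_christoffel oO sG spdG a oU UO sF sT sV Ux) -mul_jacobian //.
  by rewrite (christoffelDr sG spdG).
rewrite !E /curvature (schwarz_mx v u oU sV Ux) (derive_tangentC v u Ux).
have alg (a p q r s t p' t' : 'rV[R]_d) :
    a + (p + q + r) + (s + t) - (a + (p' + q + s) + (r + t')) = p + t - (p' + t').
  by apply/rowP => j; rewrite !mxE; ring.
exact: alg.
Qed.

End AlongMap.

(** * Algebraic symmetries of the curvature tensor *)

Section CurvatureSymmetries.
Context (R : realType) (d : nat) (O : set 'rV[R]_d) (G : 'rV[R]_d -> 'M[R]_d).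
Hypotheses (oO : open O) (sG : smooth_on O G) (spdG : forall x, O x -> spd (G x)).
Implicit Types (x u v w z : 'rV[R]_d).
Local Notation Rm := (curvature G).

Let sC u v : smooth_on O (fun y => christoffel G y u v).
Proof.
by apply: (smooth_christoffel oO sG spdG (F := id)) => //; [exact: smooth_id|exact: smooth_cst|exact: smooth_cst].
Qed.

Lemma curvature_antisym x u v w : Rm x v u w = - Rm x u v w.
Proof. by rewrite /curvature opprB. Qed.

Lemma curvature_linear x v w : O x -> linear (fun u => Rm x u v w).
Proof.
move=> Ox a u u'.
have dC b c : differentiable (fun y => christoffel G y b c) x.
  exact: smooth_differentiable (sC b c) Ox.
have E1 : 'D_(a *: u + u') (fun y => christoffel G y v w) x =
    a *: 'D_u (fun y => christoffel G y v w) x + 'D_u' (fun y => christoffel G y v w) x.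
  by rewrite !deriveE // linearP.
have E2 : 'D_v (fun y => christoffel G y (a *: u + u') w) x =
    a *: 'D_v (fun y => christoffel G y u w) x + 'D_v (fun y => christoffel G y u' w) x.
  apply: etrans (derive_lin_comb a v (dC u w) (dC u' w)).
  apply: near_eq_derive; apply: near_eq_open Ox => // y Oy.
  by rewrite (christoffelDl oO sG spdG) ?(christoffelZl oO sG spdG).
have F1 c : christoffel G x (a *: u + u') c = a *: christoffel G x u c + christoffel G x u' c.
  by rewrite (christoffelDl oO sG spdG) // (christoffelZl oO sG spdG).
have F2 b c c' : christoffel G x b (a *: c + c') = a *: christoffel G x b c + christoffel G x b c'.
  by rewrite (christoffelDr sG spdG) // (christoffelZr sG spdG).
have alg (p q r s p' q' r' s' : 'rV[R]_d) : a *: p + p' + (a *: q + q') -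
   (a *: r + r' + (a *: s + s')) = a *: (p + q - (r + s)) + (p' + q' - (r' + s')).
  by apply/rowP => j; rewrite !mxE; ring.
rewrite /curvature; rewrite -> E1, E2, !F1, F2; exact: alg.
Qed.

(** Symmetry of the Christoffel symbols, applied also to their derivatives, makes the three
    differences cancel cyclically. *)
Lemma curvature_bianchi x u v w : O x -> Rm x u v w + Rm x v w u + Rm x w u v = 0.
Proof.
move=> Ox.
have E a b c : 'D_a (fun y => christoffel G y b c) x = 'D_a (fun y => christoffel G y c b) x.
  apply: near_eq_derive; apply: near_eq_open Ox => // y Oy.
  exact: (christoffelC oO sG spdG).
have C b c : christoffel G x b c = christoffel G x c b by exact: (christoffelC oO sG spdG).
have alg (p q r p' q' r' : 'rV[R]_d) :
    p + p' - (q + q') + (q + q' - (r + r')) + (r + r' - (p + p')) = 0.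
  by apply/rowP => j; rewrite !mxE; ring.
rewrite /curvature.
rewrite -> (E v u w), (E w v u), (E u w v), (C u w), (C v u), (C w v).
exact: alg.
Qed.

(** The second derivatives of <w, z> along [u] and [v] commute. Expanded by metric compatibility
    with [w] and [z] constant, their mixed terms agree, and what is left is the sum of the two
    curvature pairings. *)
Lemma curvature_skew x u v w z : O x ->
  inner (G x) (Rm x u v w) z = - inner (G x) (Rm x u v z) w.
Proof.
move=> Ox.
have alg (a1 a2 a3 a4 b1 b4 : R) :
    a1 + a2 + (a3 + a4) = b1 + a3 + (a2 + b4) -> a1 - b1 = - (a4 - b4) by clear; lra.
have sid : smooth_on O (id : 'rV[R]_d -> 'rV[R]_d) by exact: smooth_id.
have OO y : O y -> O (id y) by [].
have Jid (a : 'rV[R]_d) : a *m 'J id x = a by rewrite (mul_jacobian sid) // derive_id.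
have sc (b : 'rV[R]_d) : smooth_on O (fun _ : 'rV[R]_d => b) by exact: smooth_cst.
have scov a (V : 'rV[R]_d -> 'rV[R]_d) : smooth_on O V -> smooth_on O (fun y => cov G id V y a).
  by move=> sV; exact: (smooth_cov oO sG spdG oO sid).
pose C b a := fun y => cov G id (fun=> b) y a.
have sCC b a : smooth_on O (C b a) by apply: scov; exact: sc.
have K b : cov G id (C b v) x u - cov G id (C b u) x v = Rm x u v b.
  by rewrite (cov_curvature oO sG spdG oO sid OO u v (sc b) Ox) !Jid.
have D2 a b : 'D_a ('D_b (fun y => inner (G y) w z)) x =
    inner (G x) (cov G id (C w b) x a) z + inner (G x) (C w b x) (C z a x)
    + (inner (G x) (C w a x) (C z b x) + inner (G x) w (cov G id (C z b) x a)).
  rewrite (@near_eq_derive _ _ _ _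
    (fun y => inner (G y) (C w b y) z + inner (G y) w (C z b y))); last first.
    apply: near_eq_open Ox => // y Oy.
    exact: (cov_inner oO sG spdG oO sid OO _ (sc w) (sc z) Oy).
  have si1 : smooth_on O (fun y => inner (G y) (C w b y) z) by exact: smooth_inner.
  have si2 : smooth_on O (fun y => inner (G y) w (C z b y)) by exact: smooth_inner.
  rewrite deriveD_fun; [|exact: (smooth_differentiable si1 Ox)|exact: (smooth_differentiable si2 Ox)].
  rewrite (cov_inner oO sG spdG oO sid OO a (sCC w b) (sc z) Ox).
  by rewrite (cov_inner oO sG spdG oO sid OO a (sc w) (sCC z b) Ox).
have sGi : smooth_on O (fun y => inner (G y) w z) by exact: smooth_inner.
have S : 'D_u ('D_v (fun y => inner (G y) w z)) x = 'D_v ('D_u (fun y => inner (G y) w z)) x.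
  apply: schwarz.
  - by apply: filterS (near_open oO Ox) => y Oy; exact: (smooth_differentiable sGi Oy).
  - exact: (smooth_differentiable (smooth_derive _ sGi) Ox).
  - exact: (smooth_differentiable (smooth_derive _ sGi) Ox).
have H1 := D2 u v; have H2 := D2 v u.
rewrite -> H1 in S.
rewrite -> H2 in S.
clear H1 H2.
have {}S := alg _ _ _ _ _ _ S.
rewrite <- (K w), <- (K z).
rewrite -> (innerBl (G x) _ _ z), (innerBl (G x) _ _ w).
rewrite -> (innerC (spdG Ox) (cov G id (C z v) x u) w).
rewrite -> (innerC (spdG Ox) (cov G id (C z u) x v) w).
exact: S.
Qed.

End CurvatureSymmetries.

Lemma inner_gauss_split (R : realType) d (g : 'M[R]_d) (p q q' r r' z : 'rV[R]_d) :
  inner g (p + (q - q') + (r - r')) z =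
  inner g p z + (inner g q z - inner g q' z) + (inner g r z - inner g r' z).
Proof. by rewrite !innerDl !innerNl. Qed.

(** * Immersions: the equations of Gauss, Codazzi, Weingarten and Ricci *)

Section Immersed.
Context (R : realType) (n d : nat) (O : set 'rV[R]_d) (G : 'rV[R]_d -> 'M[R]_d).
Hypotheses (oO : open O) (sG : smooth_on O G) (spdG : forall x, O x -> spd (G x)).
Context (U : set 'rV[R]_n) (F : 'rV[R]_n -> 'rV[R]_d).
Hypotheses (oU : open U) (sF : smooth_on U F) (UO : forall x, U x -> O (F x)).
Hypothesis fF : forall x, U x -> row_free ('J F x).
Implicit Types (x u v w : 'rV[R]_n) (V W : 'rV[R]_n -> 'rV[R]_d).

Local Notation gI := (Defs.induced G F).
Local Notation tanp := (tan_part G F).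
Local Notation norp := (nor_part G F).
Local Notation II := (second_form G F).
Local Notation T v := (fun y => v *m 'J F y).

Lemma induced_inner x u v : inner (gI x) u v = inner (G (F x)) (u *m 'J F x) (v *m 'J F x).
Proof. exact: inner_mulmx. Qed.

Lemma induced_spd x : U x -> spd (gI x).
Proof. by move=> Ux; apply: spd_mulmx; [exact: fF|exact: spdG (UO Ux)]. Qed.

Lemma smooth_induced : smooth_on U gI.
Proof.
have sJ : smooth_on U (fun x => 'J F x) by exact: smooth_jacobian.
have sGF := smooth_metric_along oO sG oU sF UO.
by apply: smooth_mulmx => //; [exact: smooth_mulmx|exact: smooth_trmx].
Qed.

Lemma inner_tan x (V : 'rV[R]_d) w : U x ->
  inner (gI x) (tanp x V) w = inner (G (F x)) V (w *m 'J F x).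
Proof. by move=> Ux; apply: inner_invmx_mul; exact: spd_unit (induced_spd Ux). Qed.

Lemma tan_part_is_linear x : linear (tanp x).
Proof. by move=> a V W; rewrite /tan_part !mulmxDl -!scalemxAl. Qed.

Lemma norD x (V W : 'rV[R]_d) : norp x (V + W) = norp x V + norp x W.
Proof. by rewrite /nor_part /tan_part !mulmxDl opprD addrACA. Qed.

Lemma norZ x a (V : 'rV[R]_d) : norp x (a *: V) = a *: norp x V.
Proof. by rewrite /nor_part /tan_part -!scalemxAl scalerBr. Qed.

Lemma norB x (V W : 'rV[R]_d) : norp x (V - W) = norp x V - norp x W.
Proof. by rewrite -scaleN1r norD norZ scaleN1r. Qed.

Lemma tan_norE x (V : 'rV[R]_d) : V = tanp x V *m 'J F x + norp x V.
Proof. by rewrite /nor_part addrC subrK. Qed.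

Lemma inner_nor_tangent x (V : 'rV[R]_d) w : U x ->
  inner (G (F x)) (norp x V) (w *m 'J F x) = 0.
Proof. by move=> Ux; rewrite /nor_part innerBl -induced_inner inner_tan // subrr. Qed.

Lemma tan_tangent x w : U x -> tanp x (w *m 'J F x) = w.
Proof.
by move=> Ux; apply: (inner_inj (induced_spd Ux)) => z; rewrite inner_tan // induced_inner.
Qed.

Lemma nor_tangent x w : U x -> norp x (w *m 'J F x) = 0.
Proof. by move=> Ux; rewrite /nor_part tan_tangent // subrr. Qed.

Lemma tan_nor x (V : 'rV[R]_d) : U x -> tanp x (norp x V) = 0.
Proof.
move=> Ux; apply: (inner_inj (induced_spd Ux)) => z.
by rewrite inner_tan // inner_nor_tangent // inner0l.
Qed.

Lemma inner_tangent_nor x (V : 'rV[R]_d) w : U x -> tanp x V = 0 ->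
  inner (G (F x)) V (w *m 'J F x) = 0.
Proof. by move=> Ux V0; rewrite -inner_tan // V0 inner0l. Qed.

Lemma nor_id x (V : 'rV[R]_d) : tanp x V = 0 -> norp x V = V.
Proof. by rewrite /nor_part => ->; rewrite mul0mx subr0. Qed.

Lemma smooth_tan V : smooth_on U V -> smooth_on U (fun y => tanp y (V y)).
Proof.
move=> sV; have sJ : smooth_on U (fun x => 'J F x) by exact: smooth_jacobian.
have sGF := smooth_metric_along oO sG oU sF UO.
apply: smooth_mulmx => //; last first.
  by apply: smooth_invmx => //; [move=> x /induced_spd/spd_unit|exact: smooth_induced].
by apply: smooth_mulmx => //; [exact: smooth_mulmx|exact: smooth_trmx].
Qed.

Lemma smooth_tangent_field (a : 'rV[R]_n -> 'rV[R]_n) :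
  smooth_on U a -> smooth_on U (fun y => a y *m 'J F y).
Proof. by move=> sa; apply: smooth_mulmx => //; exact: smooth_jacobian. Qed.

Lemma smoothB V W : smooth_on U V -> smooth_on U W -> smooth_on U (fun y => V y - W y).
Proof.
move=> sV sW; apply: (smooth_eq oU (f := fun y => V y + (-1) *: W y)).
  by move=> y _; rewrite scaleN1r.
by apply: smoothD => //; apply: smooth_scale => //; exact: smooth_cst.
Qed.

Lemma smooth_nor V : smooth_on U V -> smooth_on U (fun y => norp y (V y)).
Proof. by move=> sV; apply: smoothB => //; apply: smooth_tangent_field; exact: smooth_tan. Qed.

Let sT v : smooth_on U (T v) := smooth_tangent oU sF v.
Let sCT v u : smooth_on U (fun y => cov G F (T v) y u) :=
  smooth_cov oO sG spdG oU sF UO u (sT v).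

(** The tangential part of the ambient derivative is symmetric, since second derivatives of [F] are,
    and compatible with the induced metric, since the ambient connection is metric; uniqueness of
    the connection concludes. *)
Lemma christoffel_induced x u v : U x ->
  christoffel gI x u v = tanp x (cov G F (T v) x u).
Proof.
move=> Ux; apply: esym.
apply: (christoffel_unique smooth_induced induced_spd Ux (T := fun u v => tanp x (cov G F (T v) x u))).
  by move=> a b; rewrite (cov_tangentC oO sG spdG oU sF UO).
move=> a b c.
have dI : differentiable gI x by exact: smooth_differentiable smooth_induced Ux.
refine (etrans (derive_inner_cst b c a dI) _).
have E : \near x, inner (gI x) b c = inner (G (F x)) (b *m 'J F x) (c *m 'J F x).
  by apply: near_eq_open Ux => // y Uy; exact: induced_inner.
refine (etrans (near_eq_derive a E) _).
refine (etrans (cov_inner oO sG spdG oU sF UO a (sT b) (sT c) Ux) _).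
rewrite -> (innerC (induced_spd Ux) b), !(inner_tan _ _ Ux).
congr (_ + _); exact: (innerC (spdG (UO Ux))).
Qed.

Lemma gauss_formula x u v : U x ->
  cov G F (T v) x u = christoffel gI x u v *m 'J F x + II x u v.
Proof. by move=> Ux; rewrite christoffel_induced // -tan_norE. Qed.

Lemma second_formC x u v : U x -> II x u v = II x v u.
Proof. by move=> Ux; rewrite /second_form (cov_tangentC oO sG spdG oU sF UO). Qed.

Lemma second_form_linear x v : U x -> linear (fun u => II x u v).
Proof.
move=> Ux a u w; rewrite /second_form (cov_linear_dir oO sG spdG UO (sT v) Ux).
by rewrite norD norZ.
Qed.

Lemma tan_second_form x u v : U x -> tanp x (II x u v) = 0.
Proof. exact: tan_nor. Qed.

Lemma smooth_second_form u v : smooth_on U (fun y => II y u v).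
Proof. by apply: smooth_nor; exact: sCT. Qed.

Lemma cov_tangent_field (a : 'rV[R]_n -> 'rV[R]_n) x u : smooth_on U a -> U x ->
  cov G F (fun y => a y *m 'J F y) x u =
  ('D_u a x + christoffel gI x u (a x)) *m 'J F x + II x u (a x).
Proof.
move=> sa Ux; have sJ : smooth_on U (fun x => 'J F x) by exact: smooth_jacobian.
rewrite mulmxDl -addrA -gauss_formula // /cov.
rewrite derive_mulmx; [|exact: smooth_differentiable sa Ux|exact: smooth_differentiable sJ Ux].
rewrite (@derive_mulmx _ _ _ _ _ (fun=> a x)); [|exact: differentiable_cst|exact: smooth_differentiable sJ Ux].
by rewrite (derive_cst (a x)) mul0mx add0r addrA.
Qed.

(** The Gauss formula is differentiated once more and antisymmetrized. Tangential and normal parts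
    are not separated yet, as the derivative of the second fundamental form contributes to both. *)
Lemma gauss_codazzi x u v w : U x ->
  curvature G (F x) (u *m 'J F x) (v *m 'J F x) (w *m 'J F x) =
  curvature gI x u v w *m 'J F x
  + (II x u (christoffel gI x v w) - II x v (christoffel gI x u w))
  + (cov G F (fun y => II y v w) x u - cov G F (fun y => II y u w) x v).
Proof.
move=> Ux; rewrite -(cov_curvature oO sG spdG oU sF UO u v (sT w) Ux).
have sC b c : smooth_on U (fun y => christoffel gI y b c).
  by apply: (smooth_christoffel oU smooth_induced induced_spd (F := id)) => //;
    [exact: smooth_id|exact: smooth_cst|exact: smooth_cst].
have E a b : cov G F (fun y => cov G F (T w) y b) x a =
   ('D_a (fun y => christoffel gI y b w) x + christoffel gI x a (christoffel gI x b w)) *m 'J F x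
   + II x a (christoffel gI x b w) + cov G F (fun y => II y b w) x a.
  rewrite -(cov_tangent_field a (sC b w) Ux).
  have sCw := smooth_tangent_field (sC b w).
  rewrite -(covD sG spdG UO a sCw (smooth_second_form b w) Ux).
  apply: cov_near_eq; apply: near_eq_open Ux => // y Uy; exact: gauss_formula.
rewrite (E u v) (E v u) /curvature mulmxBl.
have alg (p q r p' q' r' : 'rV[R]_d) :
   p + q + r - (p' + q' + r') = p - p' + (q - q') + (r - r').
  by apply/rowP => j; rewrite !mxE; ring.
exact: alg.
Qed.

(** <V, dF(w)> vanishes identically, hence so does its derivative, and [V] only sees the normal part
    of the derivative of dF(w). *)
Lemma inner_cov_normal V x u w : smooth_on U V -> U x ->
  (forall y, U y -> tanp y (V y) = 0) ->
  inner (G (F x)) (cov G F V x u) (w *m 'J F x) = - inner (G (F x)) (V x) (II x u w).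
Proof.
move=> sV Ux V0; apply/eqP; rewrite -addr_eq0; apply/eqP.
have -> : inner (G (F x)) (V x) (II x u w) = inner (G (F x)) (V x) (cov G F (T w) x u).
  by rewrite (gauss_formula u w Ux) [RHS]innerDr inner_tangent_nor ?add0r //; exact: V0.
rewrite -(cov_inner oO sG spdG oU sF UO u sV (sT w) Ux).
rewrite (near_eq_derive (g := cst 0)) ?derive_cst //.
apply: near_eq_open Ux => // y Uy; apply: inner_tangent_nor => //; exact: V0.
Qed.

Lemma gauss_equation x u v w z : U x ->
  inner (G (F x)) (curvature G (F x) (u *m 'J F x) (v *m 'J F x) (w *m 'J F x)) (z *m 'J F x) =
  inner (gI x) (curvature gI x u v w) z
  - inner (G (F x)) (II x v w) (II x u z) + inner (G (F x)) (II x u w) (II x v z).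
Proof.
move=> Ux.
have h a b : inner (G (F x)) (II x a b) (z *m 'J F x) = 0 by exact: inner_nor_tangent.
have tII a b y : U y -> tanp y (II y a b) = 0 by exact: tan_second_form.
have c a b e : inner (G (F x)) (cov G F (fun y => II y b e) x a) (z *m 'J F x) =
    - inner (G (F x)) (II x b e) (II x a z).
  exact: (inner_cov_normal a z (smooth_second_form b e) Ux (tII b e)).
rewrite -> (gauss_codazzi u v w Ux), inner_gauss_split.
rewrite -> !c, !h, <- induced_inner.
by rewrite subrr addr0 opprK addrA.
Qed.

Lemma codazzi_equation x u v w (N : 'rV[R]_d) : U x -> tanp x N = 0 ->
  inner (G (F x)) (curvature G (F x) (u *m 'J F x) (v *m 'J F x) (w *m 'J F x)) N =
  inner (G (F x)) (II x u (christoffel gI x v w)) N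
  - inner (G (F x)) (II x v (christoffel gI x u w)) N
  + (inner (G (F x)) (cov G F (fun y => II y v w) x u) N
     - inner (G (F x)) (cov G F (fun y => II y u w) x v) N).
Proof.
move=> Ux N0; have h a : inner (G (F x)) (a *m 'J F x) N = 0.
  by rewrite (innerC (spdG (UO Ux)) (_ *m _)) inner_tangent_nor.
rewrite -> (gauss_codazzi u v w Ux), inner_gauss_split, h.
by rewrite add0r.
Qed.

Lemma weingarten x xi u v : U x -> tanp x xi = 0 ->
  inner (gI x) (Defs.shape G F x xi u) v = inner (G (F x)) (II x u v) xi.
Proof.
move=> Ux xi0; have sN : smooth_on U (nor_ext G F xi).
  by apply: smooth_nor; exact: smooth_cst.
have tN y : U y -> tanp y (nor_ext G F xi y) = 0 by exact: tan_nor.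
have c := inner_cov_normal u v sN Ux tN.
rewrite /Defs.shape; rewrite -> innerNl, (inner_tan _ v Ux), c; rewrite opprK.
by rewrite /nor_ext (nor_id xi0); exact: (innerC (spdG (UO Ux))).
Qed.

(** The derivative of the normal extension of [xi] has tangential part minus the shape operator.
    Differentiating that part brings in the two terms with [II], and the two full second derivatives
    differ by the ambient curvature. *)
Lemma ricci_equation x u v xi : U x -> tanp x xi = 0 ->
  nor_curvature G F x u v xi =
  norp x (curvature G (F x) (u *m 'J F x) (v *m 'J F x) xi)
  + (II x u (Defs.shape G F x xi v) - II x v (Defs.shape G F x xi u)).
Proof.
move=> Ux xi0; have sN : smooth_on U (nor_ext G F xi).
  by apply: smooth_nor; exact: smooth_cst.
have sCN b := smooth_cov oO sG spdG oU sF UO b sN.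
have IIN b (a : 'rV[R]_n) : II x b (- a) = - II x b a.
  rewrite !(second_formC b) // -[- a]addr0 -scaleN1r second_form_linear //.
  have -> : II x 0 b = 0.
    have := second_form_linear b Ux 1 0 0; rewrite !scale1r addr0 => /eqP.
    by rewrite -subr_eq0 opprD addrA subrr sub0r oppr_eq0 => /eqP.
  by rewrite addr0 scaleN1r.
have E a b : nor_cov G F (fun y => nor_cov G F (nor_ext G F xi) y b) x a =
    norp x (cov G F (fun y => cov G F (nor_ext G F xi) y b) x a)
    + II x a (Defs.shape G F x xi b).
  have st := smooth_tan (sCN b).
  have sW : smooth_on U (fun y => nor_cov G F (nor_ext G F xi) y b).
    by apply: smooth_nor; exact: sCN.
  have -> : cov G F (fun y => cov G F (nor_ext G F xi) y b) x a =
      cov G F (fun y => tanp y (cov G F (nor_ext G F xi) y b) *m 'J F y) x a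
      + cov G F (fun y => nor_cov G F (nor_ext G F xi) y b) x a.
    rewrite -(covD sG spdG UO a (smooth_tangent_field st) sW Ux).
    by congr (cov G F _ x a); apply/funext => y; exact: tan_norE.
  rewrite norD (cov_tangent_field a st Ux) norD nor_tangent // add0r.
  rewrite (nor_id (V := II x a _)) ?tan_second_form //.
  by rewrite /Defs.shape IIN addrAC subrr add0r.
have K := cov_curvature oO sG spdG oU sF UO u v sN Ux.
refine (etrans (congr2 (fun a b => a - b) (E u v) (E v u)) _).
have N : norp x (curvature G (F x) (u *m 'J F x) (v *m 'J F x) xi) =
   norp x (cov G F (fun y => cov G F (nor_ext G F xi) y v) x u)
   - norp x (cov G F (fun y => cov G F (nor_ext G F xi) y u) x v).
  refine (etrans _ (norB _ _ _)); rewrite -> K.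
  by rewrite /nor_ext (nor_id xi0).
rewrite -> N.
have alg (a b p q : 'rV[R]_d) : a + p - (b + q) = a - b + (p - q).
  by rewrite opprD addrACA.
exact: alg.
Qed.

End Immersed.

(** * Changes of coordinates *)

Lemma jacobian_comp (R : realType) k n m (g : 'rV[R]_k -> 'rV[R]_n)
    (f : 'rV[R]_n -> 'rV[R]_m) x :
  differentiable g x -> differentiable f (g x) ->
  'J (f \o g) x = 'J g x *m 'J f (g x).
Proof.
move=> dg df; apply/row_matrixP => i; rewrite row_mul !rowE.
have dfg : differentiable (f \o g) x by exact: differentiable_comp.
by rewrite -(deriveEjacobian _ dfg) (derive_comp _ dg df) !deriveEjacobian.
Qed.

Lemma eq_jacobian (R : realType) n m (f g : 'rV[R]_n -> 'rV[R]_m) x :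
  differentiable f x -> (\near x, f x = g x) -> 'J f x = 'J g x.
Proof.
move=> df fg; have dg := near_eq_differentiable fg df.
apply/row_matrixP => i; rewrite [LHS]rowE [RHS]rowE.
have Ef := deriveEjacobian (delta_mx 0 i) df.
have Eg := deriveEjacobian (delta_mx 0 i) dg.
have E := near_eq_derive (delta_mx 0 i) fg.
rewrite <- Ef, <- Eg; exact: E.
Qed.

Lemma mul_lin1_mx (R : realType) n m (f : 'rV[R]_n -> 'rV[R]_m) w :
  linear f -> w *m lin1_mx f = f w.
Proof.
move=> lf; pose fL := GRing.isLinear.Build _ _ _ _ _ lf.
pose ff : {linear 'rV[R]_n -> 'rV[R]_m} := HB.pack f fL.
by rewrite (mul_rV_lin1 ff).
Qed.

Lemma eq_christoffel (R : realType) d (G G' : 'rV[R]_d -> 'M[R]_d) x u v :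
  (\near x, G x = G' x) -> christoffel G x u v = christoffel G' x u v.
Proof.
move=> GG; have D : (fun w => 'D_w G x) = (fun w => 'D_w G' x).
  by apply/funext => w; exact: near_eq_derive.
exact: (congr2 (fun g D => koszul_connection g D u v) (nbhs_singleton GG) D).
Qed.

Section AmbientChange.
Context (R : realType) (d : nat) (O' : set 'rV[R]_d) (G' : 'rV[R]_d -> 'M[R]_d).
Hypotheses (oO : open O') (sG : smooth_on O' G') (spdG : forall x, O' x -> spd (G' x)).
Context (O : set 'rV[R]_d) (G : 'rV[R]_d -> 'M[R]_d) (phi : 'rV[R]_d -> 'rV[R]_d).
Hypotheses (oU : open O) (sphi : smooth_on O phi) (UO : forall x, O x -> O' (phi x)).
Hypothesis fphi : forall x, O x -> row_free ('J phi x).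
Hypothesis GE : forall x, O x -> G x = Defs.induced G' phi x.
Implicit Types (u v w : 'rV[R]_d).

(** The dimensions agree here, so ['J phi] is invertible and nothing is normal. *)
Lemma second_form_square x u v : O x -> second_form G' phi x u v = 0.
Proof.
move=> Ox; rewrite /second_form; set V := cov _ _ _ _ _.
have uJ : 'J phi x \in unitmx by rewrite -row_free_unit fphi.
by rewrite -(mulmxKV uJ V) (nor_tangent spdG UO fphi).
Qed.

(** The transformation law of the Christoffel symbols is the Gauss formula of [phi], viewed as an
    immersion of codimension 0. *)
Lemma christoffel_change x u v : O x ->
  christoffel G x u v *m 'J phi x = cov G' phi (fun y => v *m 'J phi y) x u.
Proof.
move=> Ox; rewrite (gauss_formula oO sG spdG oU sphi UO fphi) //.
rewrite second_form_square // addr0; congr (_ *m _).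
by apply: eq_christoffel; apply: near_eq_open Ox.
Qed.

Context (n : nat) (U : set 'rV[R]_n) (F : 'rV[R]_n -> 'rV[R]_d).
Hypotheses (oUF : open U) (sF : smooth_on U F) (UF : forall x, U x -> O (F x)).

Lemma cov_change (V : 'rV[R]_n -> 'rV[R]_d) x (u : 'rV[R]_n) : smooth_on U V -> U x ->
  cov G' (phi \o F) (fun y => V y *m 'J phi (F y)) x u = cov G F V x u *m 'J phi (F x).
Proof.
move=> sV Ux; have OF := UF Ux.
have dF := smooth_differentiable sF Ux; have dphi := smooth_differentiable sphi OF.
have dV := smooth_differentiable sV Ux.
have sJ : smooth_on O (fun z => 'J phi z) by exact: smooth_jacobian.
have dJ := smooth_differentiable sJ OF.
have dJF : differentiable (fun y => 'J phi (F y)) x.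
  exact: (@differentiable_comp _ _ _ _ F (fun z => 'J phi z)).
have E1 := derive_mulmx u dV dJF.
have E2 := derive_mulmx_cst (V x) (u *m 'J F x) dJ.
have E3 : 'D_u (fun y => 'J phi (F y)) x = 'D_(u *m 'J F x) (fun z => 'J phi z) (F x).
  by rewrite (mul_jacobian sF u Ux); exact: (derive_comp u dF dJ).
have C := christoffel_change (u *m 'J F x) (V x) OF.
have B : christoffel G' ((phi \o F) x) (u *m 'J (phi \o F) x) (V x *m 'J phi (F x)) =
    christoffel G' (phi (F x)) (u *m 'J F x *m 'J phi (F x)) (V x *m 'J phi (F x)).
  by rewrite (jacobian_comp dF dphi) mulmxA.
refine (etrans (congr2 +%R (etrans E1 (congr1 (fun z => _ + V x *m z) E3)) B) _).
refine (etrans _ (esym (mulmxDl _ _ _))).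
refine (etrans (esym (addrA _ _ _)) (congr1 (fun z => _ + z) (etrans _ (esym C)))).
exact: (congr1 (fun z => z + _) (esym E2)).
Qed.

Hypothesis fF : forall x, U x -> row_free ('J F x).

Lemma second_form_ambient x (u v : 'rV[R]_n) : U x ->
  second_form G' (phi \o F) x u v = second_form G F x u v *m 'J phi (F x).
Proof.
move=> Ux; have OF := UF Ux.
have J y : U y -> 'J (phi \o F) y = 'J F y *m 'J phi (F y).
  move=> Uy; apply: jacobian_comp; first exact: smooth_differentiable sF Uy.
  exact: smooth_differentiable sphi (UF Uy).
have GF := GE OF.
have I : Defs.induced G' (phi \o F) x = Defs.induced G F x.
  rewrite /Defs.induced; rewrite -> (J _ Ux), GF; rewrite /Defs.induced /=.
  by move: ('J F x) ('J phi (F x)) => A B; rewrite trmx_mul !mulmxA.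
have N (V : 'rV[R]_d) : nor_part G' (phi \o F) x (V *m 'J phi (F x)) =
    nor_part G F x V *m 'J phi (F x).
  rewrite /nor_part /tan_part; rewrite -> I, (J _ Ux), GF; rewrite /Defs.induced /=.
  move: ('J F x) ('J phi (F x)) (G' _) => A B g.
  by rewrite mulmxBl trmx_mul !mulmxA.
refine (etrans (congr1 (nor_part G' (phi \o F) x) _) (N _)).
refine (etrans _ (cov_change u (smooth_tangent oUF sF v) Ux)).
have E y : U y -> v *m 'J (phi \o F) y = v *m 'J F y *m 'J phi (F y).
  by move=> /J ->; exact: mulmxA.
exact: (@cov_near_eq _ _ _ G' (phi \o F) _ _ x u (near_eq_open oUF E Ux)).
Qed.

End AmbientChange.

Section Reparametrization.
Context (R : realType) (n d : nat) (O : set 'rV[R]_d) (G : 'rV[R]_d -> 'M[R]_d).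
Hypotheses (oO : open O) (sG : smooth_on O G) (spdG : forall x, O x -> spd (G x)).
Context (U : set 'rV[R]_n) (F : 'rV[R]_n -> 'rV[R]_d).
Hypotheses (oU : open U) (sF : smooth_on U F) (UO : forall x, U x -> O (F x)).
Hypothesis fF : forall x, U x -> row_free ('J F x).
Context (U' : set 'rV[R]_n) (psi : 'rV[R]_n -> 'rV[R]_n).
Hypotheses (oU' : open U') (spsi : smooth_on U' psi) (UU : forall x, U' x -> U (psi x)).
Hypothesis fpsi : forall x, U' x -> row_free ('J psi x).

(** The derivative of [v *m 'J psi] along [u] only adds a tangent vector, which the normal
    projection kills. *)
Lemma second_form_reparam x u v : U' x ->
  second_form G (F \o psi) x u v =
  second_form G F (psi x) (u *m 'J psi x) (v *m 'J psi x).
Proof.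
move=> Ux; have Up := UU Ux.
have dpsi y (Uy : U' y) := smooth_differentiable spsi Uy.
have dF y (Uy : U' y) := smooth_differentiable sF (UU Uy).
have sJ : smooth_on U (fun z => 'J F z) by exact: smooth_jacobian.
have sJpsi : smooth_on U' (fun z => 'J psi z) by exact: smooth_jacobian.
have dJ := smooth_differentiable sJ Up.
have dJpsi := smooth_differentiable sJpsi Ux.
have dJp : differentiable (fun y => 'J F (psi y)) x.
  by apply: (@differentiable_comp _ _ _ _ psi (fun z => 'J F z)); [exact: dpsi|].
have J y : U' y -> 'J (F \o psi) y = 'J psi y *m 'J F (psi y).
  by move=> Uy; apply: jacobian_comp; [exact: dpsi|exact: dF].
have fFp y : U' y -> row_free ('J (F \o psi) y).
  move=> Uy; rewrite J // /row_free mxrankMfree; [exact: fpsi|exact: fF (UU Uy)].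
have UOp y : U' y -> O ((F \o psi) y) by move=> Uy; exact: UO (UU Uy).
pose a := 'D_u (fun y => v *m 'J psi y) x.
have C : cov G (F \o psi) (fun y => v *m 'J (F \o psi) y) x u =
    a *m 'J F (psi x) + cov G F (fun y => (v *m 'J psi x) *m 'J F y) (psi x) (u *m 'J psi x).
  have dvp : differentiable (fun y => v *m 'J psi y) x.
    exact: smooth_differentiable (smooth_tangent oU' spsi v) Ux.
  have Ec y : U' y -> v *m 'J (F \o psi) y = v *m 'J psi y *m 'J F (psi y).
    by move=> /J ->; exact: mulmxA.
  have E1 := derive_mulmx u dvp dJp.
  have E2 : 'D_u (fun y => 'J F (psi y)) x = 'D_(u *m 'J psi x) (fun z => 'J F z) (psi x).
    by rewrite (mul_jacobian spsi u Ux); exact: (derive_comp u (dpsi _ Ux) dJ).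
  have E3 := derive_mulmx_cst (v *m 'J psi x) (u *m 'J psi x) dJ.
  have B : christoffel G ((F \o psi) x) (u *m 'J (F \o psi) x)
        (v *m 'J psi x *m 'J F (psi x)) =
      christoffel G (F (psi x)) (u *m 'J psi x *m 'J F (psi x)) (v *m 'J psi x *m 'J F (psi x)).
    by rewrite (J _ Ux) mulmxA.
  refine (etrans (@cov_near_eq _ _ _ G (F \o psi) _ _ x u (near_eq_open oU' Ec Ux)) _).
  refine (etrans (congr2 +%R (etrans E1 (congr1 (fun z => _ + (v *m 'J psi x) *m z) E2)) B) _).
  refine (etrans (esym (addrA _ _ _)) (congr1 (fun z => _ + z) _)).
  exact: (congr1 (fun z => z + _) (esym E3)).
rewrite /second_form C.
set V := cov G F _ _ _.
have up : 'J psi x \in unitmx by rewrite -row_free_unit fpsi.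
have tE (w : 'rV[R]_n) : w *m 'J F (psi x) = (w *m invmx ('J psi x)) *m 'J (F \o psi) x.
  by rewrite J // mulmxA mulmxKV.
have nt w : nor_part G (F \o psi) x (w *m 'J F (psi x)) = 0.
  by rewrite tE (nor_tangent spdG UOp fFp).
rewrite -> norD, nt; clearbody V; rewrite add0r.
rewrite {1}(@tan_norE _ _ _ G F (psi x) V) norD nt add0r; apply: nor_id.
apply: (inner_inj (induced_spd spdG UOp fFp Ux)) => w; rewrite inner0l.
refine (etrans (inner_tan spdG UOp fFp _ _ Ux) _).
have E : w *m 'J (F \o psi) x = w *m 'J psi x *m 'J F (psi x).
  exact: (etrans (congr1 (mulmx w) (J _ Ux)) (mulmxA _ _ _)).
exact: (etrans (congr1 (inner _ _) E) (inner_nor_tangent spdG UO fF _ _ Up)).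
Qed.

End Reparametrization.

Lemma eq_second_form (R : realType) n d (O : set 'rV[R]_d) (G G' : 'rV[R]_d -> 'M[R]_d)
    (U : set 'rV[R]_n) (F F' : 'rV[R]_n -> 'rV[R]_d) x u v :
  open U -> open O -> (forall y, U y -> O (F y)) -> smooth_on U F ->
  (forall y, U y -> F y = F' y) -> (forall z, O z -> G z = G' z) -> U x ->
  second_form G F x u v = second_form G' F' x u v.
Proof.
move=> oU oO UO sF FF GG Ux; have OF := UO _ Ux.
have J y : U y -> 'J F y = 'J F' y.
  move=> Uy; apply: eq_jacobian; first exact: smooth_differentiable sF Uy.
  exact: near_eq_open Uy.
have Fx := FF _ Ux; have Gx : G (F x) = G' (F' x) by rewrite -Fx; exact: GG.
have C : cov G F (fun y => v *m 'J F y) x u = cov G' F' (fun y => v *m 'J F' y) x u.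
  have E y : U y -> v *m 'J F y = v *m 'J F' y by move=> /J ->.
  refine (etrans (@cov_near_eq _ _ _ G F _ _ x u (near_eq_open oU E Ux)) _).
  refine (congr1 (fun z => _ + z) _).
  refine (etrans (eq_christoffel _ _ (near_eq_open oO GG OF)) _).
  by rewrite -Fx (J _ Ux).
refine (etrans (congr1 (nor_part G F x) C) _); rewrite /second_form.
move: (cov G' F' _ _ _) => V.
pose f (A : 'M[R]_(n, d)) (g : 'M[R]_d) :=
  V - V *m g *m A^T *m invmx (A *m g *m A^T) *m A.
exact: (congr2 f (J _ Ux) Gx).
Qed.

Section EndoChange.
Context (R : realType) (d : nat) (O' : set 'rV[R]_d) (G' : 'rV[R]_d -> 'M[R]_d).
Hypotheses (oO : open O') (sG : smooth_on O' G') (spdG : forall x, O' x -> spd (G' x)).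
Context (O : set 'rV[R]_d) (G : 'rV[R]_d -> 'M[R]_d) (phi : 'rV[R]_d -> 'rV[R]_d).
Hypotheses (oU : open O) (sphi : smooth_on O phi) (UO : forall x, O x -> O' (phi x)).
Hypothesis fphi : forall x, O x -> row_free ('J phi x).
Hypothesis GE : forall x, O x -> G x = Defs.induced G' phi x.
Context (S S' : 'rV[R]_d -> 'M[R]_d).
Hypotheses (sS : smooth_on O S).
Hypothesis SE : forall x, O x -> S x *m 'J phi x = 'J phi x *m S' (phi x).
Implicit Types (x u v w : 'rV[R]_d).

Lemma mul_cov_endo (A : set 'rV[R]_d) (g : 'rV[R]_d -> 'M[R]_d) (Z : 'rV[R]_d -> 'M[R]_d) x u w :
  open A -> smooth_on A g -> (forall x, A x -> spd (g x)) -> A x ->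
  w *m cov_endo g Z x u =
  w *m 'D_u Z x + christoffel g x u (w *m Z x) - christoffel g x u w *m Z x.
Proof.
move=> oA sg spg Ax.
have L : linear (christoffel g x u).
  by move=> a b c; rewrite (christoffelDr sg spg) // (christoffelZr sg spg).
by rewrite /cov_endo mulmxBr mulmxDr !mulmxA !mul_lin1_mx.
Qed.

(** By the Leibniz rule w (nabla S) = nabla (w S) - (nabla w) S, and both terms on the right
    transform as derivatives of vector fields. *)
Lemma cov_endo_change x u : O x -> differentiable S' (phi x) ->
  cov_endo G S x u *m 'J phi x = 'J phi x *m cov_endo G' S' (phi x) (u *m 'J phi x).
Proof.
move=> Ox dS'.
have sGO : smooth_on O G.
  by apply: (smooth_eq oU (f := Defs.induced G' phi));
   [move=> y /GE|exact: (smooth_induced oO sG oU sphi UO)].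
have spG y : O y -> spd (G y).
  by move=> Oy; rewrite GE //; exact: (induced_spd spdG UO fphi).
have OO y : O y -> O (id y) by [].
have sid : smooth_on O (id : 'rV[R]_d -> 'rV[R]_d) by exact: smooth_id.
have sJ : smooth_on O (fun z => 'J phi z) by exact: smooth_jacobian.
have dJ := smooth_differentiable sJ Ox; have dphi := smooth_differentiable sphi Ox.
have Jid (a : 'rV[R]_d) : a *m 'J id x = a by rewrite (mul_jacobian sid) // derive_id.
apply/row_matrixP => i; rewrite [LHS]rowE [RHS]rowE; set w := delta_mx 0 i.
refine (etrans (mulmxA _ _ _) (etrans _ (esym (mulmxA _ _ _)))).
refine (etrans (congr1 (fun z => z *m 'J phi x) (mul_cov_endo S u w oU sGO spG Ox)) _).
refine (etrans _ (esym (mul_cov_endo S' _ _ oO sG spdG (UO Ox)))).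
have sV : smooth_on O (fun y => w *m S y) by apply: smooth_mulmx => //; exact: smooth_cst.
have H := cov_change oO sG spdG oU sphi UO fphi GE sid OO u sV Ox.
have dS := smooth_differentiable sS Ox.
have E1 : w *m 'D_u S x + christoffel G x u (w *m S x) = cov G id (fun y => w *m S y) x u.
  rewrite /cov; rewrite -> Jid.
  exact: (congr1 (fun z => z + _) (esym (derive_mulmx_cst w u dS))).
have dwJ : differentiable (fun y => w *m 'J phi y) x.
  exact: smooth_differentiable (smooth_tangent oU sphi w) Ox.
have dSp : differentiable (fun y => S' (phi y)) x.
  exact: (@differentiable_comp _ _ _ _ phi S').
have E2 := derive_mulmx u dwJ dSp.
have E3 : 'D_u (fun y => S' (phi y)) x = 'D_(u *m 'J phi x) S' (phi x).
  by rewrite (mul_jacobian sphi u Ox); exact: (derive_comp u dphi dS').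
have Q : christoffel G x u w *m 'J phi x = cov G' phi (fun y => w *m 'J phi y) x u.
  exact: (christoffel_change oO sG spdG oU sphi UO fphi GE u w Ox).
have SEw y : O y -> w *m S y *m 'J phi y = w *m 'J phi y *m S' (phi y).
  by move=> /SE E; rewrite -!mulmxA E.
(* A constant [w] has the non-constant image w dphi in the target; the term with the derivative of
   that image occurs in both [L1] and [L2] and cancels. *)
have L1 : (w *m 'D_u S x + christoffel G x u (w *m S x)) *m 'J phi x =
    'D_u (fun y => w *m 'J phi y) x *m S' (phi x)
    + w *m 'J phi x *m 'D_(u *m 'J phi x) S' (phi x)
    + christoffel G' (phi x) (u *m 'J phi x) (w *m 'J phi x *m S' (phi x)).
  refine (etrans (congr1 (fun z => z *m 'J phi x) E1) (etrans (esym H) _)).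
  refine (etrans (@cov_near_eq _ _ _ G' phi _ _ x u (near_eq_open oU SEw Ox)) _).
  refine (congr1 (fun z => z + _) (etrans E2 _)).
  exact: (congr1 (fun z => _ + w *m 'J phi x *m z) E3).
have L2 : christoffel G x u w *m S x *m 'J phi x =
    'D_u (fun y => w *m 'J phi y) x *m S' (phi x)
    + christoffel G' (phi x) (u *m 'J phi x) (w *m 'J phi x) *m S' (phi x).
  refine (etrans (esym (mulmxA _ _ _)) _); rewrite -> (SE Ox).
  refine (etrans (mulmxA _ _ _) (etrans (congr1 (fun z => z *m S' (phi x)) Q) _)).
  exact: mulmxDl.
have alg (a b c e : 'rV[R]_d) : a + b + c - (a + e) = b + c - e.
  by clear; apply/rowP => j; rewrite !mxE; ring.
exact: (etrans (mulmxBl _ _ _) (etrans (congr2 (fun a b => a - b) L1 L2) (alg _ _ _ _))).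
Qed.

End EndoChange.

(** * Charts, transition maps and coordinate expressions of tensors *)

Section Charts.
Context (R : realType) (d : nat) (M : manifold R d).
Implicit Types (p q r s : M) (A : set M) (x : 'rV[R]_d).

Definition coord_set q A := chart q @` (chart_dom q `&` A).
Definition transition q r := chart r \o chart_inv q.

Lemma coord_setE q A x : coord_set q A x <-> chart_img q x /\ A (chart_inv q x).
Proof.
split=> [[y [qy Ay] <-]|[[y qy <-]]]; first by rewrite chartK //; split=> //; exists y.
by rewrite chartK // => Ay; exists y.
Qed.

Lemma chart_inv_dom q x : chart_img q x -> chart_dom q (chart_inv q x).
Proof. by case=> y qy <-; rewrite chartK. Qed.

Lemma chart_invK q x : chart_img q x -> chart q (chart_inv q x) = x.
Proof. by case=> y qy <-; rewrite chartK. Qed.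

Lemma chart_mem q r : chart_dom q r -> chart_img q (chart q r).
Proof. by move=> qr; exists r. Qed.

Lemma chart_center p : chart_img p (chart p p).
Proof. exact: chart_mem (chart_dom_mem p). Qed.

Lemma coord_set_center p A : A p -> coord_set p A (chart p p).
Proof. by move=> Ap; apply/coord_setE; rewrite chartK; [split=> //; exact: chart_center|exact: chart_dom_mem]. Qed.

Lemma coord_set_open q A : open A -> open (coord_set q A).
Proof.
move=> oA; rewrite openE => x /coord_setE[qx Ax].
have H1 : nbhs x (chart_img q) by exact: open_nbhs_nbhs (conj (@chart_img_open _ _ _ q) qx).
have H2 : nbhs x (chart_inv q @^-1` A).
  by apply: (chart_inv_continuous qx); exact: open_nbhs_nbhs (conj oA Ax).
by rewrite /interior; apply: filterS2 H1 H2 => y qy Ay; apply/coord_setE.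
Qed.

Let ov q r := coord_set q (chart_dom r).

Lemma overlap_open q r : open (ov q r).
Proof. by apply: coord_set_open; exact: chart_dom_open. Qed.

Lemma smooth_transition q r : smooth_on (ov q r) (transition q r).
Proof. exact: transition_smooth. Qed.

Lemma transition_inv q r x : ov q r x -> chart_inv r (transition q r x) = chart_inv q x.
Proof. by move=> /coord_setE[qx rx]; rewrite /transition /= chartK. Qed.

Lemma transition_mem q r x : ov q r x -> ov r q (transition q r x).
Proof.
move=> H; have /coord_setE[qx rx] := H; apply/coord_setE.
by rewrite transition_inv //; split; [exact: chart_mem|exact: chart_inv_dom].
Qed.

Lemma transition_trans q r s x : ov q r x -> transition r s (transition q r x) = transition q s x.
Proof. by move=> H; rewrite /transition /= -[chart r _]/(transition q r x) transition_inv. Qed.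

Lemma jacobian_transition q r s x : ov q r x -> ov q s x ->
  'J (transition q s) x = 'J (transition q r) x *m 'J (transition r s) (transition q r x).
Proof.
move=> qr qs; have d1 := smooth_differentiable (@smooth_transition q r) qr.
have rs : ov r s (transition q r x).
  by apply/coord_setE; rewrite transition_inv //; split;
    [have /coord_setE[] := transition_mem qr|move/coord_setE: qs => []].
have d2 := smooth_differentiable (@smooth_transition r s) rs.
refine (etrans _ (jacobian_comp d1 d2)); apply/esym/eq_jacobian.
  exact: differentiable_comp.
by apply: (near_eq_open (@overlap_open q r)) qr => y; exact: transition_trans.
Qed.

Lemma jacobian_transition_id q x : chart_img q x -> 'J (transition q q) x = 1%:M.
Proof.
move=> qx; have qq : ov q q x by apply/coord_setE; split=> //; exact: chart_inv_dom.
have d1 := smooth_differentiable (@smooth_transition q q) qq.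
have -> : 'J (transition q q) x = 'J id x.
  apply: eq_jacobian => //; apply: (near_eq_open (@chart_img_open _ _ _ q)) qx => y qy.
  exact: chart_invK.
apply/row_matrixP => i; rewrite !rowE mulmx1.
have did : differentiable (id : 'rV[R]_d -> 'rV[R]_d) x by have [] := is_diff_id x.
by rewrite -(deriveEjacobian _ did) derive_id.
Qed.

Lemma row_free_transition q r x : ov q r x -> row_free ('J (transition q r) x).
Proof.
move=> qr; have /coord_setE[qx rx] := qr.
have qq : ov q q x by apply/coord_setE; split=> //; exact: chart_inv_dom.
apply/row_freeP; exists ('J (transition r q) (transition q r x)).
by rewrite -(jacobian_transition qr qq) jacobian_transition_id.
Qed.

Lemma frame_in_change q r x : ov q r x ->
  frame_in q x = 'J (transition q r) x *m frame_in r (transition q r x).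
Proof.
move=> qr; have /coord_setE[qx rx] := qr; rewrite /frame_in transition_inv //.
apply: jacobian_transition => //; apply/coord_setE; split=> //; exact: chart_dom_mem.
Qed.

Lemma frame_in_unit q x : chart_img q x -> frame_in q x \in unitmx.
Proof.
move=> qx; rewrite -row_free_unit; apply: row_free_transition.
by apply/coord_setE; split=> //; exact: chart_dom_mem.
Qed.

(** This is what makes coordinate expressions agree, at the center of a chart, with the tensors
    given pointwise. *)
Lemma frame_in_center p : frame_in p (chart p p) = 1%:M.
Proof.
rewrite /frame_in chartK; last exact: chart_dom_mem.
exact: jacobian_transition_id (chart_center p).
Qed.

Lemma form_in_center (g : M -> 'M[R]_d) p : form_in g p (chart p p) = g p.
Proof.
by rewrite /form_in frame_in_center mul1mx trmx1 mulmx1 chartK //; exact: chart_dom_mem.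
Qed.

Lemma endo_in_center (S : M -> 'M[R]_d) p : endo_in S p (chart p p) = S p.
Proof.
by rewrite /endo_in frame_in_center mul1mx invmx1 mulmx1 chartK //; exact: chart_dom_mem.
Qed.

Lemma form_in_change (g : M -> 'M[R]_d) q r x : ov q r x ->
  form_in g q x = Defs.induced (form_in g r) (transition q r) x.
Proof.
move=> qr; rewrite /form_in /Defs.induced; rewrite -> (transition_inv qr), (frame_in_change qr).
move: ('J _ _) (frame_in _ _) (g _) => A B h.
by rewrite trmx_mul !mulmxA.
Qed.

Lemma endo_in_change (S : M -> 'M[R]_d) q r x : ov q r x ->
  endo_in S q x *m 'J (transition q r) x =
  'J (transition q r) x *m endo_in S r (transition q r x).
Proof.
move=> qr; have /coord_setE[qx rx] := qr.
have /coord_setE[rx' _] := transition_mem qr.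
have uf := frame_in_unit rx'; have uq := frame_in_unit qx.
have E := frame_in_change qr.
have uJ : 'J (transition q r) x \in unitmx by rewrite -row_free_unit row_free_transition.
rewrite /endo_in; rewrite -> (transition_inv qr), E; move: uf uJ; clear.
move: ('J _ _) (frame_in _ _) (S _) => A B T uB uA.
have uAB : A *m B \in unitmx by rewrite unitmx_mul uA.
have E : invmx (A *m B) *m A = invmx B by rewrite -{2}[A](mulmxK uB) mulKmx.
by rewrite -!mulmxA E !mulmxA.
Qed.

End Charts.

Section RiemannianCharts.
Context (R : realType) (d : nat) (M : riemannian R d).

Lemma metric_spd (p : M) : spd (Defs.metric p).
Proof. by split; [exact: Defs.metric_sym|exact: Defs.metric_pos]. Qed.

Lemma form_in_spd (q : M) x : chart_img q x -> spd (form_in (@Defs.metric R d M) q x).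
Proof.
move=> qx; apply: spd_mulmx; last exact: metric_spd.
by rewrite row_free_unit; exact: frame_in_unit.
Qed.

End RiemannianCharts.

(** * The curvature of a quaternionic space form *)

Section CurvatureLike.
Context (R : realType) (V : lmodType R).
Implicit Types (x y z w : V) (S : V -> V -> V -> V -> R).

(** Linearity is asked in the first slot only; the symmetries transfer it to the other three. *)
Record curvature_like S : Prop := CurvatureLike {
  cl_linear : forall a x x' y z w, S (a *: x + x') y z w = a * S x y z w + S x' y z w;
  cl_antisym : forall x y z w, S x y z w = - S y x z w;
  cl_skew : forall x y z w, S x y z w = - S x y w z;
  cl_bianchi : forall x y z w, S x y z w + S y z x w + S z x y w = 0
}.

Section Theory.
Variable S : V -> V -> V -> V -> R.
Hypothesis cS : curvature_like S.

(** The four Bianchi identities in which each of the four vectors in turn stays in the last slot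
    combine with the sign symmetries. *)
Lemma cl_pair x y z w : S x y z w = S z w x y.
Proof.
have a1 := cl_bianchi cS x y z w; have a2 := cl_bianchi cS y z w x.
have a3 := cl_bianchi cS z w x y; have a4 := cl_bianchi cS w x y z.
have b1 := cl_skew cS y z w x; have b2 := cl_skew cS z w y x.
have b3 := cl_antisym cS x z w y; have b4 := cl_skew cS z x w y.
have b5 := cl_skew cS w x y z; have b6 := cl_skew cS x y w z.
have b7 := cl_antisym cS y w x z; have b8 := cl_skew cS w y x z.
lra.
Qed.

Lemma cl_add1 x x' y z w : S (x + x') y z w = S x y z w + S x' y z w.
Proof. by have := cl_linear cS 1 x x' y z w; rewrite scale1r mul1r. Qed.

Lemma cl_add2 x y y' z w : S x (y + y') z w = S x y z w + S x y' z w.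
Proof.
by rewrite (cl_antisym cS) cl_add1 opprD -!(cl_antisym cS).
Qed.

Lemma cl_add3 x y z z' w : S x y (z + z') w = S x y z w + S x y z' w.
Proof. by rewrite cl_pair cl_add1 ![S _ w x y]cl_pair. Qed.

Lemma cl_add4 x y z w w' : S x y z (w + w') = S x y z w + S x y z w'.
Proof. by rewrite (cl_skew cS) cl_add3 opprD -!(cl_skew cS). Qed.

Lemma cl_opp1 x y z w : S (- x) y z w = - S x y z w.
Proof.
have := cl_linear cS (-1) x x y z w; rewrite scaleN1r addrC subrr => E.
have Z : S 0 y z w = 0.
  by have := cl_linear cS 1 0 0 y z w; rewrite scaler0 addr0 mul1r; lra.
by have := cl_add1 x (- x) y z w; rewrite subrr Z; lra.
Qed.

Lemma cl_opp2 x y z w : S x (- y) z w = - S x y z w.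
Proof. by rewrite (cl_antisym cS) cl_opp1 -(cl_antisym cS). Qed.

Lemma cl_opp3 x y z w : S x y (- z) w = - S x y z w.
Proof. by rewrite cl_pair cl_opp1 cl_pair. Qed.

Lemma cl_opp4 x y z w : S x y z (- w) = - S x y z w.
Proof. by rewrite (cl_skew cS) cl_opp3 -(cl_skew cS). Qed.

Lemma cl_scale3 a x y z w : S x y (a *: z) w = a * S x y z w.
Proof.
rewrite cl_pair [in RHS]cl_pair; have := cl_linear cS a z 0 w x y.
by rewrite addr0 -[0](subrr z) cl_add1 cl_opp1 subrr addr0.
Qed.

(** Polarizing in [y] and then in [x] makes S x y z w invariant under cyclic permutations of x, y,
    z, so that the Bianchi identity reads 3 S x y z w = 0. The predicate [P] allows the use both on
    a single quaternionic line and on the whole space. *)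
Lemma cl_sectional0 (P : V -> Prop) :
  (forall x y, P x -> P y -> P (x + y)) ->
  (forall x y, P x -> P y -> S x y y x = 0) ->
  forall x y z w, P x -> P y -> P z -> P w -> S x y z w = 0.
Proof.
move=> PD P0.
have H1 x y z : P x -> P y -> P z -> S x y z x = 0.
  move=> px py pz; have := P0 _ _ px (PD _ _ py pz).
  rewrite cl_add2 !cl_add3 !P0 //.
  have := cl_pair x z y x; have := cl_antisym cS y x x z; have := cl_skew cS x y x z.
  lra.
have H2 x y z w : P x -> P y -> P z -> P w -> S x y z w = - S w y z x.
  move=> px py pz pw; have := H1 _ _ _ (PD _ _ px pw) py pz.
  rewrite cl_add1 !cl_add4 (H1 x) // (H1 w) //; lra.
move=> x y z w px py pz pw.
have c1 := H2 x y z w px py pz pw; have c2 := H2 y z x w py pz px pw.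
have c3 := H2 z x y w pz px py pw.
have b := cl_bianchi cS x y z w.
have d1 := cl_pair w y z x; have e1 := cl_skew cS z x w y.
have d2 := cl_pair w z x y; have e2 := cl_skew cS x y w z.
have d3 := cl_pair w x y z; have e3 := cl_skew cS y z w x.
lra.
Qed.

End Theory.

Lemma curvature_like_comb S S' (a : R) : curvature_like S -> curvature_like S' ->
  curvature_like (fun x y z w => S x y z w - a * S' x y z w).
Proof.
move=> cS cS'; split=> [b x x' y z w|x y z w|x y z w|x y z w].
- by rewrite (cl_linear cS) (cl_linear cS'); ring.
- by rewrite (cl_antisym cS) (cl_antisym cS' x); ring.
- by rewrite (cl_skew cS) (cl_skew cS' x); ring.
- have := cl_bianchi cS x y z w; have := cl_bianchi cS' x y z w => b b'.
  have -> : forall p q r p' q' r' : R, p - a * p' + (q - a * q') + (r - a * r') =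
    p + q + r - a * (p' + q' + r') by move=> *; ring.
  by rewrite b b' mulr0 subrr.
Qed.

End CurvatureLike.

Section QuaternionicCurvature.
Context (R : realType) (d : nat) (g : 'M[R]_d).
Hypothesis spdg : spd g.
Local Notation V := 'rV[R]_d.
Local Notation "<< x , y >>" := (inner g x y).
Implicit Types (x y z w : V).

Record quaternionic_triple (i j k : V -> V) : Prop := QuaternionicTriple {
  qt_lin : [/\ linear i, linear j & linear k];
  qt_skew : [/\ forall x y, <<i x, y>> = - <<x, i y>>, forall x y, <<j x, y>> = - <<x, j y>> &
              forall x y, <<k x, y>> = - <<x, k y>>];
  qt_sq : [/\ forall x, i (i x) = - x, forall x, j (j x) = - x & forall x, k (k x) = - x];
  qt_pos : [/\ forall x, i (j x) = k x, forall x, j (k x) = i x & forall x, k (i x) = j x];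
  qt_neg : [/\ forall x, j (i x) = - k x, forall x, k (j x) = - i x & forall x, i (k x) = - j x]
}.

Lemma quaternionic_triple_cycle i j k :
  quaternionic_triple i j k -> quaternionic_triple j k i.
Proof. by case=> [[? ? ?] [? ? ?] [? ? ?] [? ? ?] [? ? ?]]; split; split. Qed.

Definition qterm (q : V -> V) x y z w : R :=
  <<q y, z>> * <<q x, w>> - <<q x, z>> * <<q y, w>> + 2 * <<q y, x>> * <<q z, w>>.

(* <R(x,y)z, w> for the curvature tensor R of the quaternionic space form of
   quaternionic sectional curvature 4 *)
Definition model_curvature (i j k : V -> V) x y z w : R :=
  <<z, y>> * <<x, w>> - <<x, z>> * <<y, w>>
  + (qterm i x y z w + qterm j x y z w + qterm k x y z w).

Lemma model_curvature_cycle i j k x y z w :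
  model_curvature i j k x y z w = model_curvature j k i x y z w.
Proof. by rewrite /model_curvature; congr (_ + _); rewrite -addrA; exact: addrC. Qed.

Lemma curvature_like_model i j k :
  quaternionic_triple i j k -> curvature_like (model_curvature i j k).
Proof.
case=> [[li lj lk] [si sj sk] _ _ _].
have A (q : V -> V) : (forall x y, <<q x, y>> = - <<x, q y>>) ->
    forall x y, <<q x, y>> = - <<q y, x>>.
  by move=> sq x y; rewrite sq (innerC spdg).
have ai := A _ si; have aj := A _ sj; have ak := A _ sk.
have C := innerC spdg.
split=> [a x x' y z w|x y z w|x y z w|x y z w]; rewrite /model_curvature /qterm.
- rewrite li lj lk !innerDl !innerDr !innerZl !innerZr; ring.
- by rewrite (ai x y) (aj x y) (ak x y) (C z x) (C z y); ring.
- by rewrite (ai w z) (aj w z) (ak w z) (C z y) (C w y); ring.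
- rewrite (ai x y) (aj x y) (ak x y) (ai z y) (aj z y) (ak z y) (ai x z) (aj x z) (ak x z).
  by ring.
Qed.

(** The commutator of the model with [i] is a combination of [j] and [k] whose coefficients are
    Kaehler forms. Hence subtracting the model from a curvature tensor preserves the property that
    commutators with i, j, k lie in their span. *)
Lemma model_commutator i j k x y z w : quaternionic_triple i j k ->
  model_curvature i j k x y (i z) w + model_curvature i j k x y z (i w) =
  4 * <<k y, x>> * <<j z, w>> - 4 * <<j y, x>> * <<k z, w>>.
Proof.
case=> [[li lj lk] [si sj sk] [qii qjj qkk] [qij qjk qki] [qji qkj qik]].
have C := innerC spdg.
have e1 a b : <<i a, i b>> = <<a, b>> by rewrite si qii innerNr opprK.
have e2 a b : <<j a, i b>> = - <<k a, b>>.
  by rewrite -[j a]opprK innerNl -qik si qii innerNr opprK.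
have e3 a b : <<k a, i b>> = <<j a, b>>.
  by rewrite -qij si qii innerNr opprK.
have e4 a b : <<a, i b>> = - <<i a, b>> by rewrite si opprK.
have e5 a b : <<i (i a), b>> = - <<a, b>> by rewrite qii innerNl.
have e6 a b : <<j (i a), b>> = - <<k a, b>> by rewrite qji innerNl.
have e7 a b : <<k (i a), b>> = <<j a, b>> by rewrite qki.
rewrite /model_curvature /qterm (C (i z) y) (C z y) !e5 !e6 !e7 !e1 !e2 !e3 !e4; ring.
Qed.

(** * The curvature tensor is determined by the quaternionic sectional curvatures *)

Section Ishihara.
Context (i j k : V -> V) (Rm : V -> V -> V -> V -> R) (c : R).
Hypothesis qt : quaternionic_triple i j k.
Hypothesis cRm : curvature_like Rm.
Hypothesis Rm_commutator : forall q, q = i \/ q = j \/ q = k ->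
  forall x y, exists a b e : R, forall z w,
    Rm x y (q z) w + Rm x y z (q w) = a * <<i z, w>> + b * <<j z, w>> + e * <<k z, w>>.
Definition quaternionic_span X x := exists a b e f : R, x = a *: X + b *: i X + e *: j X + f *: k X.
Hypothesis Rm_sectional : forall X x y, quaternionic_span X x -> quaternionic_span X y ->
  Rm x y y x = c * (<<x, x>> * <<y, y>> - <<x, y>> ^+ 2).

(** The aim is S = 0: the conditions on [Rm] become homogeneous conditions on [S]. *)
Let S x y z w := Rm x y z w - c / 4 * model_curvature i j k x y z w.

Let cS : curvature_like S.
Proof. by apply: curvature_like_comb => //; exact: curvature_like_model. Qed.

Let spanD X x y : quaternionic_span X x -> quaternionic_span X y -> quaternionic_span X (x + y).
Proof.
move=> [a [b [e [f ->]]]] [a' [b' [e' [f' ->]]]].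
exists (a + a'), (b + b'), (e + e'), (f + f').
by rewrite !scalerDl; apply/rowP => s; rewrite !mxE; ring.
Qed.

Let linD (q : V -> V) : linear q -> forall x y, q (x + y) = q x + q y.
Proof. by move=> lq x y; have := lq 1 x y; rewrite !scale1r. Qed.

Let linZ (q : V -> V) : linear q -> forall a x, q (a *: x) = a *: q x.
Proof.
move=> lq a x; have q0 : q 0 = 0.
  by apply/eqP; have /eqP := lq 1 0 0; rewrite !scale1r addr0 -subr_eq0 opprD addrA subrr sub0r oppr_eq0.
by have := lq a x 0; rewrite addr0 q0 addr0.
Qed.

Let cmb X (a b e f : R) := a *: X + b *: i X + e *: j X + f *: k X.

Let icmb X a b e f : i (cmb X a b e f) = cmb X (- b) a (- f) e.
Proof.
case: qt => [[li lj lk] _ [qii qjj qkk] [qij qjk qki] [qji qkj qik]].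
by rewrite /cmb !(linD li) !(linZ li) qii qij qik; apply/rowP => l; rewrite !mxE; ring.
Qed.

Let jcmb X a b e f : j (cmb X a b e f) = cmb X (- e) f a (- b).
Proof.
case: qt => [[li lj lk] _ [qii qjj qkk] [qij qjk qki] [qji qkj qik]].
by rewrite /cmb !(linD lj) !(linZ lj) qjj qji qjk; apply/rowP => l; rewrite !mxE; ring.
Qed.

Let kcmb X a b e f : k (cmb X a b e f) = cmb X (- f) (- e) b a.
Proof.
case: qt => [[li lj lk] _ [qii qjj qkk] [qij qjk qki] [qji qkj qik]].
by rewrite /cmb !(linD lk) !(linZ lk) qkk qki qkj; apply/rowP => l; rewrite !mxE; ring.
Qed.

Let spanE X x : quaternionic_span X x -> [/\ quaternionic_span X (i x),
  quaternionic_span X (j x) & quaternionic_span X (k x)].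
Proof.
move=> [a [b [e [f ->]]]]; rewrite -/(cmb X a b e f) icmb jcmb kcmb.
by split; do 4 eexists; reflexivity.
Qed.

Let span_self X : quaternionic_span X X.
Proof. by exists 1, 0, 0, 0; rewrite scale1r !scale0r !addr0. Qed.

(** For x, y in one quaternionic line, <x, y>^2 plus the three <x, q y>^2 equals |x|^2 |y|^2. So the
    model gives 4 times the Gram determinant, and [S] has no sectional curvature on the line. *)
Let S_span X x y z w : quaternionic_span X x -> quaternionic_span X y ->
  quaternionic_span X z -> quaternionic_span X w -> S x y z w = 0.
Proof.
apply: (cl_sectional0 cS (P := quaternionic_span X)); first exact: spanD.
move=> {}x {}y sx sy; rewrite /S (Rm_sectional sx sy) /model_curvature /qterm.
case: qt => [[li lj lk] [si sj sk] [qii qjj qkk] [qij qjk qki] [qji qkj qik]].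
have z0 (q : V -> V) : (forall x y, <<q x, y>> = - <<x, q y>>) -> forall u, <<q u, u>> = 0.
  by move=> sq u; have := sq u u; rewrite (innerC spdg u); lra.
have n (q : V -> V) : (forall x y, <<q x, y>> = - <<x, q y>>) -> (forall x, q (q x) = - x) ->
    <<q X, q X>> = <<X, X>>.
  by move=> sq qq; rewrite sq qq innerNr opprK.
have o (q q1 q2 : V -> V) : (forall x y, <<q x, y>> = - <<x, q y>>) ->
    (forall x y, <<q2 x, y>> = - <<x, q2 y>>) ->
    (forall x, q (q1 x) = q2 x) -> <<q X, q1 X>> = 0.
  by move=> sq s2 qr; rewrite sq qr -s2 z0 // oppr0.
have xq (q : V -> V) : (forall x y, <<q x, y>> = - <<x, q y>>) -> <<X, q X>> = 0.
  by move=> sq; rewrite (innerC spdg) z0.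
have [oij ojk oki] : [/\ <<i X, j X>> = 0, <<j X, k X>> = 0 & <<k X, i X>> = 0].
  by split; [exact: (o _ _ k)|exact: (o _ _ i)|exact: (o _ _ j)].
have [oji okj oik] : [/\ <<j X, i X>> = 0, <<k X, j X>> = 0 & <<i X, k X>> = 0].
  by split; rewrite (innerC spdg).
have ip a b e f a' b' e' f' : <<cmb X a b e f, cmb X a' b' e' f'>> =
    <<X, X>> * (a * a' + b * b' + e * e' + f * f').
  rewrite /cmb !innerDl !innerZl !innerDr !innerZr.
  rewrite oij ojk oki oji okj oik (z0 i) // (z0 j) // (z0 k) //.
  by rewrite (xq i) // (xq j) // (xq k) // (n i) // (n j) // (n k) //; ring.
rewrite (z0 i) // (z0 j) // (z0 k) //; move: sx sy => [a [b [e [f ->]]]] [a' [b' [e' [f' ->]]]].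
rewrite -/(cmb X a b e f) -/(cmb X a' b' e' f') !icmb !jcmb !kcmb !ip.
by field.
Qed.

Let S_commutator x y z w (q : V -> V) : (q = i \/ q = j \/ q = k) ->
  exists a b e : R, forall z w,
    S x y (q z) w + S x y z (q w) = a * <<i z, w>> + b * <<j z, w>> + e * <<k z, w>>.
Proof.
move=> Hq; have [a [b [e H]]] := Rm_commutator Hq x y.
have qt1 := quaternionic_triple_cycle qt; have qt2 := quaternionic_triple_cycle qt1.
have E (q' : V -> V) z' w' : S x y (q' z') w' + S x y z' (q' w') =
    Rm x y (q' z') w' + Rm x y z' (q' w') - c / 4 * (model_curvature i j k x y (q' z') w'
    + model_curvature i j k x y z' (q' w')) by rewrite /S; ring.
case: Hq H => [->|[->|->]] H.
- exists a, (b - c * <<k y, x>>), (e + c * <<j y, x>>) => z' w'.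
  by rewrite E H (model_commutator _ _ _ _ qt); field.
- exists (a + c * <<k y, x>>), b, (e - c * <<i y, x>>) => z' w'.
  by rewrite E H !(model_curvature_cycle i) (model_commutator _ _ _ _ qt1); field.
- exists (a - c * <<j y, x>>), (b + c * <<i y, x>>), e => z' w'.
  by rewrite E H -!(model_curvature_cycle k) (model_commutator _ _ _ _ qt2); field.
Qed.

(** For the pair (u, p u) the coefficients a, b, e of the commutator are read off at z = u, w = q'
    u, inside the quaternionic line of u where [S] vanishes; so N u (p u) = 0. Polarization gives N
    (p u) v = N u (p v), and moving k = i j across in two ways gives N u (k v) = - N u (k v). *)
Let S_kaehler x y z w (q : V -> V) : (q = i \/ q = j \/ q = k) ->
  S x y (q z) w + S x y z (q w) = 0.
Proof.
move=> Hq.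
pose N x y := S x y (q z) w + S x y z (q w).
have N0 p u : p = i \/ p = j \/ p = k -> N u (p u) = 0.
  move=> Hp; have [->|u0] := eqVneq u 0.
    by rewrite /N -[0](subrr 0) !(cl_add1 cS) !(cl_opp1 cS); ring.
  have [a [b [e H]]] := S_commutator u (p u) z w Hq.
  have sp q' : q' = i \/ q' = j \/ q' = k -> forall v, quaternionic_span u v -> quaternionic_span u (q' v).
    by move=> Hq' v /spanE[? ? ?]; case: Hq' => [->|[->|->]].
  have nu : <<u, u>> != 0 by rewrite gt_eqF //; exact: spdg.2.
  case: qt => [[li lj lk] [si sj sk] [qii qjj qkk] [qij qjk qki] [qji qkj qik]].
  have Z q' : q' = i \/ q' = j \/ q' = k -> a * <<i u, q' u>> + b * <<j u, q' u>> + e * <<k u, q' u>> = 0.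
    move=> Hq'; rewrite -H.
    have -> : S u (p u) (q u) (q' u) = 0.
      by apply: (@S_span u); [exact: span_self|exact: sp (span_self u)..].
    have -> : S u (p u) u (q (q' u)) = 0.
      apply: (@S_span u); [exact: span_self|exact: sp (span_self u)|exact: span_self|].
      exact: sp (sp _ Hq' _ (span_self u)).
    exact: addr0.
  have z0 (q' : V -> V) : (forall x y, <<q' x, y>> = - <<x, q' y>>) -> forall u, <<q' u, u>> = 0.
    by move=> sq v; have := sq v v; rewrite (innerC spdg v); lra.
  have n (q' : V -> V) : (forall x y, <<q' x, y>> = - <<x, q' y>>) -> (forall x, q' (q' x) = - x) ->
      <<q' u, q' u>> = <<u, u>>.
    by move=> sq qq; rewrite sq qq innerNr opprK.
  have oij : <<i u, j u>> = 0 by rewrite si qij -sk z0 ?oppr0.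
  have ojk : <<j u, k u>> = 0 by rewrite sj qjk -si z0 ?oppr0.
  have oki : <<k u, i u>> = 0 by rewrite sk qki -sj z0 ?oppr0.
  have Zi := Z i (or_introl erefl); have Zj := Z j (or_intror (or_introl erefl)).
  have Zk := Z k (or_intror (or_intror erefl)).
  move: Zi Zj Zk; rewrite !n // oij ojk oki (innerC spdg (j u)) oij (innerC spdg (k u)) ojk.
  rewrite (innerC spdg (i u)) oki !mulr0 !addr0 !add0r.
  move=> /eqP; rewrite mulf_eq0 (negPf nu) orbF => /eqP a0.
  move=> /eqP; rewrite mulf_eq0 (negPf nu) orbF => /eqP b0.
  move=> /eqP; rewrite mulf_eq0 (negPf nu) orbF => /eqP e0.
  by rewrite /N H a0 b0 e0 !mul0r !addr0.
have ND p u v : p = i \/ p = j \/ p = k -> linear p -> N (p u) v = N u (p v).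
  move=> Hp lp; have := N0 p (u + v) Hp; rewrite (linD lp) /N.
  rewrite !(cl_add1 cS) !(cl_add2 cS).
  have := N0 p u Hp; have := N0 p v Hp; rewrite /N.
  have := cl_antisym cS (p u) v (q z) w; have := cl_antisym cS (p u) v z (q w).
  lra.
case: qt => [[li lj lk] _ [qii qjj qkk] [qij qjk qki] [qji qkj qik]].
have Nk u v : N u (k v) = 0.
  have : N u (k v) = - N u (k v).
    have E := ND k u v (or_intror (or_intror erefl)) lk.
    rewrite -{1}qij -(ND i u (j v) (or_introl erefl) li).
    rewrite -(ND j (i u) v (or_intror (or_introl erefl)) lj) qji -E.
    by rewrite /N !(cl_opp1 cS); ring.
  lra.
have -> : S x y (q z) w + S x y z (q w) = N x y by [].
have -> : y = k (- k y).
  by rewrite -scaleN1r (linZ lk) qkk scaleN1r opprK.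
exact: Nk.
Qed.

(** [S] is now of Kaehler type, and S(u, iu, u, iu) = 0 on the line of each u. As in the classical
    argument for holomorphic sectional curvature, polarization and the Bianchi identity give S(a, b,
    a, b) = -3 S(a, ib, a, ib). *)
Lemma space_form_curvature x y z w : Rm x y z w = c / 4 * model_curvature i j k x y z w.
Proof.
suff : S x y z w = 0 by rewrite /S => /eqP; rewrite subr_eq0 => /eqP.
case: qt => [[li lj lk] _ [qii qjj qkk] [qij qjk qki] [qji qkj qik]].
have K a b e f : S a b (i e) (i f) = S a b e f.
  have := S_kaehler a b e (i f) (or_introl erefl).
  by rewrite qii (cl_opp4 cS); lra.
have K' a b e f : S (i a) (i b) e f = S a b e f.
  by rewrite (cl_pair cS) K -(cl_pair cS).
have h u : S u (i u) u (i u) = 0.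
  have [? _ _] := spanE (span_self u).
  by apply: (@S_span u) => //; exact: span_self.
(* Q(a,b,e,f) = S(a, i b, e, i f) is symmetric in (a,b), in (e,f) and under (a,b)<->(e,f) *)
have s1 a b e f : S a (i b) e f = S b (i a) e f.
  have := K' a (i b) e f; rewrite qii (cl_opp2 cS).
  by have := cl_antisym cS b (i a) e f; lra.
have pol a b : S a (i a) b (i b) + 2 * S a (i b) a (i b) = 0.
  have e1 := h (a + b); have e2 := h (a - b).
  have ha := h a; have hb := h b.
  rewrite (linD li) !(cl_add1 cS) !(cl_add2 cS) !(cl_add3 cS) !(cl_add4 cS) in e1.
  have iN : i (- b) = - i b by rewrite -scaleN1r (linZ li) scaleN1r.
  rewrite (linD li) iN !(cl_add1 cS) !(cl_add2 cS) !(cl_add3 cS) !(cl_add4 cS) in e2.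
  rewrite !(cl_opp1 cS, cl_opp2 cS, cl_opp3 cS, cl_opp4 cS) in e2.
  have f1 := cl_pair cS b (i b) a (i a).
  have f2 := s1 b a b (i a); have f3 := s1 a b b (i a).
  have f4 := s1 b a a (i b).
  have f5 := cl_pair cS a (i b) b (i a).
  have f6 := cl_pair cS b (i a) a (i b).
  have f7 e f : S e f b (i a) = S e f a (i b) by rewrite ![S e f _ _](cl_pair cS) s1.
  have g1 := f7 a (i b); have g2 := f7 b (i a).
  lra.
have q1 a b : S a b a b + 3 * S a (i b) a (i b) = 0.
  have p := pol a b; have bi := cl_bianchi cS a (i a) b (i b).
  have t1 : S (i a) b a (i b) = - S a (i b) a (i b).
    by rewrite -K' qii (cl_opp1 cS).
  have t2 : S b a (i a) (i b) = - S a b a b by rewrite K (cl_antisym cS).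
  lra.
apply: (cl_sectional0 cS (P := fun=> True)) => // a b _ _.
(* Used for b and for i b, the relation gives S(a, b, a, b) = 9 S(a, b, a, b). *)
have h1 := q1 a b; have h2 := q1 a (i b).
rewrite qii (cl_opp2 cS) (cl_opp4 cS) opprK in h2.
have := cl_skew cS a b b a; lra.
Qed.

End Ishihara.

End QuaternionicCurvature.

(** * Rank-one second fundamental forms and the Codazzi equation *)

Section CodazziObstruction.
Context (R : realType) (n : nat) (g : 'M[R]_n).
Hypothesis spdg : spd g.
Local Notation V := 'rV[R]_n.
Implicit Types (x y z : V).

(** What the tangential parts of a quaternionic triple retain, with s = cos^2 theta. Nothing relates
    p1 p2 to p3. *)
Record slant_triple (s : R) (p1 p2 p3 : V -> V) : Prop := SlantTriple {
  st_pos : 0 < s;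
  st_skew : [/\ forall x y, inner g (p1 x) y = - inner g x (p1 y),
     forall x y, inner g (p2 x) y = - inner g x (p2 y) &
     forall x y, inner g (p3 x) y = - inner g x (p3 y)];
  st_sq : [/\ forall x, p1 (p1 x) = - (s *: x), forall x, p2 (p2 x) = - (s *: x) &
     forall x, p3 (p3 x) = - (s *: x)];
  st_anti : [/\ forall x, p1 (p2 x) = - p2 (p1 x), forall x, p2 (p3 x) = - p3 (p2 x) &
     forall x, p3 (p1 x) = - p1 (p3 x)]
}.

Definition quasi_umbilical_form (e : V) (lam : R) x y : R :=
  inner g x y + (lam - 1) * inner g x e * inner g y e.

(** Here d stands for the derivative of zeta paired with nu, and f_a(x) for <J_a x, nu>. Four
    evaluations of the Codazzi equation eliminate d(p3 e), f1(p2 e) and f2(p1 e) and leave (lam t^2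
    - s^3) f3(e) = 0, where t is an inner product that the triple relations leave free. *)
Lemma quasi_umbilical_obstruction (s lam kap : R) (p1 p2 p3 : V -> V) (e : V)
    (d f1 f2 f3 : V -> R) :
  slant_triple s p1 p2 p3 -> inner g e e = 1 -> 0 < lam -> lam != 1 -> kap != 0 ->
  (forall x y z, quasi_umbilical_form e lam y z * d x - quasi_umbilical_form e lam x z * d y =
    kap * ((inner g z (p1 y) * f1 x - inner g z (p1 x) * f1 y + 2 * inner g x (p1 y) * f1 z)
      + (inner g z (p2 y) * f2 x - inner g z (p2 x) * f2 y + 2 * inner g x (p2 y) * f2 z)
      + (inner g z (p3 y) * f3 x - inner g z (p3 x) * f3 y + 2 * inner g x (p3 y) * f3 z))) ->
  f3 e = 0.
Proof.
move=> [s0 [k1 k2 k3] [q1 q2 q3] [a12 a23 a31]] ee lam0 lam1 kap0 H.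
have C := innerC spdg.
have z0 (p : V -> V) : (forall x y, inner g (p x) y = - inner g x (p y)) ->
    forall u, inner g u (p u) = 0.
  by move=> kp u; have := kp u u; rewrite (C (p u)); lra.
have m (p q : V -> V) : (forall x y, inner g (p x) y = - inner g x (p y)) ->
    (forall x y, inner g (q x) y = - inner g x (q y)) ->
    (forall x, p (q x) = - q (p x)) -> forall u, inner g (p u) (q u) = 0.
  move=> kp kq pq u; have E1 := kp u (q u); have E2 := kq u (p u).
  by rewrite pq innerNr in E1; rewrite C in E2; lra.
have a21 x : p2 (p1 x) = - p1 (p2 x) by rewrite a12 opprK.
have a32 x : p3 (p2 x) = - p2 (p3 x) by rewrite a23 opprK.
have a13 x : p1 (p3 x) = - p3 (p1 x) by rewrite a31 opprK.
have r1 := z0 _ k1; have r2 := z0 _ k2; have r3 := z0 _ k3.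
have l1 u : inner g (p1 u) u = 0 by rewrite C.
have l2 u : inner g (p2 u) u = 0 by rewrite C.
have l3 u : inner g (p3 u) u = 0 by rewrite C.
have m12 := m _ _ k1 k2 a12; have m23 := m _ _ k2 k3 a23; have m31 := m _ _ k3 k1 a31.
have m21 u : inner g (p2 u) (p1 u) = 0 by rewrite C.
have m32 u : inner g (p3 u) (p2 u) = 0 by rewrite C.
have m13 u : inner g (p1 u) (p3 u) = 0 by rewrite C.
have w12 u : inner g u (p1 (p2 u)) = 0 by have := k1 u (p2 u); rewrite m12; lra.
have w21 u : inner g u (p2 (p1 u)) = 0 by have := k2 u (p1 u); rewrite m21; lra.
have w13 u : inner g u (p1 (p3 u)) = 0 by have := k1 u (p3 u); rewrite m13; lra.
have w23 u : inner g u (p2 (p3 u)) = 0 by have := k2 u (p3 u); rewrite m23; lra.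
have w31 u : inner g u (p3 (p1 u)) = 0 by have := k3 u (p1 u); rewrite m31; lra.
have w32 u : inner g u (p3 (p2 u)) = 0 by have := k3 u (p2 u); rewrite m32; lra.
have sq1 u v : inner g u (p1 (p1 v)) = - (s * inner g u v) by rewrite q1 innerNr innerZr.
have sq2 u v : inner g u (p2 (p2 v)) = - (s * inner g u v) by rewrite q2 innerNr innerZr.
have sq3 u v : inner g u (p3 (p3 v)) = - (s * inner g u v) by rewrite q3 innerNr innerZr.
have n1 u : inner g (p1 u) (p1 u) = s * inner g u u by rewrite k1 sq1 opprK.
have n2 u : inner g (p2 u) (p2 u) = s * inner g u u by rewrite k2 sq2 opprK.
have n3 u : inner g (p3 u) (p3 u) = s * inner g u u by rewrite k3 sq3 opprK.
have b112 u : inner g (p1 u) (p1 (p2 u)) = 0 by rewrite k1 sq1 r2 mulr0 !oppr0.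
have b221 u : inner g (p2 u) (p2 (p1 u)) = 0 by rewrite k2 sq2 r1 mulr0 !oppr0.
have b223 u : inner g (p2 u) (p2 (p3 u)) = 0 by rewrite k2 sq2 r3 mulr0 !oppr0.
(* This is also <p1 p2 e, p3 e>. Since |p1 p2 e|^2 = s^2 and |p3 e|^2 = s, Cauchy-Schwarz gives t^2
   <= s^3, with equality when p1 p2 e is parallel to p3 e. *)
pose t := inner g (p2 e) (p3 (p1 e)).
have t1 : inner g (p1 e) (p3 (p2 e)) = - t by rewrite -[LHS]opprK -k3 C.
have t2 : inner g (p2 e) (p1 (p3 e)) = - t by rewrite a13 innerNr.
have Ha := H e (p3 e) e; have Hb := H e (p1 e) (p2 e).
have Hc := H e (p2 e) (p1 e); have Hd := H (p2 e) (p3 e) (p2 e).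
rewrite /quasi_umbilical_form in Ha Hb Hc Hd.
rewrite !(r1, r2, r3, l1, l2, l3, w13, w23, sq3, ee) in Ha.
rewrite !(r1, r2, r3, l1, l2, l3, m12, m21, m23, n2, w21, w31, sq1, b221, ee) -/t in Hb.
rewrite !(r1, r2, r3, l1, l2, l3, m12, m21, m13, n1, w12, w32, sq2, b112, t1, ee) in Hc.
rewrite !(r1, r2, r3, l1, l2, l3, m23, m32, n2, sq3, b223, t2, ee) in Hd.
have Ea : lam * d (p3 e) = 3 * kap * s * f3 e by lra.
have Eb : t * f3 e - s * f2 (p1 e) - 2 * s * f1 (p2 e) = 0.
  by apply: (mulfI kap0); rewrite mulr0; move: Hb; lra.
have Ec : - t * f3 e - s * f1 (p2 e) - 2 * s * f2 (p1 e) = 0.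
  by apply: (mulfI kap0); rewrite mulr0; move: Hc; lra.
have Ed : s * d (p3 e) = 3 * kap * t * f1 (p2 e) by move: Hd; lra.
have E0 : t * f3 e = s * f1 (p2 e) by lra.
have E1 : (lam * t ^+ 2 - s ^+ 3) * f3 e = 0.
  apply: (mulfI kap0); rewrite mulr0.
  have A : s * (s * (lam * d (p3 e))) = 3 * kap * s ^+ 3 * f3 e by rewrite Ea; ring.
  have B : s * (s * (lam * d (p3 e))) = 3 * kap * lam * t * (t * f3 e).
    have -> : s * (s * (lam * d (p3 e))) = s * lam * (s * d (p3 e)) by ring.
    by rewrite Ed E0; ring.
  by move: A B => -> ?; lra.
(* If t^2 = s^3 the factor is (lam - 1) s^3, nonzero because lam <> 1. Otherwise p1 p2 e has a
   nonzero component orthogonal to p3 e, and the equation is tested on it. *)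
have [ts|ts] := eqVneq (t ^+ 2) (s ^+ 3).
  move: E1; rewrite ts -{2}[s ^+ 3]mul1r -mulrBl => /eqP.
  by rewrite mulf_eq0 mulf_eq0 subr_eq0 (negPf lam1) expf_eq0 (gt_eqF s0) /= => /eqP.
(* u is orthogonal to e, p1 e, p2 e and p3 e, which forces d (p3 e) = 0 *)
pose u := s *: p1 (p2 e) - t *: p3 e.
have tt : inner g (p1 (p2 e)) (p3 e) = t by rewrite k1 t2 opprK.
have ue : inner g u e = 0.
  by rewrite /u innerBl !innerZl l3 (C _ e) w12; lra.
have u3 : inner g u (p3 e) = 0.
  by rewrite /u innerBl !innerZl tt n3 ee; lra.
have u33 : inner g u (p3 (p3 e)) = 0 by rewrite sq3 ue mulr0 oppr0.
have u13 : inner g u (p1 (p3 e)) = 0.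
  rewrite /u innerBl !innerZl k1 sq1 m23 (C (p3 e)) l1; lra.
have u23 : inner g u (p2 (p3 e)) = 0.
  rewrite /u innerBl !innerZl (C (p3 e)) l2 a12 innerNl k2 sq2 m13; lra.
have uu : inner g u u = s * (s ^+ 3 - t ^+ 2).
  rewrite {2}/u innerBr !innerZr u3 mulr0 subr0 /u innerBl !innerZl n1 n2 ee.
  by rewrite (C (p3 e)) tt; ring.
have := H u (p3 e) u; rewrite /quasi_umbilical_form.
rewrite (C (p3 e) u) u3 ue l3 uu u13 u23 u33 r1 r2 r3 => Hu.
have d0 : d (p3 e) = 0.
  have nz : s * (s ^+ 3 - t ^+ 2) != 0.
    by apply: mulf_neq0; [rewrite gt_eqF|rewrite subr_eq0 eq_sym].
  by apply: (mulfI nz); lra.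
move: Ea; rewrite d0 mulr0 => /esym/eqP.
rewrite !mulf_eq0 (negPf kap0) (gt_eqF s0) pnatr_eq0 /=.
by move=> /eqP.
Qed.

End CodazziObstruction.

(** * The Casorati inequality for symmetric matrices *)

(** x, b, y and t are the squared norm of the block of H on the hyperplane, that of its mixed block,
    its entry on the normal, and its trace on the hyperplane. The right side collects the trace-free
    part of the first block, the mixed block and the deviation from t = (r / N) y, with positive
    coefficients when r > 0 and N > 1. *)
Lemma casorati_defect_identity (R : realFieldType) (N r x b t y : R) :
  N != 0 -> N - 1 != 0 -> r != 0 ->
  (r + N) / N * (x + 2 * b + y ^+ 2) + (N + r) * (N ^+ 2 - N - r) / (r * N) * x - (t + y) ^+ 2 =
  (r + N) * (N - 1) / r * (x - 2 * (t / (N - 1)) * t + (t / (N - 1)) ^+ 2 * (N - 1))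
  + 2 * (r + N) / N * b + N / r * (t - r / N * y) ^+ 2.
Proof. by move=> N0 N1 r0; field; rewrite N0 N1 r0. Qed.

Section Casorati.
Context (R : realType) (n : nat).
Implicit Types (w : 'rV[R]_n) (H : 'M[R]_n).

Lemma mxtrace_sqr_ge0 k l (A : 'M[R]_(k, l)) : 0 <= \tr (A *m A^T).
Proof.
rewrite /mxtrace; apply: sumr_ge0 => i _; rewrite mxE; apply: sumr_ge0 => j _.
by rewrite mxE -expr2 sqr_ge0.
Qed.

Lemma mxtrace_sqr_eq0 k l (A : 'M[R]_(k, l)) : \tr (A *m A^T) = 0 -> A = 0.
Proof.
rewrite /mxtrace => /eqP; rewrite psumr_eq0 => [/allP A0|i _]; last first.
  by rewrite mxE; apply: sumr_ge0 => j _; rewrite mxE -expr2 sqr_ge0.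
apply/matrixP => i j; have := A0 i (mem_index_enum i); rewrite mxE psumr_eq0 /=.
  by move=> /allP/(_ j (mem_index_enum j)); rewrite mxE /= -expr2 sqrf_eq0 !mxE => /eqP.
by move=> l' _; rewrite mxE -expr2 sqr_ge0.
Qed.

Definition hyperplane_proj w : 'M[R]_n := 1%:M - w^T *m w.
Local Notation P := hyperplane_proj.

Section UnitNormal.
Variables (w : 'rV[R]_n).
Hypothesis w1 : w *m w^T = 1%:M.

Lemma hyperplane_projT : (P w)^T = P w.
Proof. by rewrite /P linearB /= trmx1 trmx_mul trmxK. Qed.

Lemma mul_normal_proj : w *m P w = 0.
Proof. by rewrite /P mulmxBr mulmx1 mulmxA w1 mul1mx subrr. Qed.

Lemma hyperplane_proj_idem : P w *m P w = P w.
Proof. by rewrite {1}/P mulmxBl mul1mx -mulmxA mul_normal_proj mulmx0 subr0. Qed.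

Lemma mxtrace_normal (A : 'M[R]_n) : \tr (A *m (w^T *m w)) = (w *m A *m w^T) 0 0.
Proof. by rewrite mulmxA mxtrace_mulC mulmxA trace_mx11. Qed.

Lemma mxtrace_hyperplane_proj : \tr (P w) = n%:R - 1.
Proof. by rewrite /P raddfB /= mxtrace1 -[w^T *m w]mul1mx mxtrace_normal mulmx1 w1 mxE. Qed.

Variables (H : 'M[R]_n) (HT : H^T = H).

Let q := (w *m H *m w^T) 0 0.
Let T := \tr H - q.
Let SL := \tr (H *m P w *m H *m P w).
Let n1 : R := n%:R - 1.

Let trHP : \tr (H *m P w) = T.
Proof. by rewrite /P mulmxBr mulmx1 raddfB /= mxtrace_normal. Qed.

(** At a = T / n1 this is the trace-free part of H on the hyperplane. *)
Let D (a : R) : 'M[R]_n := P w *m H *m P w - a *: P w.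

Let DT a : (D a)^T = D a.
Proof. by rewrite /D linearB /= linearZ /= !trmx_mul hyperplane_projT HT mulmxA. Qed.

Let trD a : \tr (D a *m (D a)^T) = SL - 2 * a * T + a ^+ 2 * n1.
Proof.
rewrite DT /D; set X := P w *m H *m P w.
have XP : X *m P w = X by rewrite /X -mulmxA hyperplane_proj_idem.
have PX : P w *m X = X by rewrite /X !mulmxA hyperplane_proj_idem.
have XX : X *m X = P w *m (H *m P w *m H *m P w) by rewrite {2}/X !mulmxA XP /X.
have tX : \tr X = T by rewrite /X -mulmxA mxtrace_mulC -mulmxA hyperplane_proj_idem trHP.
have tXX : \tr (X *m X) = SL by rewrite XX mxtrace_mulC -[_ *m P w *m P w]mulmxA hyperplane_proj_idem.
have -> : (X - a *: P w) *m (X - a *: P w) = X *m X - (2 * a) *: X + a ^+ 2 *: P w.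
  rewrite mulmxBl !mulmxBr -!scalemxAl -!scalemxAr XP PX hyperplane_proj_idem.
  by apply/matrixP => i' j'; rewrite !mxE; ring.
by rewrite mxtraceD mxtraceZ mxtrace_hyperplane_proj raddfB /= mxtraceZ tX tXX -/n1; ring.
Qed.

Let B := w *m H *m P w.

Let trHH : \tr (H *m H) = SL + 2 * \tr (B *m B^T) + q ^+ 2.
Proof.
pose X := H *m P w; pose Y := H *m (w^T *m w).
have E : H = X + Y by rewrite /X /Y -mulmxDr /P subrK mulmx1.
have tXY : \tr (X *m Y) = \tr (B *m B^T).
  rewrite /X /Y mulmxA mxtrace_normal /B !trmx_mul hyperplane_projT HT trace_mx11 !mulmxA.
  by rewrite -[w *m H *m P w *m P w]mulmxA hyperplane_proj_idem.
have tYY : \tr (Y *m Y) = q ^+ 2.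
  rewrite /Y mulmxA mxtrace_normal -mulmxA.
  have -> : w *m (H *m (w^T *m w) *m H *m w^T) = (w *m H *m w^T) *m (w *m H *m w^T).
    by rewrite !mulmxA.
  by rewrite mxE big_ord1 expr2.
have -> : \tr (H *m H) = \tr (X *m X) + \tr (X *m Y) + (\tr (Y *m X) + \tr (Y *m Y)).
  by rewrite {1 2}E mulmxDl !(mulmxDr _ X Y) !mxtraceD.
rewrite (mxtrace_mulC Y X) tXY tYY /X mulmxA -/SL; ring.
Qed.

Variables (r : R).
Hypotheses (r0 : 0 < r) (n2 : (1 < n)%N).

Let n10 : 0 < n1.
Proof. by rewrite /n1 subr_gt0 ltr1n. Qed.

Let n0 : 0 < (n%:R : R).
Proof. by rewrite ltr0n (ltn_trans _ n2). Qed.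

Definition casorati_defect : R :=
  (r + n%:R) / n%:R * \tr (H *m H)
  + (n%:R + r) * (n%:R ^+ 2 - n%:R - r) / (r * n%:R) * \tr (H *m P w *m H *m P w)
  - \tr H ^+ 2.

Let defectE : casorati_defect =
  (r + n%:R) * n1 / r * \tr (D (T / n1) *m (D (T / n1))^T)
  + 2 * (r + n%:R) / n%:R * \tr (B *m B^T) + n%:R / r * (T - r / n%:R * q) ^+ 2.
Proof.
rewrite trD /casorati_defect trHH -/SL.
have -> : \tr H = T + q by rewrite /T subrK.
have /lt0r_neq0 nn1 := n10; have /lt0r_neq0 nn := n0; have /lt0r_neq0 rr := r0.
exact: casorati_defect_identity.
Qed.

Lemma casorati_defect_ge0 : 0 <= casorati_defect.
Proof.
rewrite defectE; have rn : 0 < r + n%:R by rewrite addr_gt0.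
apply: addr_ge0; last by rewrite mulr_ge0 ?sqr_ge0 // divr_ge0 // ltW.
apply: addr_ge0; apply: mulr_ge0; try exact: mxtrace_sqr_ge0.
  by rewrite divr_ge0 ?mulr_ge0 // ltW.
by rewrite divr_ge0 ?mulr_ge0 // ltW.
Qed.

Lemma casorati_defect_eq0 : casorati_defect = 0 <->
  exists t, H = t *: (P w + (n%:R * n1 / r) *: (w^T *m w)).
Proof.
have rn : 0 < r + n%:R by rewrite addr_gt0.
have c1 : 0 < (r + n%:R) * n1 / r by rewrite divr_gt0 ?mulr_gt0.
have c2 : 0 < 2 * (r + n%:R) / n%:R by rewrite divr_gt0 ?mulr_gt0.
have c3 : 0 < n%:R / r by rewrite divr_gt0.
have /lt0r_neq0 nn1 := n10; have /lt0r_neq0 nn := n0; have /lt0r_neq0 rr := r0.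
split=> [E|[t Ht]].
  have A0 := mxtrace_sqr_ge0 (D (T / n1)); have B0 := mxtrace_sqr_ge0 B.
  have C0 := sqr_ge0 (T - r / n%:R * q).
  have := E; rewrite defectE => /eqP.
  rewrite paddr_eq0; [|by rewrite addr_ge0 // mulr_ge0 // ltW|by rewrite mulr_ge0 // ltW].
  rewrite paddr_eq0; [|by rewrite mulr_ge0 // ltW|by rewrite mulr_ge0 // ltW].
  have F (c x : R) : 0 < c -> c * x == 0 -> x = 0.
    by move=> c0; rewrite mulf_eq0 gt_eqF //= => /eqP.
  move=> /andP[/andP[/(F _ _ c1)/mxtrace_sqr_eq0 DA /(F _ _ c2)/mxtrace_sqr_eq0 BA]].
  move=> /(F _ _ c3)/eqP; rewrite sqrf_eq0 subr_eq0 => /eqP TA.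
  (* The common eigenvalue on the hyperplane. [TA] makes the normal entry q = (n / r) T, that is (n
     n1 / r) times this eigenvalue. *)
  exists (T / n1).
  have wHw : w *m H = q *: w.
    have -> : w *m H = B + w *m H *m (w^T *m w) by rewrite /B -mulmxDr /P subrK mulmx1.
    by rewrite BA add0r mulmxA [w *m H *m w^T]mx11_scalar -/q mul_scalar_mx.
  have Hw : H *m w^T = q *: w^T by rewrite -[LHS]trmxK trmx_mul trmxK HT wHw linearZ.
  have PHP : P w *m H *m P w = (T / n1) *: P w by apply/eqP; rewrite -subr_eq0; apply/eqP.
  have E1 : H = P w *m H *m P w + q *: (w^T *m w).
    rewrite {2}/P mulmxBr mulmx1 {1}/P mulmxBl mul1mx -mulmxA wHw -scalemxAr.
    have Z : (H - q *: (w^T *m w)) *m w^T = 0.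
      by rewrite mulmxBl Hw -scalemxAl -mulmxA w1 mulmx1 subrr.
    by rewrite [_ *m (w^T *m w)]mulmxA Z mul0mx subr0 subrK.
  rewrite {1}E1 PHP [RHS]scalerDr scalerA; congr (_ + _ *: _).
  by rewrite TA; field; rewrite nn1 nn rr.
rewrite defectE.
have wP := mul_normal_proj.
have Pw : P w *m w^T = 0 by rewrite -[LHS]trmxK trmx_mul trmxK hyperplane_projT wP trmx0.
have ww : w *m (w^T *m w) = w by rewrite mulmxA w1 mul1mx.
have wH : w *m H = (t * (n%:R * n1 / r)) *: w.
  by rewrite Ht -scalemxAr mulmxDr wP add0r -scalemxAr ww scalerA.
have qE : q = t * (n%:R * n1 / r) by rewrite /q wH -scalemxAl w1 mxE mxE mulr1.
have TE : T = t * n1.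
  rewrite /T qE Ht mxtraceZ mxtraceD mxtraceZ mxtrace_hyperplane_proj.
  rewrite -[w^T *m w]mul1mx mxtrace_normal mulmx1 w1 mxE mulr1 -/n1; ring.
have B0 : B = 0 by rewrite /B wH -scalemxAl wP scaler0.
have PH : P w *m H = t *: P w.
  rewrite Ht -scalemxAr [P w *m (P w + _)]mulmxDr hyperplane_proj_idem -scalemxAr mulmxA Pw.
  by rewrite mul0mx scaler0 addr0.
have -> : D (T / n1) = 0 by rewrite /D PH -scalemxAl hyperplane_proj_idem TE mulfK // subrr.
rewrite B0 !mul0mx mxtrace0 !mulr0 !add0r qE TE.
have -> : t * n1 - r / n%:R * (t * (n%:R * n1 / r)) = 0 by field; rewrite nn rr.
by rewrite mxtrace0 expr2 !mulr0 addr0.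
Qed.

End UnitNormal.

Definition reflection (v : 'rV[R]_n) (s : R) : 'M[R]_n := 1%:M - (2 / s) *: (v^T *m v).

Lemma reflectionT v s : (reflection v s)^T = reflection v s.
Proof. by rewrite /reflection linearB linearZ /= trmx_mul trmxK trmx1. Qed.

Lemma reflection_sqr v s : v *m v^T = s%:M -> s != 0 -> reflection v s *m reflection v s = 1%:M.
Proof.
move=> vv s0; rewrite /reflection; set N := v^T *m v.
have NN : N *m N = s *: N by rewrite /N mulmxA -[v^T *m v *m v^T]mulmxA vv mul_mx_scalar -scalemxAl.
rewrite mulmxBl mul1mx mulmxBr mulmx1 -scalemxAl -scalemxAr NN !scalerA.
have -> : 2 / s * (2 / s) * s = 2 / s + 2 / s by field.
by apply/matrixP => i j; rewrite !mxE; ring.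
Qed.

(* Householder reflection exchanging w and the i-th basis vector *)
Lemma orthogonal_extension w (i : 'I_n) : w *m w^T = 1%:M ->
  exists U : 'M[R]_n, U *m U^T = 1%:M /\ row i U = w.
Proof.
move=> w1; pose e : 'rV[R]_n := delta_mx 0 i.
have e1 : e *m e^T = 1%:M.
  by rewrite trmx_delta mul_delta_mx [RHS]mx11_scalar mxE /=; apply/matrixP => a b; rewrite !mxE !ord1.
have [we|we] := eqVneq e w.
  by exists 1%:M; rewrite trmx1 mulmx1 row1; split.
pose v := e - w; pose s := (v *m v^T) 0 0.
have vv : v *m v^T = s%:M by rewrite [LHS]mx11_scalar.
have s0 : s != 0.
  apply: contra_neq we => s0; apply/eqP; rewrite -subr_eq0; apply/eqP.
  by apply: mxtrace_sqr_eq0; rewrite -/v vv s0 mxtrace_scalar.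
have sE : s = 2 * (1 - (e *m w^T) 0 0).
  have ew : w *m e^T = e *m w^T.
    by rewrite [LHS]mx11_scalar [RHS]mx11_scalar -[w *m e^T]trmxK trmx_mul trmxK mxE.
  by rewrite /s /v linearB /= mulmxBl !mulmxBr e1 w1 ew !mxE /=; ring.
exists (reflection v s); split; first by rewrite reflectionT reflection_sqr.
rewrite rowE -/e /reflection mulmxBr mulmx1 -scalemxAr mulmxA.
have -> : e *m v^T = (s / 2)%:M.
  rewrite [LHS]mx11_scalar; congr (_%:M).
  have X : (1%:M - e *m w^T) 0 0 = 1 - (e *m w^T) 0 0 by rewrite !mxE.
  rewrite /v linearB /= mulmxBr e1 X sE.
  by move: ((e *m w^T) 0 0) => x; field.
rewrite mul_scalar_mx scalerA; have -> : 2 / s * (s / 2) = 1 by field.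
by rewrite scale1r /v opprB addrC subrK.
Qed.

End Casorati.

(** * Orthonormal families *)

Section OrthonormalBases.
Context (R : realType).

(** Gram-Schmidt: as G E^T has only k < n columns, its left kernel contains a nonzero vector; it is
    orthogonal to the k rows already found and is normalized. *)
Lemma spd_orthonormal_family n (G : 'M[R]_n) k : spd G -> (k <= n)%N ->
  exists E : 'M[R]_(k, n), E *m G *m E^T = 1%:M.
Proof.
move=> spdG; elim: k => [|k IH] kn.
  by exists 0; apply/matrixP => i; case: i.
have [E EE] := IH (ltnW kn).
pose K := kermx (G *m E^T).
have K0 : K != 0.
  rewrite -mxrank_eq0 mxrank_ker subn_eq0 -ltnNge.
  exact: leq_ltn_trans (rank_leq_col _) kn.
have [i Ki] : exists i, row i K != 0.
  apply/existsP; apply: contraNT K0; rewrite negb_exists => /forallP H.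
  by apply/eqP/row_matrixP => i; rewrite row0; apply/eqP; have := H i; rewrite negbK.
pose u := row i K; pose a := Num.sqrt (inner G u u).
have u0 : 0 < inner G u u by exact: spdG.2.
have a0 : a != 0 by rewrite gt_eqF // sqrtr_gt0.
have uE : u *m G *m E^T = 0 by rewrite -mulmxA -row_mul mulmx_ker row0.
have Eu : E *m G *m u^T = 0.
  have -> : E *m G *m u^T = (u *m G *m E^T)^T by rewrite !trmx_mul trmxK spdG.1 mulmxA.
  by rewrite uE trmx0.
pose E' : 'M[R]_(1 + k, n) := col_mx (a^-1 *: u) E.
suff H : E' *m G *m E'^T = 1%:M by exists E'.
rewrite /E' mul_col_mx tr_col_mx mul_col_row linearZ /= -!scalemxAl -!scalemxAr -?scalemxAl.
rewrite uE Eu EE !scaler0 scalerA [RHS](@scalar_mx_block _ 1 k); congr block_mx.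
rewrite [LHS]mx11_scalar mxE -innerE; congr (_%:M).
by rewrite -[inner G u u]sqr_sqrtr ?ltW // -/a; field.
Qed.

(** An orthonormal family for the Gram matrix of a row basis of [L] provides the coefficients of the
    new basis. *)
Lemma orthonormal_basis_subspace n k s (G : 'M[R]_n) (L : 'M[R]_(k, n)) :
  spd G -> \rank L = s ->
  exists E : 'M[R]_(s, n), E *m G *m E^T = 1%:M /\ (E :=: L)%MS.
Proof.
move=> spdG <-; pose B := row_base L.
have spdB : spd (B *m G *m B^T) by apply: spd_mulmx => //; exact: row_base_free.
have [C CC] := spd_orthonormal_family spdB (leqnn _).
exists (C *m B); split; first by rewrite -CC trmx_mul !mulmxA.
have fC : row_full C.
  rewrite row_full_unit -row_free_unit; apply/row_freeP.
  by exists (B *m G *m B^T *m C^T); rewrite !mulmxA in CC *.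
exact: eqmx_trans (eqmxMfull _ fC) (eq_row_base L).
Qed.

Lemma orthonormal_expansion n s (G : 'M[R]_n) (E : 'M[R]_(s, n)) (v : 'rV[R]_n) :
  E *m G *m E^T = 1%:M -> (v <= E)%MS -> v = (v *m G *m E^T) *m E.
Proof.
by move=> EE /submxP[c ->]; rewrite -(mulmxA c) -(mulmxA c) EE mulmx1.
Qed.

Lemma parseval n s (G : 'M[R]_n) (E : 'M[R]_(s, n)) (u v : 'rV[R]_n) :
  E *m G *m E^T = 1%:M -> (v <= E)%MS ->
  inner G u v = \sum_i inner G u (row i E) * inner G v (row i E).
Proof.
move=> EE vE; rewrite {1}(orthonormal_expansion EE vE).
rewrite (_ : _ *m E = \sum_i inner G v (row i E) *: row i E); last first.
  by rewrite mulmx_sum_row; apply: eq_bigr => i _; rewrite inner_rowE.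
by rewrite inner_sumr; apply: eq_bigr => i _; rewrite innerZr mulrC.
Qed.

(** A unit vector w of the kernel of O^T completes O to an orthogonal matrix, and the transposed
    orthogonality relation reads w^T w + O^T O = 1. *)
Lemma orthonormal_complement s n (O : 'M[R]_(s, n)) : s.+1 = n -> O *m O^T = 1%:M ->
  exists w : 'rV[R]_n, w *m w^T = 1%:M /\ O^T *m O = hyperplane_proj w.
Proof.
move=> sn; case: n / sn O => O OO.
have spd1 : spd (1%:M : 'M[R]_s.+1).
  split; first exact: trmx1.
  move=> u u0; rewrite inner1 lt_neqAle mxtrace_sqr_ge0 andbT eq_sym.
  by apply: contra u0 => /eqP/mxtrace_sqr_eq0 ->.
have [|E [EE EO]] := @orthonormal_basis_subspace s.+1 s.+1 1 1%:M (kermx O^T) spd1.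
  rewrite mxrank_ker mxrank_tr.
  have -> : \rank O = s by apply/eqP; rewrite -/(row_free O); apply/row_freeP; exists O^T.
  by rewrite subSnn.
move: EE; rewrite mulmx1 => EE; exists E; split=> //.
have EO0 : E *m O^T = 0 by apply/sub_kermxP; rewrite EO.
have OE0 : O *m E^T = 0 by rewrite -[LHS]trmxK trmx_mul trmxK EO0 trmx0.
have XX : col_mx E O *m (col_mx E O)^T = 1%:M :> 'M[R]_(1 + s).
  by rewrite tr_col_mx mul_col_row EE OO EO0 OE0 [RHS](@scalar_mx_block _ 1 s).
have H : (col_mx E O)^T *m col_mx E O = 1%:M :> 'M[R]_s.+1 by exact: (@mulmx1C _ s.+1).
rewrite tr_col_mx mul_row_col in H.
by rewrite /hyperplane_proj -H addrAC subrr add0r.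
Qed.

(** The hypothesis makes w a multiple of w', hence equal to it up to a sign, which w^T w does not
    see. *)
Lemma hyperplane_proj_inj n (w w' : 'rV[R]_n) : w *m w^T = 1%:M -> w' *m w'^T = 1%:M ->
  hyperplane_proj w' *m w^T = 0 -> hyperplane_proj w' = hyperplane_proj w.
Proof.
move=> w1 w'1; rewrite /hyperplane_proj mulmxBl mul1mx => /eqP; rewrite subr_eq0 => /eqP E.
pose a := (w' *m w^T) 0 0.
have aE : w' *m w^T = a%:M by rewrite [LHS]mx11_scalar.
have wE : w = a *: w'.
  by rewrite -[LHS]trmxK E -mulmxA aE mul_mx_scalar linearZ /= trmxK.
clearbody a.
have a2 : a ^+ 2 = 1.
  have := w1; rewrite wE linearZ /= -scalemxAl -scalemxAr w'1 scalerA => /matrixP/(_ 0 0).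
  by rewrite !mxE /= mulr1 expr2.
have -> : w^T *m w = w'^T *m w' by rewrite wE !linearZ /= -scalemxAl scalerA -expr2 a2 scale1r.
by [].
Qed.

Lemma mxrank_hyperplane_proj n (w : 'rV[R]_n) : w *m w^T = 1%:M ->
  (\rank (hyperplane_proj w)).+1 = n.
Proof.
move=> w1; apply/eqP; rewrite eqn_leq; apply/andP; split.
  rewrite ltn_neqAle rank_leq_row andbT; apply/negP => /eqP rk.
  have uP : hyperplane_proj w \in unitmx by rewrite -row_free_unit /row_free rk.
  have := mul_normal_proj w1; move/(congr1 (fun z => z *m invmx (hyperplane_proj w))).
  rewrite mulmxK // mul0mx => w0; move: w1; rewrite w0 mul0mx => /matrixP/(_ 0 0)/eqP.
  by rewrite !mxE /= eq_sym oner_eq0.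
have E : hyperplane_proj w + w^T *m w = 1%:M by rewrite /hyperplane_proj subrK.
have := mxrank_add (hyperplane_proj w) (w^T *m w); rewrite E mxrank1 => H.
apply: leq_trans H _; rewrite -[X in (_ <= X)%N]addn1 leq_add2l.
exact: leq_trans (mxrankM_maxr _ _) (rank_leq_row _).
Qed.

Lemma inf_attained (S : set R) m : S m -> (forall x, S x -> m <= x) -> inf S = m.
Proof.
move=> Sm lb; apply/eqP; rewrite eq_le; apply/andP; split.
  by apply: ge_inf => //; exists m.
by apply: lb_le_inf => //; exists m.
Qed.

Lemma sup_attained (S : set R) m : S m -> (forall x, S x -> x <= m) -> sup S = m.
Proof.
move=> Sm ub; apply/eqP; rewrite eq_le; apply/andP; split.
  by apply: ge_sup => //; exists m.
by apply: ub_le_sup => //; exists m.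
Qed.

Definition unit_sphere n : set 'rV[R]_n := [set w | w *m w^T = 1%:M].

Lemma unit_sphere_neq0 n : (0 < n)%N -> @unit_sphere n !=set0.
Proof.
case: n => // n _; exists (delta_mx 0 0).
rewrite /unit_sphere /= trmx_delta mul_delta_mx.
by apply/matrixP => a b; rewrite !mxE !ord1.
Qed.

Lemma unit_sphere_compact n : compact (@unit_sphere n).
Proof.
apply: bounded_closed_compact.
  exists 1; split; first exact: num_real.
  move=> M M1 w w1; apply: le_trans (ltW M1).
  (* The matrix norm is the largest absolute entry, and each squared entry is at most the sum w w^T
     = 1. *)
  rewrite /Num.norm /= mx_normrE; apply: bigmax_le => // -[i j] _ /=.
  have : (w *m w^T) 0 0 = 1 by rewrite w1 mxE.
  rewrite mxE (bigD1 j) //= mxE -expr2 ord1 => E.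
  rewrite -(@ler_pXn2r _ 2) ?nnegrE // expr1n real_normK ?num_real // -E lerDl.
  by apply: sumr_ge0 => l _; rewrite mxE -expr2 sqr_ge0.
have cf : continuous (fun w : 'rV[R]_n => (w *m w^T) 0 0).
  move=> w; apply: differentiable_continuous.
  have sid := @smooth_id R 'rV[R]_n setT openT.
  have s : smooth_on setT (fun w : 'rV[R]_n => w *m w^T).
    by apply: smooth_mulmx => //; [exact: openT|apply: smooth_trmx => //; exact: openT].
  by move/(smooth_mxP openT): s => /(_ 0 0) s; exact: (smooth_differentiable s).
rewrite (_ : @unit_sphere n = (fun w : 'rV[R]_n => (w *m w^T) 0 0) @^-1` [set 1]).
  by apply: closed_comp => //; exact: closed_eq.
apply/seteqP; split=> w; rewrite /unit_sphere /= => H.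
  by rewrite H mxE.
by rewrite [LHS]mx11_scalar H.
Qed.

End OrthonormalBases.

(** * Quaternionic structures on manifolds *)

Lemma sum_ord3 (V : nmodType) (f : 'I_3 -> V) : \sum_(a < 3) f a = f 0 + f 1 + f 2.
Proof.
rewrite !big_ord_recl big_ord0 addr0 addrA.
by congr (f _ + f _ + f _); apply/val_inj.
Qed.

Section CovariantEndo.
Context (R : realType) (d : nat) (O : set 'rV[R]_d) (G : 'rV[R]_d -> 'M[R]_d).
Hypotheses (oO : open O) (sG : smooth_on O G) (spdG : forall x, O x -> spd (G x)).
Implicit Types (x u v w : 'rV[R]_d) (S : 'rV[R]_d -> 'M[R]_d).

Let sid : smooth_on O (id : 'rV[R]_d -> 'rV[R]_d).
Proof. exact: smooth_id. Qed.

Let OO y : O y -> O (id y).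
Proof. by []. Qed.

Let Jid x (a : 'rV[R]_d) : O x -> a *m 'J id x = a.
Proof. by move=> Ox; rewrite (mul_jacobian sid) // derive_id. Qed.

Let sc (w : 'rV[R]_d) : smooth_on O (fun _ : 'rV[R]_d => w).
Proof. exact: smooth_cst. Qed.

Lemma cov_id (V : 'rV[R]_d -> 'rV[R]_d) x u : O x ->
  cov G id V x u = 'D_u V x + christoffel G x u (V x).
Proof. by move=> Ox; rewrite /cov Jid. Qed.

Lemma cov_mul_endo S (a : 'rV[R]_d -> 'rV[R]_d) x u : smooth_on O S -> smooth_on O a -> O x ->
  cov G id (fun y => a y *m S y) x u = cov G id a x u *m S x + a x *m cov_endo G S x u.
Proof.
move=> sS sa Ox; have dS := smooth_differentiable sS Ox; have da := smooth_differentiable sa Ox.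
have E := mul_cov_endo S u (a x) oO sG spdG Ox.
have D := derive_mulmx u da dS.
have C1 := cov_id (fun y => a y *m S y) u Ox; have C2 := cov_id a u Ox.
have alg (p q r t z : 'rV[R]_d) : p + q + r = p + t + (q + r - t).
  by clear; apply/rowP => j; rewrite !mxE; ring.
refine (etrans C1 (etrans (congr1 (fun z => z + _) D) _)).
refine (etrans _ (congr2 (fun a b => a *m S x + b) (esym C2) (esym E))).
rewrite mulmxDl; exact: alg.
Qed.

Lemma smooth_cov_endo S u : smooth_on O S -> smooth_on O (fun y => cov_endo G S y u).
Proof.
move=> sS; have sL : smooth_on O (fun y => lin1_mx (christoffel G y u)).
  apply/smooth_mxP => // i j.
  have s : smooth_on O (fun y => christoffel G y u (delta_mx 0 i)).
    by apply: (smooth_christoffel oO sG spdG (F := id)).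
  apply: (smooth_eq oO (f := fun y => christoffel G y u (delta_mx 0 i) 0 j)).
    by move=> y _; rewrite [RHS]mxE.
  by move/(smooth_mxP oO): s => /(_ 0 j).
apply: (smooth_eq oO (f := fun y => 'D_u S y + S y *m lin1_mx (christoffel G y u)
     + (-1) *: (lin1_mx (christoffel G y u) *m S y))).
  by move=> y _; rewrite scaleN1r.
apply: smoothD => //; last first.
  by apply: smooth_scale => //; [exact: smooth_cst|exact: smooth_mulmx].
by apply: smoothD => //; [exact: smooth_derive|exact: smooth_mulmx].
Qed.

(** The Ricci identity for endomorphism fields. When w (nabla_b S) = nabla_b (w S) - (nabla_b w) S
    is differentiated along a, the cross terms are symmetric in a and b; what remains is the
    curvature acting on w S and on w. *)
Lemma cov_endo_commutator S x u v w : smooth_on O S -> O x ->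
  w *m (cov_endo G (fun y => cov_endo G S y v) x u
        - cov_endo G (fun y => cov_endo G S y u) x v) =
  curvature G x u v (w *m S x) - curvature G x u v w *m S x.
Proof.
move=> sS Ox.
have sWS : smooth_on O (fun y => w *m S y) by apply: smooth_mulmx.
have K (V : 'rV[R]_d -> 'rV[R]_d) : smooth_on O V ->
    cov G id (fun y => cov G id V y v) x u - cov G id (fun y => cov G id V y u) x v =
    curvature G x u v (V x).
  by move=> sV; rewrite (cov_curvature oO sG spdG oO sid OO u v sV Ox) !Jid.
have E a b : w *m cov_endo G (fun y => cov_endo G S y b) x a =
    cov G id (fun y => cov G id (fun y => w *m S y) y b) x a
    - cov G id (fun y => cov G id (fun=> w) y b) x a *m S x
    - christoffel G x b w *m cov_endo G S x a - christoffel G x a w *m cov_endo G S x b.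
  pose Z y := cov_endo G S y b.
  have sZ : smooth_on O Z by exact: smooth_cov_endo.
  have sCw : smooth_on O (fun y => cov G id (fun=> w) y b).
    exact: (smooth_cov oO sG spdG oO sid OO b (sc w)).
  have Cw y c : O y -> cov G id (fun=> w) y c = christoffel G y c w.
    by move=> Oy; rewrite cov_id // (derive_cst w) add0r.
  have H1 := cov_mul_endo a sZ (sc w) Ox.
  have WZ y : O y -> w *m Z y = cov G id (fun y => w *m S y) y b
      - cov G id (fun=> w) y b *m S y.
    move=> Oy; have H2 := cov_mul_endo b sS (sc w) Oy.
    by rewrite H2 addrAC subrr add0r.
  have H3 : cov G id (fun y => w *m Z y) x a =
      cov G id (fun y => cov G id (fun y => w *m S y) y b) x a
      - cov G id (fun y => cov G id (fun=> w) y b *m S y) x a.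
    refine (etrans (@cov_near_eq _ _ _ G id _ _ x a (near_eq_open oO WZ Ox)) _).
    have s1 : smooth_on O (fun y => cov G id (fun y => w *m S y) y b).
      exact: (smooth_cov oO sG spdG oO sid OO b sWS).
    have s2 : smooth_on O (fun y => cov G id (fun=> w) y b *m S y) by apply: smooth_mulmx.
    apply/eqP; rewrite eq_sym subr_eq -(covD sG spdG OO a (smoothB oO s1 s2) s2 Ox).
    by apply/eqP; congr (cov G id _ x a); apply/funext => y; rewrite subrK.
  have H4 := cov_mul_endo a sS sCw Ox.
  rewrite (Cw _ a Ox) in H1; rewrite (Cw _ b Ox) in H4.
  have alg (p q r t z : 'rV[R]_d) : z = t + q -> z = p - r -> q = p - r - t.
    by move=> -> /(congr1 (fun z => z - t)); rewrite addrAC subrr add0r.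
  have := alg _ _ _ _ _ H1 H3; rewrite -/(Z x) H4 opprD addrA => ->.
  by [].
have alg (p q r t p' q' : 'rV[R]_d) : p - q - r - t - (p' - q' - t - r) = p - p' - (q - q').
  by clear; apply/rowP => j; rewrite !mxE; ring.
refine (etrans (mulmxBr _ _ _) (etrans (congr2 (fun a b => a - b) (E u v) (E v u)) _)).
refine (etrans (alg _ _ _ _ _ _) (congr2 (fun a b => a - b) (K _ sWS) _)).
exact: (etrans (esym (mulmxBl _ _ _)) (congr1 (fun z => z *m S x) (K _ (sc w)))).
Qed.

Lemma cov_endo_sum (I : finType) (t : I -> 'rV[R]_d -> R) (S : I -> 'rV[R]_d -> 'M[R]_d) x u :
  (forall i, smooth_on O (t i)) -> (forall i, smooth_on O (S i)) -> O x ->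
  cov_endo G (fun y => \sum_i t i y *: S i y) x u =
  \sum_i ('D_u (t i) x *: S i x + t i x *: cov_endo G (S i) x u).
Proof.
move=> st sS Ox.
have dt i := smooth_differentiable (st i) Ox; have dS i := smooth_differentiable (sS i) Ox.
have dtS i : differentiable (fun y => t i y *: S i y) x.
  exact: smooth_differentiable (smooth_scale oO (st i) (sS i)) Ox.
rewrite /cov_endo derive_sum_fun //.
rewrite mulmx_suml mulmx_sumr -sumrN -!big_split; apply: eq_bigr => i _ /=.
rewrite (derive_scale u (dt i) (dS i)) -scalemxAl -scalemxAr !scalerDr scalerN.
by rewrite !addrA.
Qed.

Lemma eq_cov_endo S S' x u : (\near x, S x = S' x) -> cov_endo G S x u = cov_endo G S' x u.
Proof. by move=> E; rewrite /cov_endo (near_eq_derive u E) (nbhs_singleton E). Qed.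

(* The trace form expresses the connection coefficients of the frame J by traces,
   so that they are smooth and the frame can be differentiated twice. *)
Lemma parallel_span_curvature (J : 'I_3 -> 'rV[R]_d -> 'M[R]_d) (x : 'rV[R]_d) (N : R) :
  N != 0 -> (forall a, smooth_on O (J a)) ->
  (forall y a b, O y -> \tr (J a y *m J b y) = if a == b then N else 0) ->
  (forall y a u, O y -> exists t : 'I_3 -> R, cov_endo G (J a) y u = \sum_b t b *: J b y) ->
  O x -> forall a u v, exists t : 'I_3 -> R, forall w,
    curvature G x u v (w *m J a x) - curvature G x u v w *m J a x =
    \sum_b t b *: (w *m J b x).
Proof.
move=> N0 sJ trJ parJ Ox a u v.
pose T c e b y := N^-1 * \tr (cov_endo G (J c) y e *m J b y).
have TE c e y : O y -> cov_endo G (J c) y e = \sum_b T c e b y *: J b y.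
  move=> Oy; have [t tE] := parJ y c e Oy; rewrite [LHS]tE; apply: eq_bigr => b _.
  congr (_ *: _); rewrite /T tE mulmx_suml raddf_sum /= (bigD1 b) //= big1 ?addr0.
    by rewrite -scalemxAl mxtraceZ trJ // eqxx mulrCA mulVf // mulr1.
  by move=> b' nb; rewrite -scalemxAl mxtraceZ trJ // (negPf nb) mulr0.
have sT c e b : smooth_on O (T c e b).
  apply: smoothM => //; first exact: smooth_cst.
  have sM : smooth_on O (fun y => cov_endo G (J c) y e *m J b y).
    by apply: smooth_mulmx => //; exact: smooth_cov_endo.
  by rewrite /mxtrace; apply: smooth_sum => // i; by move/(smooth_mxP oO): sM => /(_ i i).
have in_span e e' : exists t : 'I_3 -> R,
    cov_endo G (fun y => cov_endo G (J a) y e') x e = \sum_b t b *: J b x.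
  rewrite (eq_cov_endo e (near_eq_open oO (TE a e') Ox)) cov_endo_sum //.
  exists (fun b => 'D_e (T a e' b) x + \sum_c T a e' c x * T c e b x).
  under [RHS]eq_bigr do rewrite scalerDl.
  rewrite !big_split /=; congr (_ + _).
  under eq_bigr do rewrite (TE _ _ _ Ox) scaler_sumr.
  rewrite exchange_big; apply: eq_bigr => b _ /=; rewrite scaler_suml.
  by apply: eq_bigr => c _; rewrite scalerA.
have [t1 E1] := in_span u v; have [t2 E2] := in_span v u.
exists (fun b => t1 b - t2 b) => w.
rewrite -(cov_endo_commutator u v w (sJ a) Ox) E1 E2 -sumrB mulmx_sumr.
by apply: eq_bigr => b _; rewrite -scalerBl -scalemxAr.
Qed.

End CovariantEndo.

Section SpaceForm.
Context (R : realType) (d : nat) (M : riemannian R d) (sigma : M -> set 'M[R]_d).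
Hypothesis d0 : (0 < d)%N.

Local Notation Gp p := (form_in (@Defs.metric R d M) p).
Local Notation qmul J a := (fun u : 'rV[R]_d => u *m J a).

Lemma canonical_basis_triple p J : canonical_basis sigma p J ->
  quaternionic_triple (Defs.metric p) (qmul J 0) (qmul J 1) (qmul J 2).
Proof.
case=> [iso sq pos neg _].
have e1 : 1 + 1 = 2 :> 'I_3 by exact/val_inj.
have e2 : 2 + 1 = 0 :> 'I_3 by exact/val_inj.
have e3 : 1 + 2 = 0 :> 'I_3 by exact/val_inj.
have e4 : 2 + 2 = 1 :> 'I_3 by exact/val_inj.
have e5 : 0 + 1 = 1 :> 'I_3 by exact/val_inj.
have e6 : 0 + 2 = 2 :> 'I_3 by exact/val_inj.
have sk a x y : inner (Defs.metric p) (x *m J a) y = - inner (Defs.metric p) x (y *m J a).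
  rewrite -[in RHS](iso a) -[y *m J a *m J a]mulmxA sq.
  by rewrite mulmxN mulmx1 innerNr opprK.
have S a x : x *m J a *m J a = - x by rewrite -mulmxA sq mulmxN mulmx1.
have P0 := pos 0; have P1 := pos 1; have P2 := pos 2.
have N0 := neg 0; have N1 := neg 1; have N2 := neg 2.
rewrite e1 e2 e3 e4 e5 e6 in P0 P1 P2 N0 N1 N2.
split; first by split=> a x y; rewrite mulmxDl -scalemxAl.
- by split=> x y; exact: sk.
- by split=> x; exact: S.
- by split=> x; rewrite -mulmxA ?P0 ?P1 ?P2.
- by split=> x; rewrite -mulmxA ?N0 ?N1 ?N2 mulmxN.
Qed.

(** J_c is J_(c+1) J_(c+2) and also minus the product in the other order, so its trace vanishes.
    Orthogonality for the trace form is what [parallel_span_curvature] requires of a frame. *)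
Lemma mxtrace_canonical p J a b : canonical_basis sigma p J ->
  \tr (J a *m J b) = if a == b then - d%:R else 0.
Proof.
case=> [_ sq pos neg _].
have tJ c : \tr (J c) = 0.
  have e : c + 1 + 2 = c :> 'I_3 by case: c => -[|[|[|]]] //= H; exact/val_inj.
  have h1 := pos (c + 1); have h2 := neg (c + 1); rewrite e in h1 h2.
  have := mxtrace_mulC (J (c + 1 + 1)) (J (c + 1)); rewrite h1 h2 raddfN /=.
  lra.
have [<-|ab] := eqVneq a b.
  by rewrite sq raddfN /= mxtrace1.
have [e|e] : b = a + 1 \/ a = b + 1.
  by move: a b ab => [[|[|[|a]]] ha] [[|[|[|b]]] hb] //= _;
    (try by left; exact/val_inj); right; exact/val_inj.
  by rewrite e neg raddfN /= tJ oppr0.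
by rewrite e pos tJ.
Qed.

(** [sigma_parallel] speaks of chart centers. At another point y of the chart of [p], the derivative
    is moved to the chart indexed by [chart_inv p y], whose center that point is, and the conclusion
    is brought back through the transition map. *)
Lemma cov_endo_parallel (p : M) (U : set M) (J : 'I_3 -> M -> 'M[R]_d) (y : 'rV[R]_d) a u :
  sigma_parallel sigma -> open U -> (forall a, smooth_endo U (J a)) ->
  (forall q, U q -> canonical_basis sigma q (fun a => J a q)) ->
  coord_set p U y ->
  exists t : 'I_3 -> R, cov_endo (Gp p) (endo_in (J a) p) y u = \sum_b t b *: endo_in (J b) p y.
Proof.
move=> par oU sJ cJ pUy; have /coord_setE[py Uy] := pUy.
pose r := chart_inv p y.
have cb : canonical_basis sigma r (fun a => J a r) by exact: cJ.
have Sr q : U q -> sigma q (J a q).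
  move=> /cJ [_ _ _ _ H]; apply/H; exists (fun b => (b == a)%:R).
  by rewrite (bigD1 a) //= eqxx scale1r big1 ?addr0 // => b /negPf ->; rewrite scale0r.
pose phi := transition p r.
pose O := coord_set p (chart_dom r) `&` coord_set p U.
have oO : open O by apply: openI; [exact: overlap_open|exact: coord_set_open].
have pr : coord_set p (chart_dom r) y.
  by apply/coord_setE; split=> //; exact: chart_dom_mem.
have Oy : O y by split.
have sphi : smooth_on O phi.
  by apply: (smooth_subset (U := coord_set p (chart_dom r))) => [z []//|]; exact: smooth_transition.
have phiO z : O z -> chart_img r (phi z).
  by move=> [/transition_mem/coord_setE[]].
have ophi : open (chart_img r) by exact: (@chart_img_open _ _ _ r).
have fphi z : O z -> row_free ('J phi z) by move=> [/row_free_transition].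
have GE z : O z -> Gp p z = Defs.induced (Gp r) phi z.
  by move=> [zr _]; exact: form_in_change.
have SE b z : O z -> endo_in (J b) p z *m 'J phi z = 'J phi z *m endo_in (J b) r (phi z).
  by move=> [zr _]; exact: endo_in_change.
have sS : smooth_on O (endo_in (J a) p).
  by apply: (smooth_subset (U := coord_set p U)) => [z []//|]; exact: sJ.
have phiy : phi y = chart r r by rewrite /phi /transition /=.
have dS' : differentiable (endo_in (J a) r) (phi y).
  apply: (smooth_differentiable (U := coord_set r U)); first exact: sJ.
  by rewrite phiy; exact: coord_set_center.
have H := cov_endo_change ophi (Defs.metric_smooth r) (@form_in_spd _ _ _ r) oO sphi phiO fphi GE sS
  (SE a) u Oy dS'.
have := par r U (J a) oU Uy (sJ a) Sr (u *m 'J phi y).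
have [_ _ _ _ H0] := cb.
move=> /H0[t tE]; exists t.
have uJ : 'J phi y \in unitmx by rewrite -row_free_unit; exact: fphi.
apply: (can_inj (mulmxK uJ)).
refine (etrans H _); rewrite phiy tE mulmx_sumr mulmx_suml; apply: eq_bigr => b _.
rewrite -scalemxAr -scalemxAl; congr (_ *: _).
by rewrite SE // phiy endo_in_center.
Qed.

End SpaceForm.

Section SpaceFormCurvature.
Context (R : realType) (d : nat) (M : riemannian R d) (sigma : M -> set 'M[R]_d).
Hypothesis d0 : (0 < d)%N.

Local Notation Gp p := (form_in (@Defs.metric R d M) p).
Local Notation qmul J a := (fun u : 'rV[R]_d => u *m J a).

Lemma row_free_eq0 k l m (A : 'M[R]_(l, m)) (u : 'M[R]_(k, l)) :
  row_free A -> u *m A = 0 -> u = 0.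
Proof. by move=> fA uA; apply: (row_free_inj fA); rewrite uA mul0mx. Qed.

Lemma gram_gt0 (g : 'M[R]_d) (x y : 'rV[R]_d) : spd g -> row_free (col_mx x y) ->
  0 < inner g x x * inner g y y - inner g x y ^+ 2.
Proof.
move=> spdg fxy.
have y0 : y != 0.
  apply: contraTneq fxy => ->; apply/negP => /(@row_free_eq0 1 _ _ _ (row_mx 0 1%:M)).
  rewrite mul_row_col mul0mx mulmx0 addr0 => /(_ erefl)/(congr1 (fun u => rsubmx u 0 0)).
  by rewrite row_mxKr !mxE /= => /eqP; rewrite oner_eq0.
have yy : 0 < inner g y y by exact: spdg.2.
pose z := x - (inner g x y / inner g y y) *: y.
have z0 : z != 0.
  apply: contraTneq fxy => z0; apply/negP.
  move=> /(@row_free_eq0 1 _ _ _ (row_mx 1%:M (- (inner g x y / inner g y y))%:M)).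
  rewrite mul_row_col mul1mx mul_scalar_mx scaleNr -/z z0 => /(_ erefl)/(congr1 (fun u => lsubmx u 0 0)).
  by rewrite row_mxKl !mxE /= => /eqP; rewrite oner_eq0.
have zz : 0 < inner g z z by exact: spdg.2.
have yy0 : inner g y y != 0 by rewrite gt_eqF.
suff <- : inner g y y * inner g z z = inner g x x * inner g y y - inner g x y ^+ 2.
  exact: mulr_gt0.
rewrite /z !innerBl !innerBr !innerZl !innerZr (innerC spdg y x).
by field.
Qed.

Lemma linear_dependence (x y : 'rV[R]_d) : ~~ row_free (col_mx x y) ->
  y = 0 \/ exists a, x = a *: y.
Proof.
rewrite -kermx_eq0 => /matrix0Pn[i [j kij]].
pose K := kermx (col_mx x y).
have Ki : row i K != 0.
  by apply/rV0Pn; exists j; rewrite mxE.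
have KE : row i K *m col_mx x y = 0 by rewrite -row_mul mulmx_ker row0.
pose a := lsubmx (row i K) 0 0; pose b := rsubmx (row i K) 0 0.
have E : a *: x + b *: y = 0.
  rewrite -KE -[row i K]hsubmxK mul_row_col [lsubmx _]mx11_scalar [rsubmx _]mx11_scalar.
  by rewrite !mul_scalar_mx.
have [a0|a0] := eqVneq a 0; last first.
  right; exists (- (a^-1 * b)); apply: (scalerI a0).
  rewrite scalerA mulrN mulrA mulfV // mul1r scaleNr.
  by apply/eqP; rewrite -addr_eq0 E.
left; have b0 : b != 0.
  apply: contra_neq Ki => b0; rewrite -[row i K]hsubmxK.
  by rewrite [lsubmx _]mx11_scalar [rsubmx _]mx11_scalar -/a -/b a0 b0 !raddf0 row_mx0.
by move: E; rewrite a0 scale0r add0r => /eqP; rewrite scaler_eq0 (negPf b0) => /eqP.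
Qed.

Lemma quaternionic_span_sub (J : 'I_3 -> 'M[R]_d) X x :
  quaternionic_span (qmul J 0) (qmul J 1) (qmul J 2) X x ->
  (x <= X + \sum_(a < 3) <<X *m J a>>)%MS.
Proof.
move=> [a [b [e [f ->]]]].
have S c : (X *m J c <= X + \sum_(a < 3) <<X *m J a>>)%MS.
  apply: submx_trans (addsmxSr _ _); apply: (sumsmx_sup c) => //.
  by rewrite genmxE.
rewrite !addmx_sub // scalemx_sub //; exact: addsmxSl.
Qed.

Lemma space_form_curvatureE c (p : M) J : quaternionic_space_form sigma c ->
  canonical_basis sigma p J -> forall x y z w,
  inner (Defs.metric p) (curvature (Gp p) (chart p p) x y z) w =
  c / 4 * model_curvature (Defs.metric p) (qmul J 0) (qmul J 1) (qmul J 2) x y z w.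
Proof.
move=> [[aqh par] sec] cJ.
have qt := canonical_basis_triple cJ.
have pp := chart_center p.
have oO : open (chart_img p) by exact: (@chart_img_open _ _ _ p).
have sG := Defs.metric_smooth p.
have spG := @form_in_spd _ _ _ p.
have gp : Gp p (chart p p) = Defs.metric p by exact: form_in_center.
pose Rm x y z w := inner (Defs.metric p) (curvature (Gp p) (chart p p) x y z) w.
have skew x y z w : Rm x y z w = - Rm x y w z.
  by rewrite /Rm -gp; exact: (curvature_skew oO sG spG).
have cRm : curvature_like Rm.
  split=> [a x x' y z w|x y z w|x y z w|x y z w].
  - by rewrite /Rm (curvature_linear oO sG spG y z pp) innerDl innerZl.
  - by rewrite /Rm curvature_antisym innerNl.
  - exact: skew.
  - by rewrite /Rm -!innerDl (curvature_bianchi oO sG spG) // inner0l.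
apply: (space_form_curvature (metric_spd p) qt cRm) => [q Hq x y|X x y sx sy].
(* [J] is given at [p] alone, while the commutator is computed with the smooth local frame [J'].
   Both span the fibre of [sigma] at [p], so the coefficients can be converted. *)
- have [U [J' [oU Up sJ' cJ']]] := aqh p.
  have [_ _ _ _ spJ] := cJ; have [_ _ _ _ spJ'] := cJ' _ Up.
  pose O := coord_set p U.
  have oO' : open O by exact: coord_set_open.
  have OI z : O z -> chart_img p z by move=> /coord_setE[].
  have sGO : smooth_on O (Gp p) by exact: smooth_subset OI sG.
  have spGO z : O z -> spd (Gp p z) by move=> /OI; exact: spG.
  have Op : O (chart p p) by exact: coord_set_center.
  have nd : - d%:R != 0 :> R by rewrite oppr_eq0 pnatr_eq0 -lt0n.
  have sJO a : smooth_on O (endo_in (J' a) p) by exact: sJ'.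
  have trJ z a b : O z -> \tr (endo_in (J' a) p z *m endo_in (J' b) p z) =
      if a == b then - d%:R else 0.
    move=> /coord_setE[pz Uz]; rewrite -(mxtrace_canonical a b (cJ' _ Uz)).
    have uF := frame_in_unit pz; rewrite /endo_in; move: (frame_in p z) uF => F uF.
    by rewrite -!mulmxA [invmx F *m (F *m _)]mulKmx // mxtrace_mulC -!mulmxA mulVmx // mulmx1.
  have parJ z a u : O z -> exists t : 'I_3 -> R,
      cov_endo (Gp p) (endo_in (J' a) p) z u = \sum_b t b *: endo_in (J' b) p z.
    by move=> Oz; exact: (cov_endo_parallel a u par oU sJ' cJ' Oz).
  have C a := parallel_span_curvature oO' sGO spGO nd sJO trJ parJ Op a x y.
  have [e ->] : exists e, q = qmul J e.
    by case: Hq => [->|[->|->]]; eexists; reflexivity.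
  have Je : sigma p (J e).
    apply/spJ; exists (fun b => (b == e)%:R).
    by rewrite (bigD1 e) //= eqxx scale1r big1 ?addr0 // => b /negPf ->; rewrite scale0r.
  have [s sE] := (spJ' _).1 Je.
  have [t tE] : exists t : 'I_3 -> 'I_3 -> R, forall a w,
      curvature (Gp p) (chart p p) x y (w *m J' a p) - curvature (Gp p) (chart p p) x y w *m J' a p =
      \sum_b t a b *: (w *m J' b p).
    have [f Hf] := choice C; exists f => a w.
    have := Hf a w; rewrite endo_in_center => ->.
    by apply: eq_bigr => b _; rewrite endo_in_center.
  have inJ b : exists r : 'I_3 -> R, J' b p = \sum_a r a *: J a.
    apply/spJ/spJ'; exists (fun a => (a == b)%:R).
    by rewrite (bigD1 b) //= eqxx scale1r big1 ?addr0 // => a /negPf ->; rewrite scale0r.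
  have [r rE] := choice inJ.
  (* coefficients of the commutator in the basis J *)
  pose k a := \sum_b \sum_b' s b * t b b' * r b' a.
  have sumC (I : finType) (f : I -> 'rV[R]_d) :
      curvature (Gp p) (chart p p) x y (\sum_i f i) = \sum_i curvature (Gp p) (chart p p) x y (f i).
    have add u v : curvature (Gp p) (chart p p) x y (u + v) =
        curvature (Gp p) (chart p p) x y u + curvature (Gp p) (chart p p) x y v.
      apply: (inner_inj (metric_spd p)) => z'.
      exact: etrans (cl_add3 cRm x y u v z') (esym (innerDl _ _ _ _)).
    have zero : curvature (Gp p) (chart p p) x y 0 = 0.
      by have := add 0 0; rewrite addr0 => /eqP; rewrite -subr_eq0 opprD addrA subrr sub0r oppr_eq0 => /eqP.
    by elim/big_rec2: _ => [//|i a b _ <-]; rewrite add.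
  have scalC a u : curvature (Gp p) (chart p p) x y (a *: u) = a *: curvature (Gp p) (chart p p) x y u.
    apply: (inner_inj (metric_spd p)) => z'.
    exact: etrans (cl_scale3 cRm a x y u z') (esym (innerZl _ _ _ _)).
  have comm w : curvature (Gp p) (chart p p) x y (w *m J e) - curvature (Gp p) (chart p p) x y w *m J e
      = \sum_a k a *: (w *m J a).
    rewrite sE !mulmx_sumr sumC -sumrB.
    under eq_bigr => b _ do rewrite -!scalemxAr scalC -scalerBr tE.
    rewrite /k; under [RHS]eq_bigr => a _ do rewrite scaler_suml.
    rewrite [RHS]exchange_big; apply: eq_bigr => b _ /=.
    under [RHS]eq_bigr => a _ do rewrite scaler_suml.
    rewrite [RHS]exchange_big scaler_sumr; apply: eq_bigr => b' _ /=.
    rewrite rE mulmx_sumr !scaler_sumr; apply: eq_bigr => a _.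
    by rewrite -scalemxAr !scalerA.
  exists (k 0), (k 1), (k 2) => z w.
  have sk : inner (Defs.metric p) (curvature (Gp p) (chart p p) x y z) (w *m J e) =
      - inner (Defs.metric p) (curvature (Gp p) (chart p p) x y z *m J e) w.
    have [iso sq _ _ _] := cJ.
    rewrite -[in LHS](iso e) -[w *m J e *m J e]mulmxA sq.
    by rewrite mulmxN mulmx1 innerNr.
  refine (etrans (congr1 (fun t => _ + t) sk) (etrans (esym (innerBl _ _ _ _)) _)).
  refine (etrans (congr1 (fun t => inner _ t w) (comm z)) _).
  by rewrite sum_ord3 !innerDl !innerZl.
have R0 u v w : Rm 0 u v w = 0.
  by rewrite -[X in Rm X](subrr u) (cl_add1 cRm) (cl_opp1 cRm) subrr.
(* The definition prescribes the sectional curvature of independent pairs, in the line of a nonzero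
   X; for X = 0 and for dependent pairs both sides vanish. *)
have [X0|X0] := eqVneq X 0.
  move: sx => [a [b [f [h ->]]]]; rewrite X0 /= !mul0mx !scaler0 !addr0.
  by rewrite R0 !inner0l mul0r expr0n /= subr0 mulr0.
have [fxy|nfxy] := boolP (row_free (col_mx x y)).
  have := sec p J X x y cJ X0 (quaternionic_span_sub sx) (quaternionic_span_sub sy) fxy.
  have := gram_gt0 (metric_spd p) fxy.
  rewrite /sectional gp -/(Rm x y y x) => D0 <-.
  by rewrite divfK // gt_eqF.
have [->|[a ->]] := linear_dependence nfxy.
  rewrite inner0l inner0r mulr0 expr0n /= subr0 mulr0.
  by rewrite -[X in Rm x X](subrr x) (cl_add2 cRm) (cl_opp2 cRm) subrr.
have Z : Rm y y y (a *: y) = 0 by have := cl_antisym cRm y y y (a *: y); lra.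
rewrite innerZl innerZr !innerZl.
have := cl_linear cRm a y 0 y y (a *: y); rewrite addr0 Z mulr0 add0r => ->.
rewrite R0; ring.
Qed.

End SpaceFormCurvature.

(** * Submanifolds *)

Lemma open_setI_preimage (T S : topologicalType) (f : T -> S) (U : set T) (W : set S) :
  open U -> open W -> (forall x, U x -> {for x, continuous f}) -> open (U `&` f @^-1` W).
Proof.
move=> oU oW cf; rewrite openE => x [Ux Wx]; rewrite /interior.
have H1 : nbhs x U by exact: open_nbhs_nbhs.
have H2 : nbhs x (f @^-1` W) by apply: (cf x Ux); exact: open_nbhs_nbhs.
by apply: filterI H1 H2.
Qed.

Lemma open_smooth_preimage (R : realType) (V W : normedModType R) (f : V -> W) (U : set V)
    (A : set W) : open U -> smooth_on U f -> open A -> open (U `&` f @^-1` A).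
Proof.
move=> oU sf oA; apply: open_setI_preimage => // x Ux.
exact: differentiable_continuous (smooth_differentiable sf Ux).
Qed.

(** An ambient change of chart and a reparametrization are combined. The maps live on overlaps, so
    the domains are shrunk to preimages on which all compositions make sense. *)
Lemma second_form_change (R : realType) n d (O O' : set 'rV[R]_d) (G G' : 'rV[R]_d -> 'M[R]_d)
    (phi : 'rV[R]_d -> 'rV[R]_d) (U U' : set 'rV[R]_n) (F F' : 'rV[R]_n -> 'rV[R]_d)
    (psi : 'rV[R]_n -> 'rV[R]_n) x u v :
  open O' -> smooth_on O' G' -> (forall z, O' z -> spd (G' z)) ->
  open O -> smooth_on O phi -> (forall z, O z -> O' (phi z)) ->
  (forall z, O z -> row_free ('J phi z)) -> (forall z, O z -> G z = Defs.induced G' phi z) ->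
  open U -> smooth_on U F -> (forall z, U z -> row_free ('J F z)) ->
  open U' -> smooth_on U' psi -> (forall z, U' z -> row_free ('J psi z)) ->
  (forall z, U' z -> U (psi z) -> O (F (psi z)) -> phi (F (psi z)) = F' z) ->
  U' x -> U (psi x) -> O (F (psi x)) ->
  second_form G' F' x u v =
  second_form G F (psi x) (u *m 'J psi x) (v *m 'J psi x) *m 'J phi (F (psi x)).
Proof.
move=> oO' sG' spdG' oO sphi OO fphi GE oU sF fF oU' spsi fpsi FE U'x Ux Ox.
have oU2 := open_smooth_preimage oU sF oO.
set U2 := U `&` _ in oU2.
have sF2 : smooth_on U2 F by apply: (smooth_subset (U := U)) => // z [].
have UF2 z : U2 z -> O (F z) by case.
have fF2 z : U2 z -> row_free ('J F z) by move=> [/fF].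
have U2x : U2 (psi x) by [].
have FE2 z : U' z -> U2 (psi z) -> phi (F (psi z)) = F' z.
  by move=> z' [Uz Oz]; exact: FE.
clearbody U2.
have oU3 := open_smooth_preimage oU' spsi oU2.
have spsi3 : smooth_on (U' `&` psi @^-1` U2) psi.
  by apply: (smooth_subset (U := U')) => // z [].
set U3 := U' `&` _ in oU3 spsi3.
have UU z : U3 z -> U2 (psi z) by case.
have FE3 z : U3 z -> ((phi \o F) \o psi) z = F' z by move=> [z1 z2]; exact: FE2.
have fpsi3 z : U3 z -> row_free ('J psi z) by move=> [/fpsi].
have U3x : U3 x by [].
clearbody U3; clear FE2 FE U'x Ux fpsi spsi oU' sF fF oU.
have sPF : smooth_on U2 (phi \o F) by exact: (smooth_comp oU2 oO UF2 sF2 sphi).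
have fPF z : U2 z -> row_free ('J (phi \o F) z).
  move=> Uz; rewrite -> (jacobian_comp (smooth_differentiable sF2 Uz) (smooth_differentiable sphi (UF2 _ Uz))).
  by rewrite /row_free mxrankMfree; [exact: fF2|exact: fphi (UF2 _ Uz)].
have UPF z : U2 z -> O' ((phi \o F) z) by move=> /UF2/OO.
have sPFP : smooth_on U3 ((phi \o F) \o psi) by exact: (smooth_comp oU3 oU2 UU spsi3 sPF).
refine (etrans (esym (eq_second_form u v oU3 oO' (fun z Uz => UPF _ (UU _ Uz)) sPFP FE3
  (fun z _ => erefl (G' z)) U3x)) _).
refine (etrans (second_form_reparam spdG' oU2 sPF UPF fPF oU3 spsi3 UU fpsi3 u v U3x) _).
exact: (second_form_ambient oO' sG' spdG' oO sphi OO fphi GE oU2 sF2 UF2 _ _ U2x).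
Qed.

(** Independent rows have a positive definite Gram matrix. The determinant turns full rank into an
    open condition. *)
Lemma row_free_gram (R : realType) n d (A : 'M[R]_(n, d)) :
  row_free A <-> \det (A *m A^T) != 0.
Proof.
rewrite -unitfE -unitmxE; split=> [fA|uA].
  have s1 : spd (1%:M : 'M[R]_d).
    split; first exact: trmx1.
    move=> u u0; rewrite inner1 lt_neqAle mxtrace_sqr_ge0 andbT eq_sym.
    by apply: contra u0 => /eqP/mxtrace_sqr_eq0 ->.
  by have /spd_unit := spd_mulmx fA s1; rewrite mulmx1.
apply/row_freeP; exists (A^T *m invmx (A *m A^T)).
by rewrite mulmxA mulmxV.
Qed.

Lemma open_row_free (R : realType) k n d (U : set 'rV[R]_k) (A : 'rV[R]_k -> 'M[R]_(n, d)) :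
  open U -> smooth_on U A -> open [set x | U x /\ row_free (A x)].
Proof.
move=> oU sA.
have sD : smooth_on U (fun x => \det (A x *m (A x)^T)).
  by apply: smooth_det => //; apply: smooth_mulmx => //; exact: smooth_trmx.
have -> : [set x | U x /\ row_free (A x)] = U `&` (fun x => \det (A x *m (A x)^T)) @^-1` [set~ 0].
  apply/seteqP; split=> x [Ux fx]; split=> //; first exact/eqP/row_free_gram.
  by apply/row_free_gram/eqP.
apply: open_setI_preimage => //; first (apply: closed_openC; apply: accessible_closed_set1).
  exact: hausdorff_accessible (@norm_hausdorff _ _).
by move=> x Ux; exact: differentiable_continuous (smooth_differentiable sD Ux).
Qed.

(** * The fundamental equations at a point of the submanifold *)

Section SubmanifoldAt.
Context (R : realType) (n d : nat) (M : manifold R n) (Mbar : riemannian R d).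
Context (f : immersion M Mbar).
Implicit Types (p r : M) (u v w z : 'rV[R]_n) (xi : 'rV[R]_d).

Local Notation Gp p := (form_in (@Defs.metric R d Mbar) (f p)).
Local Notation Fp p := (local_rep f p).
Local Notation x0 p := (chart p p).
Local Notation Jp p := ('J (local_rep f p) (chart p p)).

Definition imm_dom0 p := coord_set p (f @^-1` chart_dom (f p)).
(** [imm_free] gives injectivity of the differential at the center of the chart. Full rank on a
    neighbourhood is therefore built into the domain, which [open_row_free] shows to be open. *)
Definition imm_dom p := [set y | imm_dom0 p y /\ row_free ('J (Fp p) y)].

Lemma imm_preimage_open (A : set Mbar) : open A -> open (f @^-1` A).
Proof. by move=> oA; apply: open_comp => // x _; exact: imm_continuous. Qed.

Lemma imm_dom0_open p : open (imm_dom0 p).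
Proof. by apply: coord_set_open; apply: imm_preimage_open; exact: chart_dom_open. Qed.

Lemma imm_dom_open p : open (imm_dom p).
Proof.
apply: open_row_free; first exact: imm_dom0_open.
apply: smooth_jacobian; first exact: imm_dom0_open.
exact: imm_smooth.
Qed.

Lemma imm_dom_smooth p : smooth_on (imm_dom p) (Fp p).
Proof. by apply: (smooth_subset (U := imm_dom0 p)) => [y []//|]; exact: imm_smooth. Qed.

Lemma imm_dom_sub p y : imm_dom p y -> chart_img (f p) (Fp p y).
Proof. by move=> [/coord_setE[_ fy] _]; exact: chart_mem. Qed.

Lemma imm_dom_free p y : imm_dom p y -> row_free ('J (Fp p) y).
Proof. by case. Qed.

Lemma imm_dom_center p : imm_dom p (x0 p).
Proof.
split; last exact: imm_free.
by apply: coord_set_center; exact: chart_dom_mem.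
Qed.

Lemma imm_img_open p : open (chart_img (f p)).
Proof. exact: (@chart_img_open _ _ _ (f p)). Qed.

Lemma imm_metric_smooth p : smooth_on (chart_img (f p)) (Gp p).
Proof. exact: Defs.metric_smooth. Qed.

Lemma imm_metric_spd p y : chart_img (f p) y -> spd (Gp p y).
Proof. exact: form_in_spd. Qed.

Lemma local_rep_center p : Fp p (x0 p) = chart (f p) (f p).
Proof. by rewrite /local_rep /= chartK //; exact: chart_dom_mem. Qed.

Lemma metric_center p : Gp p (Fp p (x0 p)) = Defs.metric (f p).
Proof. by rewrite local_rep_center form_in_center. Qed.

Local Notation g p := (Defs.metric (f p)).

Lemma gM_spd p : spd (gM f p).
Proof. exact: (induced_spd (@imm_metric_spd p) (@imm_dom_sub p) (@imm_dom_free p) (imm_dom_center p)). Qed.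

Lemma inner_gM p u v : inner (gM f p) u v = inner (g p) (df f p u) (df f p v).
Proof. by rewrite /gM induced_inner metric_center. Qed.

Lemma inner_tan_comp p xi w : inner (gM f p) (tan_comp f p xi) w = inner (g p) xi (df f p w).
Proof.
by rewrite -metric_center; exact: (inner_tan (@imm_metric_spd p) (@imm_dom_sub p) (@imm_dom_free p) _ _ (imm_dom_center p)).
Qed.

Lemma second_fundC p u v : second_fund f p u v = second_fund f p v u.
Proof.
exact: (second_formC (@imm_img_open p) (@imm_metric_smooth p) (@imm_metric_spd p) (@imm_dom_open p)
  (@imm_dom_smooth p) (@imm_dom_sub p) _ _ (imm_dom_center p)).
Qed.

Lemma second_fund_linear p v : linear (fun u => second_fund f p u v).
Proof.
exact: (second_form_linear (@imm_img_open p) (@imm_metric_smooth p) (@imm_metric_spd p) (@imm_dom_open p)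
  (@imm_dom_smooth p) (@imm_dom_sub p) _ (imm_dom_center p)).
Qed.

Lemma tan_second_fund p u v : tan_comp f p (second_fund f p u v) = 0.
Proof.
exact: (tan_second_form (@imm_metric_spd p) (@imm_dom_sub p) (@imm_dom_free p) _ _ (imm_dom_center p)).
Qed.

Definition ambient_curv p (a b c : 'rV[R]_d) : 'rV[R]_d :=
  curvature (Gp p) (chart (f p) (f p)) a b c.

Definition intrinsic_curv p u v w : 'rV[R]_n :=
  curvature (Defs.induced (Gp p) (Fp p)) (x0 p) u v w.

Lemma sec_curvE p u v : sec_curv f p u v = inner (gM f p) (intrinsic_curv p u v v) u
  / (inner (gM f p) u u * inner (gM f p) v v - inner (gM f p) u v ^+ 2).
Proof. by []. Qed.

Lemma gauss_at p u v w z :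
  inner (g p) (ambient_curv p (df f p u) (df f p v) (df f p w)) (df f p z) =
  inner (gM f p) (intrinsic_curv p u v w) z
  - inner (g p) (second_fund f p v w) (second_fund f p u z)
  + inner (g p) (second_fund f p u w) (second_fund f p v z).
Proof.
have := gauss_equation (@imm_img_open p) (@imm_metric_smooth p) (@imm_metric_spd p) (@imm_dom_open p)
  (@imm_dom_smooth p) (@imm_dom_sub p) (@imm_dom_free p) u v w z (imm_dom_center p).
by rewrite metric_center local_rep_center.
Qed.

Lemma weingarten_at p xi u v : tan_comp f p xi = 0 ->
  inner (gM f p) (shape_op f p xi u) v = inner (g p) (second_fund f p u v) xi.
Proof.
move=> xi0.
have := weingarten (@imm_img_open p) (@imm_metric_smooth p) (@imm_metric_spd p) (@imm_dom_open p)
  (@imm_dom_smooth p) (@imm_dom_sub p) (@imm_dom_free p) u v (imm_dom_center p) xi0.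
by rewrite metric_center.
Qed.

Lemma ricci_at p u v xi : tan_comp f p xi = 0 ->
  nor_curvature (Gp p) (Fp p) (x0 p) u v xi =
  nor_comp f p (ambient_curv p (df f p u) (df f p v) xi)
  + (second_fund f p u (shape_op f p xi v) - second_fund f p v (shape_op f p xi u)).
Proof.
move=> xi0.
have := ricci_equation (@imm_img_open p) (@imm_metric_smooth p) (@imm_metric_spd p) (@imm_dom_open p)
  (@imm_dom_smooth p) (@imm_dom_sub p) (@imm_dom_free p) u v (imm_dom_center p) xi0.
by rewrite local_rep_center.
Qed.

(* second_fund at the point of coordinates y uses the charts indexed by that point
   and by its image, not those indexed by p and f p. *)
Lemma second_fund_transport p y : imm_dom p y ->
  exists (A : 'M[R]_n) (B : 'M[R]_d), [/\ A \in unitmx, B \in unitmx &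
    forall u v, second_fund f (chart_inv p y) u v =
      second_form (Gp p) (Fp p) y (u *m A) (v *m A) *m B].
Proof.
move=> py; have [/coord_setE[iy fy] rfy] := py.
set r := chart_inv p y.
pose psi := transition r p; pose phi := transition (f p) (f r).
pose Ophi := coord_set (f p) (chart_dom (f r)).
have pr : chart_dom p r by exact: chart_inv_dom.
have Urr : coord_set r (chart_dom p) (chart r r) by exact: coord_set_center.
have psir : psi (chart r r) = y.
  by rewrite /psi /transition /= chartK ?chart_invK //; exact: chart_dom_mem.
have Oy : Ophi (Fp p y).
  apply/coord_setE; split; first exact: imm_dom_sub.
  by rewrite /local_rep /= chartK //; exact: chart_dom_mem.
have Upsi : imm_dom p (psi (chart r r)) by rewrite psir.
have Opsi : Ophi (Fp p (psi (chart r r))) by rewrite psir.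
have FE z : coord_set r (chart_dom p) z -> imm_dom p (psi z) -> Ophi (Fp p (psi z)) ->
    phi (Fp p (psi z)) = Fp r z.
  move=> Uz [/coord_setE[_ fz] _] _.
  have e : chart_inv p (psi z) = chart_inv r z by exact: transition_inv.
  rewrite e in fz.
  by rewrite /phi /transition /local_rep /= e chartK.
exists ('J psi (chart r r)), ('J phi (Fp p y)); split.
- by rewrite -row_free_unit; exact: row_free_transition.
- by rewrite -row_free_unit; exact: row_free_transition.
move=> u v; rewrite -[in RHS]psir.
apply: (second_form_change (U := imm_dom p) (U' := coord_set r (chart_dom p)) (O := Ophi)
  (O' := chart_img (f r))) Urr Upsi Opsi.
- exact: imm_img_open.
- exact: imm_metric_smooth.
- exact: imm_metric_spd.
- exact: overlap_open.
- exact: smooth_transition.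
- by move=> z /transition_mem/coord_setE[].
- by move=> z; exact: row_free_transition.
- by move=> z; exact: form_in_change.
- exact: imm_dom_open.
- exact: imm_dom_smooth.
- by move=> z /imm_dom_free.
- exact: overlap_open.
- exact: smooth_transition.
- by move=> z; exact: row_free_transition.
- exact: FE.
Qed.

End SubmanifoldAt.

(** * Slant submanifolds *)

Section CanonicalBasis.
Context (R : realType) (d : nat) (M : riemannian R d) (sigma : M -> set 'M[R]_d).

Lemma canonical_basis_shift p (J : 'I_3 -> 'M[R]_d) b :
  canonical_basis sigma p J -> canonical_basis sigma p (fun a => J (a + b)).
Proof.
case=> [iso sq pos neg span]; split=> // [a|a|S].
- by rewrite addrAC pos addrAC.
- by rewrite addrAC neg addrAC.
rewrite span; split=> [[t ->]|[t ->]].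
  exists (fun a => t (a + b)); rewrite (reindex (fun a => a + b)) //=.
  by exists (fun a => a - b) => a _; rewrite ?addrK ?subrK.
exists (fun a => t (a - b)); rewrite (reindex (fun a => a - b)) /=.
  by apply: eq_bigr => a _; rewrite subrK.
by exists (fun a => a + b) => a _; rewrite ?addrK ?subrK.
Qed.

(** The slant condition quantifies over all canonical bases; this rotation makes it available for
    combinations of J_0 and J_1. *)
Definition rotate_basis (c s : R) (J : 'I_3 -> 'M[R]_d) (a : 'I_3) : 'M[R]_d :=
  if a == 0 then c *: J 0 + s *: J 1 else if a == 1 then c *: J 1 - s *: J 0 else J 2.

Lemma canonical_basis_rotate p (J : 'I_3 -> 'M[R]_d) c s : c ^+ 2 + s ^+ 2 = 1 ->
  canonical_basis sigma p J -> canonical_basis sigma p (rotate_basis c s J).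
Proof.
move=> cs cJ; have [iso sq pos neg span] := cJ.
have cs1 (X : 'M[R]_d) : X = (c ^+ 2 + s ^+ 2) *: X by rewrite cs scale1r.
have e1 : 1 + 1 = 2 :> 'I_3 by exact/val_inj.
have e2 : 2 + 1 = 0 :> 'I_3 by exact/val_inj.
have e3 : 1 + 2 = 0 :> 'I_3 by exact/val_inj.
have e4 : 2 + 2 = 1 :> 'I_3 by exact/val_inj.
have e5 : 0 + 1 = 1 :> 'I_3 by exact/val_inj.
have e6 : 0 + 2 = 2 :> 'I_3 by exact/val_inj.
have P0 := pos 0; have P1 := pos 1; have P2 := pos 2.
have N0 := neg 0; have N1 := neg 1; have N2 := neg 2.
rewrite e1 e2 e3 e4 e5 e6 in P0 P1 P2 N0 N1 N2.
have [S0 S1 S2] := And3 (sq 0) (sq 1) (sq 2).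
have [_ [k0 k1 k2] _ _ _] := canonical_basis_triple cJ.
have D (f : 'I_3 -> Prop) : f 0 -> f 1 -> f 2 -> forall a, f a.
  by move=> f0 f1 f2 [[|[|[|]]]] // H; [move: f0|move: f1|move: f2]; congr f; exact/val_inj.
set J' := rotate_basis c s J.
have J0 : J' 0 = c *: J 0 + s *: J 1 by [].
have J1 : J' 1 = c *: J 1 - s *: J 0 by [].
have J2 : J' 2 = J 2 by [].
have sq' : forall a, J' a *m J' a = - 1%:M.
  apply: D; rewrite ?J0 ?J1 ?J2 //.
    rewrite !(mulmxDl, mulmxDr) -!scalemxAl -!scalemxAr S0 S1 P0 N0.
    rewrite [RHS]cs1; move: (J 2) (1%:M) => A B.
    by apply/matrixP => i j; rewrite !mxE; ring.
  rewrite !(mulmxBl, mulmxBr) -!scalemxAl -!scalemxAr S0 S1 P0 N0.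
  rewrite [RHS]cs1; move: (J 2) (1%:M) => A B.
  by apply/matrixP => i j; rewrite !mxE; ring.
have sk' : forall a x y, inner (Defs.metric p) (x *m J' a) y = - inner (Defs.metric p) x (y *m J' a).
  apply: D => x y; rewrite ?J0 ?J1 ?J2 //.
    by rewrite !mulmxDr -!scalemxAr !(innerDl, innerDr, innerZl, innerZr) k0 k1; ring.
  by rewrite !mulmxBr -!scalemxAr !(innerBl, innerBr, innerZl, innerZr) k0 k1; ring.
split=> [a u v|//|||S].
- by rewrite sk' -mulmxA sq' mulmxN mulmx1 innerNr opprK.
- apply: D; rewrite ?e1 ?e2 ?e3 ?e4 ?e5 ?e6 ?J0 ?J1 ?J2.
  + rewrite !(mulmxBl, mulmxDr) -!scalemxAl -!scalemxAr S0 S1 P0 N0.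
    rewrite [RHS]cs1; move: (1%:M : 'M[R]_d) => B.
    by apply/matrixP => i j; rewrite !mxE; ring.
  + rewrite !(mulmxBr) -!scalemxAr P1 N2.
    by apply/matrixP => i j; rewrite !mxE; ring.
  + rewrite !(mulmxDl) -!scalemxAl P2 N1.
    by apply/matrixP => i j; rewrite !mxE; ring.
- apply: D; rewrite ?e1 ?e2 ?e3 ?e4 ?e5 ?e6 ?J0 ?J1 ?J2.
  + rewrite !(mulmxBr, mulmxDl) -!scalemxAl -!scalemxAr S0 S1 P0 N0.
    rewrite [RHS]cs1; move: (1%:M : 'M[R]_d) => B.
    by apply/matrixP => i j; rewrite !mxE; ring.
  + rewrite !(mulmxBl) -!scalemxAl P2 N1.
    by apply/matrixP => i j; rewrite !mxE; ring.
  + rewrite !(mulmxDr) -!scalemxAr P1 N2.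
    by apply/matrixP => i j; rewrite !mxE; ring.
rewrite span; split=> -[t ->].
  exists (fun a => if a == 0 then c * t 0 + s * t 1 else if a == 1 then c * t 1 - s * t 0 else t 2).
  rewrite !sum_ord3 J0 J1 J2 /=.
  have -> : t 0 *: J 0 + t 1 *: J 1 =
      ((c ^+ 2 + s ^+ 2) * t 0) *: J 0 + ((c ^+ 2 + s ^+ 2) * t 1) *: J 1.
    by rewrite cs !mul1r.
  by apply/matrixP => i j; rewrite !mxE; ring.
exists (fun a => if a == 0 then c * t 0 - s * t 1 else if a == 1 then c * t 1 + s * t 0 else t 2).
rewrite !sum_ord3 J0 J1 J2 /=.
by apply/matrixP => i j; rewrite !mxE; ring.
Qed.

End CanonicalBasis.

Section Slant.
Context (R : realType) (n d : nat) (M : manifold R n) (Mbar : riemannian R d).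
Context (sigma : Mbar -> set 'M[R]_d) (f : immersion M Mbar) (theta : R).
Hypotheses (f_slant : slant_proper f sigma theta) (aqh : almost_quaternionic_hermitian sigma).
Implicit Types (p : M) (u v w : 'rV[R]_n) (xi : 'rV[R]_d).

Local Notation g p := (Defs.metric (f p)).
Local Notation h p := (gM f p).

Lemma tan_comp_linear p : linear (tan_comp f p).
Proof. exact: tan_part_is_linear. Qed.

Lemma tan_nor_compE p xi : xi = df f p (tan_comp f p xi) + nor_comp f p xi.
Proof. exact: tan_norE. Qed.

Lemma tan_nor_comp p xi : tan_comp f p (nor_comp f p xi) = 0.
Proof. exact: (tan_nor (@imm_metric_spd _ _ _ _ _ f p) (@imm_dom_sub _ _ _ _ _ f p)
  (@imm_dom_free _ _ _ _ _ f p) _ (imm_dom_center f p)). Qed.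

Lemma inner_normal_df p xi u : tan_comp f p xi = 0 -> inner (g p) xi (df f p u) = 0.
Proof. by move=> xi0; rewrite -inner_tan_comp xi0 inner0l. Qed.

Lemma inner_nor_comp p xi nu : tan_comp f p nu = 0 ->
  inner (g p) (nor_comp f p xi) nu = inner (g p) xi nu.
Proof.
move=> nu0; rewrite [in RHS](tan_nor_compE p xi) innerDl.
by rewrite [inner _ (df f p _) _](innerC (metric_spd _)) inner_normal_df // add0r.
Qed.

Lemma pythagoras_tan_nor p xi : inner (g p) xi xi =
  inner (h p) (tan_comp f p xi) (tan_comp f p xi) + inner (g p) (nor_comp f p xi) (nor_comp f p xi).
Proof.
have N := inner_normal_df (tan_comp f p xi) (tan_nor_comp p xi).
rewrite [in LHS](tan_nor_compE p xi) inner_gM.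
move: (nor_comp f p xi) (df f p _) N => y x N.
by rewrite innerDl !innerDr (innerC (metric_spd _) x y) N addr0 add0r.
Qed.

Definition slant_op p (A : 'M[R]_d) u : 'rV[R]_n := tan_comp f p (df f p u *m A).

Lemma slant_op_linear p A : linear (slant_op p A).
Proof. by move=> a u v; rewrite /slant_op /df mulmxDl -scalemxAl mulmxDl -scalemxAl tan_comp_linear. Qed.

Lemma inner_slant_op p A u v : inner (h p) (slant_op p A u) v = inner (g p) (df f p u *m A) (df f p v).
Proof. exact: inner_tan_comp. Qed.

Section Point.
Variables (p : M) (J : 'I_3 -> 'M[R]_d).
Hypothesis cJ : canonical_basis sigma (f p) J.

Lemma canonical_skew a x y : inner (g p) (x *m J a) y = - inner (g p) x (y *m J a).
Proof.
have [iso sq _ _ _] := cJ; rewrite -[in RHS](iso a) -[y *m J a *m J a]mulmxA sq.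
by rewrite mulmxN mulmx1 innerNr opprK.
Qed.

Lemma slant_op_skew a u v : inner (h p) (slant_op p (J a) u) v = - inner (h p) u (slant_op p (J a) v).
Proof.
by rewrite inner_slant_op canonical_skew (innerC (gM_spd f p)) inner_slant_op (innerC (metric_spd _)).
Qed.

(** The cosine of the angle is |P_a u| / |J_a u|, and |J_a u| = |u|. Pythagoras puts the quotient in
    [0, 1], where [acos] can be inverted. *)
Lemma slant_op_norm a u : inner (h p) (slant_op p (J a) u) (slant_op p (J a) u) =
  cos theta ^+ 2 * inner (h p) u u.
Proof.
have [->|u0] := eqVneq u 0.
  by rewrite /slant_op /df mul0mx mul0mx /tan_comp /tan_part !mul0mx !inner0l mulr0.
have [sl _ _] := f_slant; have := sl p J a u cJ u0.
have [iso _ _ _ _] := cJ.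
rewrite /angle /Defs.gnorm -inner_gM iso -inner_gM -/(slant_op p (J a) u).
set T := slant_op p (J a) u.
have U0 : 0 < inner (h p) u u by exact: (gM_spd f p).2.
have T0 : 0 <= inner (h p) T T := inner_ge0 (gM_spd f p) T.
have TU : inner (h p) T T <= inner (h p) u u.
  have := pythagoras_tan_nor p (df f p u *m J a); rewrite iso -inner_gM -/T => ->.
  by rewrite lerDl inner_ge0 //; exact: metric_spd.
move: (inner _ T T) (inner _ u u) T0 TU U0 => t s t0 ts s0 <-.
have st0 : 0 < Num.sqrt s by rewrite sqrtr_gt0.
rewrite acosK; first by rewrite exprMn exprVn !sqr_sqrtr // ?ltW // divfK // gt_eqF.
rewrite in_itv /= ler_pdivrMr // mul1r ler_wsqrtr // andbT.
apply: le_trans (_ : 0 <= _); first by rewrite lerN10.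
by rewrite divr_ge0 // sqrtr_ge0.
Qed.
End Point.

(** For the rotated operator c J_0 + s J_1 the tangential part has norm |u| |cos theta| again, so
    the cross term 2 c s <P_0 u, P_1 u> vanishes. The values 3/5 and 4/5 make c and s rational and
    both nonzero. *)
Lemma slant_op_orthogonal p J u : canonical_basis sigma (f p) J ->
  inner (h p) (slant_op p (J 0) u) (slant_op p (J 1) u) = 0.
Proof.
move=> cJ; have cs : (3 / 5 : R) ^+ 2 + (4 / 5) ^+ 2 = 1 by field.
have := slant_op_norm (canonical_basis_rotate cs cJ) 0 u.
have N0 := slant_op_norm cJ 0 u; have N1 := slant_op_norm cJ 1 u.
have -> : slant_op p (rotate_basis (3 / 5) (4 / 5) J 0) u =
    (3 / 5) *: slant_op p (J 0) u + (4 / 5) *: slant_op p (J 1) u.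
  rewrite /slant_op /rotate_basis /= mulmxDr -!scalemxAr.
  rewrite (tan_comp_linear p); congr (_ + _).
  by have := tan_comp_linear p (4 / 5) (df f p u *m J 1) 0; rewrite !addr0
    [tan_comp _ _ 0](_ : _ = 0) ?addr0 // /tan_comp /tan_part !mul0mx.
rewrite !(innerDl, innerDr, innerZl, innerZr) N0 N1.
rewrite (innerC (gM_spd f p) (slant_op p (J 1) u)).
by move: (inner _ _ _) (inner _ _ _) (cos _) => x y z; lra.
Qed.

Lemma slant_cos_gt0 : 0 < cos theta ^+ 2.
Proof.
have [_ _ ntr] := f_slant.
rewrite lt_neqAle sqr_ge0 andbT eq_sym; apply/negP => /eqP c0; apply: ntr => p J a u cJ.
have := slant_op_norm cJ a u; rewrite c0 mul0r; exact: (inner_eq0 (gM_spd f p)).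
Qed.

Lemma slant_nor_norm p J a u : canonical_basis sigma (f p) J ->
  inner (g p) (nor_comp f p (df f p u *m J a)) (nor_comp f p (df f p u *m J a)) =
  (1 - cos theta ^+ 2) * inner (h p) u u.
Proof.
move=> cJ; have := slant_op_norm cJ a u; have := pythagoras_tan_nor p (df f p u *m J a).
have [iso _ _ _ _] := cJ; rewrite iso -inner_gM /slant_op => E1 E2.
by rewrite mulrBl mul1r -E2 E1 addrAC subrr add0r.
Qed.

Lemma slant_witness : exists p J (a : 'I_3) u,
  canonical_basis sigma (f p) J /\ nor_comp f p (df f p u *m J a) != 0.
Proof.
have [_ nq _] := f_slant; apply: contrapT => H; apply: nq => p J a u cJ.
by apply/eqP; apply: contrapT => /negP H'; apply: H; exists p, J, a, u.
Qed.

Lemma slant_cos_lt1 : cos theta ^+ 2 < 1.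
Proof.
have [p [J [a [u [cJ nz]]]]] := slant_witness.
have := slant_nor_norm a u cJ.
have := (metric_spd (f p)).2 _ nz; have U0 := inner_ge0 (gM_spd f p) u => P E.
rewrite -subr_gt0 ltNge; apply/negP => H; move: P; rewrite E ltNge => /negP; apply.
exact: mulr_le0_ge0.
Qed.

Lemma canonical_basis_exists p : exists J, canonical_basis sigma (f p) J.
Proof. by have [U [J [_ Up _ cJ]]] := aqh (f p); exists (fun a => J a (f p)); exact: cJ. Qed.

(** Polarization of the orthogonality at x + z, followed by skewness. *)
Lemma slant_opA p J : canonical_basis sigma (f p) J -> forall x,
  slant_op p (J 0) (slant_op p (J 1) x) = - slant_op p (J 1) (slant_op p (J 0) x).
Proof.
move=> cJ x; apply: (inner_inj (gM_spd f p)) => z.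
have O := slant_op_orthogonal (x + z) cJ; have Ox := slant_op_orthogonal x cJ.
have Oz := slant_op_orthogonal z cJ; have C := innerC (gM_spd f p).
have L A : slant_op p A (x + z) = slant_op p A x + slant_op p A z.
  by have := slant_op_linear p A 1 x z; rewrite !scale1r.
move: O; rewrite !L !(innerDl, innerDr) Ox Oz innerNl.
rewrite (slant_op_skew cJ 0 (slant_op p (J 1) x)) (slant_op_skew cJ 1 (slant_op p (J 0) x)).
by rewrite (C (slant_op p (J 0) z)); lra.
Qed.

Lemma slant_op_sqr p J a : canonical_basis sigma (f p) J -> forall x,
  slant_op p (J a) (slant_op p (J a) x) = - (cos theta ^+ 2 *: x).
Proof.
move=> cJ x; apply: (inner_inj (gM_spd f p)) => z.
have O := slant_op_norm cJ a (x + z); have Ox := slant_op_norm cJ a x.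
have Oz := slant_op_norm cJ a z; have C := innerC (gM_spd f p).
have L A : slant_op p A (x + z) = slant_op p A x + slant_op p A z.
  by have := slant_op_linear p A 1 x z; rewrite !scale1r.
move: O; rewrite !L !(innerDl, innerDr) Ox Oz innerNl innerZl (slant_op_skew cJ a (slant_op p (J a) x)).
rewrite (C (slant_op p (J a) z)) (C z x).
move: (inner _ _ (slant_op _ _ z)) (inner _ x z) (inner _ x x) (inner _ z z) (cos _ ^+ 2) => A B D E F.
by lra.
Qed.

Lemma slant_opP p J : canonical_basis sigma (f p) J ->
  slant_triple (h p) (cos theta ^+ 2) (slant_op p (J 0)) (slant_op p (J 1)) (slant_op p (J 2)).
Proof.
move=> cJ.
have e1 : 1 + 1 = 2 :> 'I_3 by exact/val_inj.
have e3 : 1 + 2 = 0 :> 'I_3 by exact/val_inj.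
have A1 := slant_opA (canonical_basis_shift 1 cJ).
have A2 := slant_opA (canonical_basis_shift 2 cJ).
rewrite !add0r e1 e3 in A1 A2.
split.
- exact: slant_cos_gt0.
- by split=> x y; exact: slant_op_skew.
- by split; exact: slant_op_sqr.
- split=> //; exact: slant_opA.
Qed.

(** P_a u is orthogonal to u, and it is nonzero for u <> 0 because cos theta <> 0. It follows that n
    (n - 1) can be divided by. *)
Lemma slant_dim_gt1 : (1 < n)%N.
Proof.
have [p [J [a [u [cJ nz]]]]] := slant_witness.
have u0 : u != 0.
  by apply: contraNneq nz => ->; rewrite /df !mul0mx /nor_comp /nor_part /tan_part !mul0mx subr0.
have U0 : 0 < inner (h p) u u by exact: (gM_spd f p).2.
have s0 := slant_cos_gt0; have N := slant_op_norm cJ a u.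
have S : inner (h p) u (slant_op p (J a) u) = 0.
  by have := slant_op_skew cJ a u u; rewrite (innerC (gM_spd f p)) => /eqP; rewrite -addr_eq0 -mulr2n mulrn_eq0 => /eqP.
have P0 : 0 < inner (h p) (slant_op p (J a) u) (slant_op p (J a) u) by rewrite N mulr_gt0.
rewrite ltnNge; apply/negP => n1.
have /linear_dependence [E|[b E]] : ~~ row_free (col_mx u (slant_op p (J a) u)).
- by rewrite /row_free neq_ltn (leq_ltn_trans (rank_leq_col _)).
- by move: P0; rewrite E inner0l ltxx.
- by move: U0; rewrite {1}E innerZl (innerC (gM_spd f p)) S mulr0 ltxx.
Qed.

End Slant.

(** * Casorati and scalar curvature *)

Section CasoratiAt.
Context (R : realType) (n d : nat) (M : manifold R n) (Mbar : riemannian R d).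
Context (f : immersion M Mbar).
Implicit Types (p : M) (u v w : 'rV[R]_n) (xi : 'rV[R]_d).

Local Notation g p := (Defs.metric (f p)).
Local Notation h p := (gM f p).
Local Notation II p := (second_fund f p).

Lemma onb_orthonormal p : tangent_orthonormal f p (onb f p).
Proof.
apply: (xgetPex 0 (P := [set E : 'M[R]_n | tangent_orthonormal f p E])).
by have [E EE] := spd_orthonormal_family (gM_spd f p) (leqnn n); exists E.
Qed.

Lemma normal_space_rank p :
  \rank (kermx (g p *m ('J (local_rep f p) (chart p p))^T)) = (d - n)%N.
Proof.
rewrite mxrank_ker eqmxMfull; last by rewrite row_full_unit; exact: spd_unit (metric_spd _).
by rewrite mxrank_tr; have := imm_free f p; rewrite /row_free => /eqP ->.
Qed.

Lemma tan_comp_eq0 p xi : tan_comp f p xi = 0 <->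
  xi *m (g p *m ('J (local_rep f p) (chart p p))^T) = 0.
Proof.
rewrite /tan_comp /tan_part metric_center mulmxA; split=> [H|->]; last by rewrite mul0mx.
apply: (row_free_eq0 (A := invmx (h p))) H.
by rewrite row_free_unit unitmx_inv; exact: spd_unit (gM_spd f p).
Qed.

Lemma nor_onb_frame p : normal_frame f p (nor_onb f p).
Proof.
apply: (xgetPex 0 (P := [set E : 'M[R]_(d - n, d) | normal_frame f p E])).
have [E [EE EK]] := orthonormal_basis_subspace (metric_spd (f p)) (normal_space_rank p).
exists E; split=> // i; apply/tan_comp_eq0/sub_kermxP.
by rewrite -EK row_sub.
Qed.

Lemma normal_frame_span p (E' : 'M[R]_(d - n, d)) xi :
  normal_frame f p E' -> tan_comp f p xi = 0 -> (xi <= E')%MS.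
Proof.
move=> [EE EN] /tan_comp_eq0/sub_kermxP xiK; apply: submx_trans xiK _.
have sub : (E' <= kermx (g p *m ('J (local_rep f p) (chart p p))^T))%MS.
  by apply/row_subP => i; apply/sub_kermxP/tan_comp_eq0.
rewrite -(geq_leqif (mxrank_leqif_sup sub)) normal_space_rank.
suff /eqP -> : row_free E' by [].
by apply/row_freeP; exists (g p *m E'^T); rewrite mulmxA.
Qed.

Lemma normal_expansion p (E' : 'M[R]_(d - n, d)) xi :
  normal_frame f p E' -> tan_comp f p xi = 0 ->
  xi = \sum_al inner (g p) xi (row al E') *: row al E'.
Proof.
move=> nE xi0; rewrite {1}(orthonormal_expansion nE.1 (normal_frame_span nE xi0)) mulmx_sum_row.
by apply: eq_bigr => i _; rewrite inner_rowE.
Qed.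

Definition second_mx p xi : 'M[R]_n :=
  \matrix_(i, j) inner (g p) (II p (delta_mx 0 i) (delta_mx 0 j)) xi.

Lemma second_fund_linearr p u : linear (second_fund f p u).
Proof. by move=> a v w; rewrite second_fundC second_fund_linear !(second_fundC _ _ u). Qed.

Lemma second_mxE p xi u v : inner (g p) (II p u v) xi = inner (second_mx p xi) u v.
Proof.
have suml (F : 'rV[R]_n -> 'rV[R]_d) z : linear F -> F z = \sum_i z 0 i *: F (delta_mx 0 i).
  move=> lF; pose fF := GRing.isLinear.Build _ _ _ _ _ lF.
  pose ff : {linear 'rV[R]_n -> 'rV[R]_d} := HB.pack F fF.
  have -> : F = ff by [].
  rewrite {1}[z]row_sum_delta linear_sum.
  by apply: eq_bigr => i _; rewrite linearZ.
rewrite (suml _ _ (second_fund_linear f p v)) inner_suml innerE.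
rewrite -mulmxA mxE; apply: eq_bigr => i _; rewrite innerZl; congr (_ * _).
rewrite (suml _ _ (second_fund_linearr p (delta_mx 0 i))) inner_suml mxE.
by apply: eq_bigr => j _; rewrite innerZl !mxE mulrC.
Qed.

Lemma second_mxT p xi : (second_mx p xi)^T = second_mx p xi.
Proof. by apply/matrixP => i j; rewrite !mxE second_fundC. Qed.

(** In the basis [onb] the induced metric is the identity matrix, so the results on symmetric
    matrices with the standard inner product apply. *)
Definition second_onb p xi : 'M[R]_n := onb f p *m second_mx p xi *m (onb f p)^T.

Lemma second_onbT p xi : (second_onb p xi)^T = second_onb p xi.
Proof. by rewrite /second_onb !trmx_mul trmxK second_mxT mulmxA. Qed.

Local Notation H p al := (second_onb p (row al (nor_onb f p))).

Lemma onb_unit p : onb f p \in unitmx.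
Proof.
have := onb_orthonormal p; rewrite /tangent_orthonormal -mulmxA => /mulmx1_unit[]//.
Qed.

Lemma frame_onb p s (E : 'M[R]_(s, n)) : tangent_orthonormal f p E ->
  (E *m invmx (onb f p)) *m (E *m invmx (onb f p))^T = 1%:M.
Proof.
move=> EE; have O := onb_orthonormal p; have U := onb_unit p.
have hE : h p = invmx (onb f p) *m (invmx (onb f p))^T.
  rewrite -[LHS](mulKmx U); congr (_ *m _); rewrite trmx_inv.
  have UT : (onb f p)^T \in unitmx by rewrite unitmx_tr.
  by rewrite -[LHS](mulmxK UT); have -> : onb f p *m h p *m (onb f p)^T = 1%:M := O; rewrite mul1mx.
by rewrite trmx_mul mulmxA -[E *m _ *m _]mulmxA -hE.
Qed.

Lemma mxtrace_congruence s (U : 'M[R]_(s, n)) (A : 'M[R]_n) :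
  \tr (U *m A *m U^T *m (U *m A *m U^T)) = \tr (A *m (U^T *m U) *m A *m (U^T *m U)).
Proof. by rewrite !mulmxA mxtrace_mulC !mulmxA mxtrace_mulC !mulmxA. Qed.

(** The family E enters only through U^T U, which for an orthonormal E is the orthogonal projection
    onto its span in the coordinates of [onb]. Hence the choice of an orthonormal basis of the
    subspace does not matter. *)
Lemma casorati_basisE p s (E : 'M[R]_(s, n)) : let U := E *m invmx (onb f p) in
  casorati_basis f p E =
  s%:R^-1 * \sum_al \tr (H p al *m (U^T *m U) *m H p al *m (U^T *m U)).
Proof.
move=> U; rewrite /casorati_basis; congr (_ * _); apply: eq_bigr => al _.
rewrite -mxtrace_congruence.
have -> : U *m H p al *m U^T = E *m second_mx p (row al (nor_onb f p)) *m E^T.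
  have EU : U *m onb f p = E by rewrite mulmxKV ?onb_unit.
  by clearbody U; rewrite -EU trmx_mul /second_onb !mulmxA.
set B := second_mx _ _.
have EB i j : inner B (row i E) (row j E) = (E *m B *m E^T) i j.
  by rewrite -inner_rowE -!row_mul mxE.
have EBT : (E *m B *m E^T)^T = E *m B *m E^T by rewrite !trmx_mul trmxK second_mxT mulmxA.
rewrite /mxtrace; apply: eq_bigr => i _; rewrite mxE.
apply: eq_bigr => j _; rewrite second_mxE EB expr2; congr (_ * _).
by rewrite -[in LHS]EBT mxE.
Qed.

End CasoratiAt.

Lemma sum_sym_pairs (R : comPzRingType) n (K : 'I_n -> 'I_n -> R) :
  (forall i j, K i j = K j i) -> (forall i, K i i = 0) ->
  \sum_(i < n) \sum_(j < n) K i j = 2 * \sum_(i < n) \sum_(j < n | (i < j)%N) K i j.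
Proof.
move=> KC K0.
have -> : \sum_(i < n) \sum_(j < n) K i j = \sum_(i < n) \sum_(j < n | (i < j)%N) K i j + \sum_(i < n) \sum_(j < n | (j < i)%N) K i j.
  rewrite -big_split /=; apply: eq_bigr => i _; rewrite (bigID (fun j : 'I_n => (i < j)%N)) /=.
  congr (_ + _); rewrite (bigD1 i) /=; last by rewrite ltnn.
  by rewrite K0 add0r; apply: eq_bigl => j; rewrite -leqNgt ltn_neqAle andbC.
have -> : \sum_(i < n) \sum_(j < n | (j < i)%N) K i j = \sum_(i < n) \sum_(j < n | (i < j)%N) K i j.
  rewrite [LHS](exchange_big_dep xpredT) //=; apply: eq_bigr => i _.
  by apply: eq_bigr => j _; rewrite KC.
by rewrite mulr_natl mulr2n.
Qed.

Section ScalarCurvature.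
Context (R : realType) (n d : nat) (M : manifold R n) (Mbar : riemannian R d).
Context (sigma : Mbar -> set 'M[R]_d) (f : immersion M Mbar) (c theta : R).
Hypotheses (f_slant : slant_proper f sigma theta) (space_form : quaternionic_space_form sigma c).
Implicit Types (p : M) (u v w : 'rV[R]_n) (xi : 'rV[R]_d).

Local Notation g p := (Defs.metric (f p)).
Local Notation h p := (gM f p).
Local Notation II p := (second_fund f p).
Local Notation H p al := (second_onb f p (row al (nor_onb f p))).

Lemma casoratiE p : casorati f p = n%:R^-1 * \sum_al \tr (H p al *m H p al).
Proof.
rewrite /casorati casorati_basisE mulmxV ?onb_unit //; congr (_ * _).
by apply: eq_bigr => al _; rewrite trmx1 !mulmx1.
Qed.

Lemma natr_rank (L : 'M[R]_n) : (\rank L).+1 = n -> (\rank L)%:R = n%:R - 1 :> R.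
Proof. by move: (\rank L) => k <-; rewrite -natr1 addrK. Qed.

Definition normal_casorati p w : R :=
  (n%:R - 1)^-1 * \sum_al \tr (H p al *m hyperplane_proj w *m H p al *m hyperplane_proj w).

Lemma hyperplane_casoratiE p : hyperplane_casorati f p = normal_casorati p @` @unit_sphere R n.
Proof.
(* The normal w comes from whichever basis of L was chosen. The last clause identifies it when L is
   built from a given normal w', as the converse inclusion requires. *)
have basis (L : 'M[R]_n) : (\rank L).+1 = n ->
    exists w, w *m w^T = 1%:M /\ casorati_sub f p L = normal_casorati p w /\
    forall w', w' *m w'^T = 1%:M -> (L <= hyperplane_proj w' *m onb f p)%MS ->
      hyperplane_proj w = hyperplane_proj w'.
  move=> rL.
  have [] : [set E | tangent_orthonormal f p E /\ (E :=: L)%MS] (onb_sub f p L).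
    apply: (xgetPex 0 (P := [set E : 'M[R]_(\rank L, n) | tangent_orthonormal f p E /\ (E :=: L)%MS])).
    exact: orthonormal_basis_subspace (gM_spd f p) erefl.
  rewrite /casorati_sub.
  move: (onb_sub f p L) (casorati_basisE f p (onb_sub f p L)) => E CE [EE EL].
  have [w [w1 Ew]] := orthonormal_complement rL (frame_onb EE).
  exists w; split=> //; split.
    by rewrite CE /= Ew /normal_casorati (natr_rank rL).
  move=> w' w'1; rewrite -EL => /submxP[X EX].
  apply: hyperplane_proj_inj => //; rewrite -Ew.
  rewrite -mulmxA EX -[X *m (_ *m _) *m _]mulmxA mulmxK ?onb_unit //.
  have Pw' : hyperplane_proj w' *m w'^T = 0.
    by apply: trmx_inj; rewrite trmx_mul trmxK hyperplane_projT mul_normal_proj // trmx0.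
  by rewrite -[X *m _ *m _]mulmxA Pw' !mulmx0.
apply/seteqP; split=> x [].
  by move=> L /basis[w [w1 [-> _]]] <-; exists w.
move=> w w1 <-; exists (hyperplane_proj w *m onb f p).
  rewrite /= mxrankMfree ?row_free_unit ?onb_unit //; exact: mxrank_hyperplane_proj.
have [|w' [w'1 [-> /(_ w w1 (submx_refl _)) E]]] := basis (hyperplane_proj w *m onb f p).
  rewrite mxrankMfree ?row_free_unit ?onb_unit //; exact: mxrank_hyperplane_proj.
by rewrite /normal_casorati E.
Qed.

Lemma codim_gt0 : (0 < d - n)%N.
Proof.
have [p [J [a [u [cJ nz]]]]] := slant_witness f_slant.
rewrite lt0n; apply: contra_neqN nz => /eqP dn.
have N := tan_nor_comp f p (df f p u *m J a).
rewrite (normal_expansion (nor_onb_frame f p) N) big1 // => i _.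
by exfalso; have := ltn_ord i; rewrite [X in (_ < X)%N]dn.
Qed.

Lemma inner_onb p i j : inner (h p) (row i (onb f p)) (row j (onb f p)) = (i == j)%:R.
Proof. by rewrite -inner_rowE -!row_mul (onb_orthonormal f p) row1 mxE eqxx eq_sym. Qed.

Lemma second_onbE p xi i j :
  second_onb f p xi i j = inner (g p) (II p (row i (onb f p)) (row j (onb f p))) xi.
Proof. by rewrite second_mxE -inner_rowE -!row_mul [RHS]mxE. Qed.

Lemma gauss_space_form p J u v : canonical_basis sigma (f p) J ->
  inner (h p) (intrinsic_curv f p u v v) u =
  c / 4 * ((inner (h p) u u * inner (h p) v v - inner (h p) u v ^+ 2)
     + 3 * (inner (h p) (slant_op f p (J 0) v) u ^+ 2 + inner (h p) (slant_op f p (J 1) v) u ^+ 2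
       + inner (h p) (slant_op f p (J 2) v) u ^+ 2))
  + (inner (g p) (II p u u) (II p v v) - inner (g p) (II p u v) (II p u v)).
Proof.
move=> cJ; have d0 : (0 < d)%N := leq_trans codim_gt0 (leq_subr _ _).
have C := innerC (metric_spd (f p)).
have G := gauss_at f p u v v u; have S := space_form_curvatureE d0 space_form cJ.
have E := S (df f p u) (df f p v) (df f p v) (df f p u).
have {E} G2 := etrans (esym E) G; clear G S.
rewrite -> (C (II p v v) (II p u u)), (second_fundC f p v u) in G2.
have alg (x K a b : R) : x = K - a + b -> K = x + (a - b) by clear; move=> ->; ring.
refine (etrans (alg _ _ _ _ G2) (congr1 (fun z => z + _) _)); clear alg G2; congr (_ * _).
rewrite !inner_slant_op !inner_gM.
move: (df f p u) (df f p v) => {u v} x y.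
have skew i (z w : 'rV[R]_d) : inner (g p) (z *m J i) w = - inner (g p) (w *m J i) z.
  by rewrite (canonical_skew cJ) (C z).
have diag i (z : 'rV[R]_d) : inner (g p) (z *m J i) z = 0.
  by have := skew i z z; move: (inner _ _ _) => r; lra.
rewrite /model_curvature /qterm !diag !(skew _ x y) (C y x).
move: (inner (g p) x x) (inner (g p) y y) (inner (g p) x y) => X Y Z.
lra.
Qed.

Lemma sum_sqr_inner_onb p u : \sum_i inner (h p) u (row i (onb f p)) ^+ 2 = inner (h p) u u.
Proof.
rewrite (parseval u (onb_orthonormal f p) (v := u)); last first.
  by apply: submx_full; rewrite row_full_unit onb_unit.
by apply: eq_bigr => i _; rewrite expr2.
Qed.

(** The 9 is the factor 3 with which each J_a enters a sectional curvature, times the three J_a; by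
    Parseval each of them sums to n cos^2 theta over all ordered pairs. The traces come from the
    Gauss equation, expanded in the normal basis. *)
Lemma scalar_curvatureE p : 2 * tau f p =
  c / 4 * (n%:R * (n%:R - 1) + 9 * n%:R * cos theta ^+ 2)
  + \sum_al (\tr (H p al) ^+ 2 - \tr (H p al *m H p al)).
Proof.
have [J cJ] := canonical_basis_exists f space_form.1.1 p.
pose e i := row i (onb f p).
have HE al i j : inner (g p) (II p (e i) (e j)) (row al (nor_onb f p)) = H p al i j.
  by rewrite second_onbE.
have HT al i j : H p al j i = H p al i j by rewrite -[in LHS]second_onbT mxE.
have PE i j k l : inner (g p) (II p (e i) (e j)) (II p (e k) (e l)) =
    \sum_al H p al i j * H p al k l.
  rewrite (parseval _ (nor_onb_frame f p).1); last first.
    by apply: normal_frame_span (nor_onb_frame f p) _; exact: tan_second_fund.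
  by apply: eq_bigr => al _; exact: congr2 (HE al i j) (HE al k l).
pose q a i j := inner (h p) (slant_op f p (J a) (e j)) (e i) ^+ 2.
pose K i j := c / 4 * ((1 - (i == j)%:R) + 3 * (q 0 i j + q 1 i j + q 2 i j))
  + \sum_al (H p al i i * H p al j j - H p al i j * H p al i j).
have KE i j : inner (h p) (intrinsic_curv f p (e i) (e j) (e j)) (e i) = K i j.
  refine (etrans (gauss_space_form (e i) (e j) cJ) (congr2 +%R _ _)).
    congr (_ * (_ + _)); rewrite (inner_onb p i i) (inner_onb p j j) (inner_onb p i j) !eqxx.
    by case: (i == j); rewrite ?expr1n ?expr0n ?mulr1.
  by refine (etrans (congr2 (fun x y => x - y) (PE i i j j) (PE i j i j)) _); rewrite sumrB.
have qC a i j : q a i j = q a j i.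
  by rewrite /q (slant_op_skew cJ) sqrrN (innerC (gM_spd f p)).
have q0 a i : q a i i = 0.
  rewrite /q; have := slant_op_skew cJ a (e i) (e i); rewrite (innerC (gM_spd f p) (e i)).
  by move: (inner _ _ _) => x X; have -> : x = 0 by [lra]; rewrite expr0n.
have KC i j : K i j = K j i.
  rewrite /K eq_sym !(qC _ i j); congr (_ + _); apply: eq_bigr => al _.
  by rewrite (HT _ i j) [H p al i i * _]mulrC.
have K0 i : K i i = 0.
  rewrite /K eqxx !q0 big1 ?addr0 // => [|al _]; last by rewrite subrr.
  by rewrite subrr !add0r !mulr0.
have tauE : tau f p = \sum_(i < n) \sum_(j < n | (i < j)%N) K i j.
  apply: eq_bigr => i _; apply: eq_bigr => j ij.
  rewrite sec_curvE; refine (etrans (congr1 (fun z => z / _) (KE i j)) _).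
  rewrite (inner_onb p i i) (inner_onb p j j) (inner_onb p i j) !eqxx.
  by rewrite (_ : i == j = false) ?expr0n /= ?subr0 ?mulr1 ?divr1 //; apply/negbTE; rewrite neq_ltn ij.
rewrite tauE -(sum_sym_pairs KC K0) /K.
have qS a : \sum_i \sum_j q a i j = n%:R * cos theta ^+ 2.
  rewrite exchange_big /=.
  rewrite (eq_bigr (fun=> cos theta ^+ 2)) => [|j _].
    by rewrite sumr_const card_ord mulr_natl.
  by rewrite sum_sqr_inner_onb (slant_op_norm f_slant cJ) inner_onb eqxx mulr1.
have dS : \sum_(i < n) \sum_(j < n) (1 - (i == j)%:R : R) = n%:R * (n%:R - 1).
  rewrite (eq_bigr (fun=> n%:R - 1)) => [|i _].
    by rewrite sumr_const card_ord mulr_natl.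
  rewrite sumrB sumr_const card_ord; congr (_ - _).
  by rewrite (bigD1 i) //= eqxx big1 ?addr0 // => j ji; rewrite eq_sym (negbTE ji).
have SE : \sum_i \sum_j \sum_al (H p al i i * H p al j j - H p al i j * H p al i j) =
    \sum_al (\tr (H p al) ^+ 2 - \tr (H p al *m H p al)).
  under eq_bigr do rewrite exchange_big /=.
  rewrite exchange_big /=; apply: eq_bigr => al _.
  under eq_bigr do rewrite sumrB; rewrite sumrB; congr (_ - _).
    by rewrite expr2 /mxtrace mulr_suml; apply: eq_bigr => i _; rewrite mulr_sumr.
  rewrite /mxtrace; apply: eq_bigr => i _; rewrite mxE; apply: eq_bigr => j _.
  by rewrite (HT _ i j).
transitivity (c / 4 * (\sum_(i < n) \sum_(j < n) (1 - (i == j)%:R)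
    + 3 * (\sum_i \sum_j q 0 i j + \sum_i \sum_j q 1 i j + \sum_i \sum_j q 2 i j))
  + \sum_i \sum_j \sum_al (H p al i i * H p al j j - H p al i j * H p al i j)); last first.
  by rewrite dS !qS SE; ring.
rewrite -!big_split /= mulr_sumr -big_split /= mulr_sumr -big_split /=.
apply: eq_bigr => i _; rewrite -!big_split /= mulr_sumr -big_split /= mulr_sumr -big_split /=.
by apply: eq_bigr => j _.
Qed.

End ScalarCurvature.

(** * The inequalities and the pointwise form of equality *)

Section CasoratiInequality.
Context (R : realType) (n d : nat) (M : manifold R n) (Mbar : riemannian R d).
Context (sigma : Mbar -> set 'M[R]_d) (f : immersion M Mbar) (c theta : R).
Hypotheses (f_slant : slant_proper f sigma theta) (space_form : quaternionic_space_form sigma c).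
Implicit Types (p : M) (u v w e : 'rV[R]_n) (xi zeta : 'rV[R]_d).

Local Notation g p := (Defs.metric (f p)).
Local Notation h p := (gM f p).
Local Notation II p := (second_fund f p).
Local Notation H p al := (second_onb f p (row al (nor_onb f p))).
Local Notation N1 := (n%:R * (n%:R - 1) : R).
Local Notation bound := (c / 4 * (1 + 9 / (n%:R - 1) * cos theta ^+ 2)).
Local Notation coef r := ((n%:R - 1) * (n%:R + r) * (n%:R ^+ 2 - n%:R - r) / (r * n%:R)).
Local Notation defect p w r := (\sum_al casorati_defect w (H p al) r).

Let n2 : (1 < n)%N := slant_dim_gt1 f_slant.
Let n0 : 0 < n%:R :> R. Proof. by rewrite ltr0n ltnW. Qed.
Let n1 : 0 < n%:R - 1 :> R. Proof. by rewrite subr_gt0 ltr1n. Qed.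

(** With C(L) in place of its extremum nothing is estimated: both the inequalities and their
    equality cases reduce to the sign and the zeros of the defect. *)
Lemma casorati_gap p w r : 0 < r ->
  r * casorati f p + coef r * normal_casorati f p w = N1 * (rho f p - bound) + defect p w r.
Proof.
move=> r0; have rn := lt0r_neq0 r0; have nn := lt0r_neq0 n0; have nn1 := lt0r_neq0 n1.
pose A := \sum_al \tr (H p al *m H p al); pose T := \sum_al \tr (H p al) ^+ 2.
pose B := \sum_al \tr (H p al *m hyperplane_proj w *m H p al *m hyperplane_proj w).
have E1 : casorati f p = n%:R^-1 * A := casoratiE f p.
have E2 : normal_casorati f p w = (n%:R - 1)^-1 * B by [].
have E3 : rho f p = (c / 4 * (N1 + 9 * n%:R * cos theta ^+ 2) + (T - A)) / N1.
  by rewrite /rho (scalar_curvatureE f_slant space_form) sumrB.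
have E4 : defect p w r = (r + n%:R) / n%:R * A
    + (n%:R + r) * (n%:R ^+ 2 - n%:R - r) / (r * n%:R) * B - T.
  by rewrite /A /B /T !mulr_sumr -big_split -sumrB.
rewrite E1 E2 E3 E4; clearbody A B T; move: (cos theta) n%:R nn nn1 => C N NN NN1.
by field; rewrite NN NN1 rn.
Qed.

Lemma defect_ge0 p w r : 0 < r -> w *m w^T = 1%:M -> 0 <= defect p w r.
Proof.
by move=> r0 w1; apply: sumr_ge0 => al _; apply: casorati_defect_ge0 => //; exact: second_onbT.
Qed.

Lemma normal_casorati_continuous p : continuous (normal_casorati f p).
Proof.
have oT : open [set: 'rV[R]_n] := openT.
have sI : smooth_on [set: 'rV[R]_n] (fun w : 'rV[R]_n => w) by exact: smooth_id.
have sP : smooth_on [set: 'rV[R]_n] (fun w : 'rV[R]_n => hyperplane_proj w).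
  apply: (smooth_eq oT (f := fun w : 'rV[R]_n => 1%:M + (-1) *: (w^T *m w))).
    by move=> w _; rewrite scaleN1r.
  apply: smoothD => //; first exact: smooth_cst.
  apply: smooth_scale => //; first exact: smooth_cst.
  by apply: smooth_mulmx => //; exact: smooth_trmx.
have sT (A : 'rV[R]_n -> 'M[R]_n) : smooth_on [set: 'rV[R]_n] A ->
    smooth_on [set: 'rV[R]_n] (fun w => \tr (A w)).
  by move=> /(smooth_mxP oT) sA; apply: smooth_sum.
suff sC : smooth_on [set: 'rV[R]_n] (normal_casorati f p).
  by move=> w; apply: differentiable_continuous; exact: smooth_differentiable sC _.
apply: smoothM => //; first exact: smooth_cst.
apply: smooth_sum => // al; apply: sT.
do ![apply: smooth_mulmx => //; try exact: smooth_cst].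
Qed.

(** The common factor of the shape operators is absorbed in [zeta], which may vanish. In the
    equality case [e] and [zeta] are found point by point, without any regularity. *)
Definition quasi_umbilical_at p lam e zeta :=
  [/\ inner (h p) e e = 1, tan_comp f p zeta = 0 &
    forall u v, II p u v = quasi_umbilical_form (h p) e lam u v *: zeta].

Lemma inner_onb_coord p u v :
  inner (h p) u v = inner 1%:M (u *m invmx (onb f p)) (v *m invmx (onb f p)).
Proof.
have E : onb f p *m h p *m (onb f p)^T = 1%:M := onb_orthonormal f p.
by rewrite -E inner_mulmx !mulmxKV ?onb_unit.
Qed.

Lemma inner_umbilical_mx w lam u v :
  inner (hyperplane_proj w + lam *: (w^T *m w)) u v = quasi_umbilical_form 1%:M w lam u v.
Proof.
have -> : hyperplane_proj w + lam *: (w^T *m w) = 1%:M + (lam - 1) *: (w^T *m w).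
  by rewrite /hyperplane_proj scalerBl scale1r addrAC addrA.
rewrite /quasi_umbilical_form inner_addl inner_scalel -mulrA; congr (_ + _ * _).
rewrite !innerE !mulmx1 mulmxA -[u *m w^T *m w *m _]mulmxA mxE big_ord1; congr (_ * _).
by rewrite -[v *m _]trmxK [RHS]mxE trmx_mul trmxK.
Qed.

Lemma quasi_umbilical_form_onb p w lam u v :
  quasi_umbilical_form (h p) (w *m onb f p) lam u v =
  inner (hyperplane_proj w + lam *: (w^T *m w)) (u *m invmx (onb f p)) (v *m invmx (onb f p)).
Proof.
by rewrite inner_umbilical_mx /quasi_umbilical_form !inner_onb_coord mulmxK ?onb_unit.
Qed.

Lemma second_mx_onb p xi u v :
  inner (g p) (II p u v) xi = inner (second_onb f p xi) (u *m invmx (onb f p)) (v *m invmx (onb f p)).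
Proof.
by rewrite second_mxE /second_onb inner_mulmx !mulmxKV ?onb_unit.
Qed.

Lemma inner_delta (A : 'M[R]_n) i j : inner A (delta_mx 0 i) (delta_mx 0 j) = A i j.
Proof. by rewrite innerE -rowE trmx_delta -colE !mxE. Qed.

(** All the matrices [H p al] lose their defect for the same w. So one direction e serves every
    normal direction, and the factors t_al are the components of zeta. *)
Lemma defect_eq0_umbilical p w r : 0 < r -> w *m w^T = 1%:M -> defect p w r = 0 ->
  exists zeta, quasi_umbilical_at p (N1 / r) (w *m onb f p) zeta.
Proof.
move=> r0 w1 /eqP; rewrite psumr_eq0; last first.
  by move=> al _; apply: casorati_defect_ge0 => //; exact: second_onbT.
move=> /allP D0.
have {D0} /choice[t Ht] al : exists t, H p al = t *: (hyperplane_proj w + (N1 / r) *: (w^T *m w)).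
  have /eqP := D0 al (mem_index_enum al).
  by move/(casorati_defect_eq0 w1 (second_onbT f p _) r0 n2).
have N := nor_onb_frame f p.
exists (\sum_al t al *: row al (nor_onb f p)); split.
- by rewrite inner_onb_coord mulmxK ?onb_unit // innerE mulmx1 w1 mxE.
- apply/tan_comp_eq0; rewrite mulmx_suml big1 // => al _; rewrite -scalemxAl.
  by have /tan_comp_eq0 -> := N.2 al; rewrite scaler0.
move=> u v; rewrite (normal_expansion N (tan_second_fund f p u v)) scaler_sumr.
apply: eq_bigr => al _; rewrite scalerA; congr (_ *: _).
by rewrite second_mx_onb Ht inner_scalel quasi_umbilical_form_onb mulrC.
Qed.

Lemma umbilical_defect_eq0 p e zeta r : 0 < r -> quasi_umbilical_at p (N1 / r) e zeta ->
  let w := e *m invmx (onb f p) in w *m w^T = 1%:M /\ defect p w r = 0.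
Proof.
move=> r0 [e1 _ IIE] w.
have w1 : w *m w^T = 1%:M.
  apply/matrixP => i j; rewrite !ord1 [RHS]mxE /= -e1 inner_onb_coord -/w innerE mulmx1 //.
split=> //; rewrite big1 // => al _.
apply/(casorati_defect_eq0 w1 (second_onbT f p _) r0 n2).
exists (inner (g p) zeta (row al (nor_onb f p))).
have we : w *m onb f p = e by rewrite mulmxKV ?onb_unit.
apply/matrixP => i j; rewrite second_onbE IIE innerZl mulrC [RHS]mxE; congr (_ * _).
rewrite -we quasi_umbilical_form_onb -!inner_delta.
by congr (inner _ _ _); rewrite rowE mulmxK ?onb_unit.
Qed.

Let N10 : 0 < N1. Proof. by rewrite mulr_gt0. Qed.
Let N1E : N1 = n%:R ^+ 2 - n%:R. Proof. by rewrite mulrBr mulr1. Qed.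

(** The coefficient of C(L) changes sign at r = n(n-1): this pairs the infimum with smaller r and
    the supremum with larger r. *)
Lemma coef_gt0 r : 0 < r -> r < N1 -> 0 < coef r.
Proof.
move=> r0 rN; have nr := addr_gt0 n0 r0; have D : 0 < n%:R ^+ 2 - n%:R - r by rewrite subr_gt0 -N1E.
by rewrite divr_gt0 ?mulr_gt0.
Qed.

Lemma coef_lt0 r : N1 < r -> coef r < 0.
Proof.
move=> rN; have r0 : 0 < r := lt_trans N10 rN.
have nr := addr_gt0 n0 r0; have D : n%:R ^+ 2 - n%:R - r < 0 by rewrite subr_lt0 -N1E.
by rewrite pmulr_llt0 ?invr_gt0 ?mulr_gt0 // pmulr_rlt0 ?mulr_gt0.
Qed.

Lemma deltaC_hatE r p : deltaC_hat f r p = r * casorati f p + coef r * sup (hyperplane_casorati f p).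
Proof.
rewrite /deltaC_hat; congr (_ + _); rewrite -mulNr; congr (_ * _).
by rewrite -mulNr -mulrN; congr (_ * _ / _); ring.
Qed.

Lemma gap_ge0 p w r : 0 < r -> w *m w^T = 1%:M ->
  rho f p <= (r * casorati f p + coef r * normal_casorati f p w) / N1 + bound.
Proof.
move=> r0 w1; rewrite -lerBlDr ler_pdivlMr // mulrC casorati_gap // lerDl.
exact: defect_ge0.
Qed.

Lemma gap_eq0 p w r : 0 < r ->
  rho f p = (r * casorati f p + coef r * normal_casorati f p w) / N1 + bound <-> defect p w r = 0.
Proof.
move=> r0; rewrite casorati_gap //; have := lt0r_neq0 N10.
move: (rho f p) (defect p w r) bound N1 => a b e k k0.
have -> : (k * (a - e) + b) / k + e = a + b / k by field.
split=> [E|->]; last by rewrite mul0r addr0.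
have : b / k = 0 by lra.
by move=> /eqP; rewrite mulf_eq0 invr_eq0 (negbTE k0) orbF => /eqP.
Qed.

(** By [casorati_gap] the two sides differ by the defect at w', which is nonnegative. A hyperplane
    without defect thus realizes the infimum or the supremum, according to the sign of [coef r]. *)
Lemma gap_le p w w' r : 0 < r -> w' *m w'^T = 1%:M -> defect p w r = 0 ->
  coef r * normal_casorati f p w <= coef r * normal_casorati f p w'.
Proof.
move=> r0 w'1 D0; have E := casorati_gap p w r0; have E' := casorati_gap p w' r0.
have := defect_ge0 p r0 w'1; rewrite D0 in E.
move: (r * casorati f p) (coef r * _) (coef r * _) (defect p w' r) (N1 * _) E E' => A B C D F.
lra.
Qed.

Lemma inf_casorati p : exists2 w, w *m w^T = 1%:M &
  inf (hyperplane_casorati f p) = normal_casorati f p w.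
Proof.
have S0 := @unit_sphere_neq0 R n (ltnW n2); have SC := @unit_sphere_compact R n.
have [|w /set_mem w1 wm] := EVT_min_rV S0 SC (f := normal_casorati f p).
  by apply: continuous_subspaceT; exact: normal_casorati_continuous.
exists w => //; rewrite hyperplane_casoratiE; apply: inf_attained; first by exists w.
by move=> _ [w' w'1 <-]; apply: wm; exact: mem_set.
Qed.

Lemma sup_casorati p : exists2 w, w *m w^T = 1%:M &
  sup (hyperplane_casorati f p) = normal_casorati f p w.
Proof.
have S0 := @unit_sphere_neq0 R n (ltnW n2); have SC := @unit_sphere_compact R n.
have [|w /set_mem w1 wm] := EVT_max_rV S0 SC (f := normal_casorati f p).
  by apply: continuous_subspaceT; exact: normal_casorati_continuous.
exists w => //; rewrite hyperplane_casoratiE; apply: sup_attained; first by exists w.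
by move=> _ [w' w'1 <-]; apply: wm; exact: mem_set.
Qed.

Lemma deltaC_inequality r p : 0 < r -> rho f p <= deltaC f r p / N1 + bound.
Proof.
by move=> r0; have [w w1 E] := inf_casorati p; rewrite /deltaC E; exact: gap_ge0.
Qed.

Lemma deltaC_hat_inequality r p : 0 < r -> rho f p <= deltaC_hat f r p / N1 + bound.
Proof.
by move=> r0; have [w w1 E] := sup_casorati p; rewrite deltaC_hatE E; exact: gap_ge0.
Qed.

Lemma deltaC_equality r p : 0 < r -> r < N1 ->
  rho f p = deltaC f r p / N1 + bound <-> exists e zeta, quasi_umbilical_at p (N1 / r) e zeta.
Proof.
move=> r0 rN; split=> [|[e [zeta Q]]].
  have [w w1 E] := inf_casorati p; rewrite /deltaC E => /(gap_eq0 _ _ r0) D0.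
  by have [zeta Q] := defect_eq0_umbilical r0 w1 D0; exists (w *m onb f p), zeta.
have [w1 D0] := umbilical_defect_eq0 r0 Q.
rewrite /deltaC (_ : inf _ = normal_casorati f p (e *m invmx (onb f p))); first exact/gap_eq0.
rewrite hyperplane_casoratiE; apply: inf_attained; first by exists (e *m invmx (onb f p)).
move=> _ [w' w'1 <-]; have := gap_le r0 w'1 D0.
by rewrite ler_pM2l ?coef_gt0.
Qed.

Lemma deltaC_hat_equality r p : N1 < r ->
  rho f p = deltaC_hat f r p / N1 + bound <-> exists e zeta, quasi_umbilical_at p (N1 / r) e zeta.
Proof.
move=> rN; have r0 : 0 < r := lt_trans N10 rN; split=> [|[e [zeta Q]]].
  have [w w1 E] := sup_casorati p; rewrite deltaC_hatE E => /(gap_eq0 _ _ r0) D0.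
  by have [zeta Q] := defect_eq0_umbilical r0 w1 D0; exists (w *m onb f p), zeta.
have [w1 D0] := umbilical_defect_eq0 r0 Q.
rewrite deltaC_hatE (_ : sup _ = normal_casorati f p (e *m invmx (onb f p))); first exact/gap_eq0.
rewrite hyperplane_casoratiE; apply: sup_attained; first by exists (e *m invmx (onb f p)).
move=> _ [w' w'1 <-]; have := gap_le r0 w'1 D0.
by rewrite ler_nM2l ?coef_lt0.
Qed.

End CasoratiInequality.

(** * The equality case *)

Section UmbilicalFrames.
Context (R : realType) (n d : nat) (M : manifold R n) (Mbar : riemannian R d).
Context (f : immersion M Mbar).
Hypotheses (n0 : (0 < n)%N) (dn0 : (0 < d - n)%N).
Implicit Types (p : M) (u v w e : 'rV[R]_n) (xi zeta nu : 'rV[R]_d).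

Local Notation g p := (Defs.metric (f p)).
Local Notation h p := (gM f p).
Local Notation II p := (second_fund f p).

(** In the coordinates given by B, x is a unit vector for the standard inner product, and a
    Householder reflection completes it. *)
Lemma orthonormal_extension s k (G : 'M[R]_k) (B : 'M[R]_(s, k)) (x : 'rV[R]_k) i :
  B *m G *m B^T = 1%:M -> (x <= B)%MS -> inner G x x = 1 ->
  exists E : 'M[R]_(s, k), [/\ E *m G *m E^T = 1%:M, row i E = x & (E <= B)%MS].
Proof.
move=> BB xB x1; have [y xE] := submxP xB.
have y1 : y *m y^T = 1%:M.
  apply/matrixP => a b; rewrite !ord1 [RHS]mxE -x1 xE -inner_mulmx BB innerE mulmx1 //.
have [U [UU Ui]] := orthogonal_extension i y1.
exists (U *m B); split; last exact: submxMl.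
  by rewrite trmx_mul !mulmxA -[U *m B *m G]mulmxA -[U *m _ *m _]mulmxA BB mulmx1.
by rewrite row_mul Ui.
Qed.

Lemma tangent_frame_extension p e i : inner (h p) e e = 1 ->
  exists E : 'M[R]_n, tangent_orthonormal f p E /\ row i E = e.
Proof.
move=> e1; have [|E [EE Ei _]] := orthonormal_extension i (onb_orthonormal f p) _ e1.
  by apply: submx_full; rewrite row_full_unit onb_unit.
by exists E.
Qed.

Lemma normal_frame_extension p nu i : tan_comp f p nu = 0 -> inner (g p) nu nu = 1 ->
  exists E' : 'M[R]_(d - n, d), normal_frame f p E' /\ row i E' = nu.
Proof.
move=> nu0 nu1; have N := nor_onb_frame f p.
have [E [EE Ei EN]] := orthonormal_extension i N.1 (normal_frame_span N nu0) nu1.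
exists E; split=> //; split=> // j; apply/tan_comp_eq0.
have /submxP[z ->] : (row j E <= nor_onb f p)%MS := submx_trans (row_sub _ _) EN.
rewrite -mulmxA mulmx_sum_row big1 // => k _.
by rewrite row_mul; have /tan_comp_eq0 -> := N.2 k; rewrite scaler0.
Qed.

Lemma umbilical_shape p lam e zeta xi u : quasi_umbilical_at f p lam e zeta ->
  tan_comp f p xi = 0 ->
  shape_op f p xi u = inner (g p) zeta xi *: (u + ((lam - 1) * inner (h p) u e) *: e).
Proof.
move=> [_ _ IIE] xi0; apply: (inner_inj (gM_spd f p)) => z.
rewrite weingarten_at // IIE !innerZl innerDl innerZl /quasi_umbilical_form.
by rewrite (innerC (gM_spd f p) e z) mulrC.
Qed.

Lemma umbilical_shape_form p lam e zeta : quasi_umbilical_at f p lam e zeta ->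
  exists (a : R) (E : 'M[R]_n) (E' : 'M[R]_(d - n, d)),
    [/\ tangent_orthonormal f p E, normal_frame f p E' & shape_form f p E E' a (lam * a)].
Proof.
move=> Q; have [e1 zeta0 _] := Q.
(* Indices start at 0, so the distinguished direction, on which [shape_form] tests i + 1 = n, has
   index n - 1. *)
pose last : 'I_n := Ordinal (etrans (congr1 (fun k => (n.-1 < k)%N) (esym (prednK n0))) (ltnSn n.-1)).
pose i0 : 'I_(d - n) := Ordinal dn0.
have [E [EE Elast]] := tangent_frame_extension last e1.
have [a [E' [E'E aE]]] : exists a E', normal_frame f p E' /\ zeta = a *: row i0 E'.
  (* Where zeta vanishes all shape operators do: a = 0 and any normal frame will serve. Elsewhere
     the first normal vector is zeta normalized, and a is its norm. *)
  have [->|z0] := eqVneq zeta 0.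
    by exists 0, (nor_onb f p); rewrite scale0r; split=> //; exact: nor_onb_frame.
  have Z0 : 0 < inner (g p) zeta zeta := (metric_spd (f p)).2 _ z0.
  pose k := Num.sqrt (inner (g p) zeta zeta).
  have k0 : k != 0 by rewrite gt_eqF // sqrtr_gt0.
  have [||E' [E'E Ei]] := normal_frame_extension i0 _ _ (p := p) (nu := k^-1 *: zeta).
  - apply/tan_comp_eq0; rewrite -scalemxAl; have /tan_comp_eq0 -> := zeta0.
    by rewrite scaler0.
  - by rewrite innerZl innerZr mulrA -invfM -expr2 sqr_sqrtr ?ltW // mulVf // gt_eqF.
  by exists k, E'; split=> //; rewrite Ei scalerA divff // scale1r.
exists a, E, E'; split=> // al i.
rewrite (umbilical_shape (row i E) Q (E'E.2 al)) aE innerZl -Elast.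
have -> : inner (g p) (row i0 E') (row al E') = (al == 0 :> nat)%:R.
  by rewrite -inner_rowE -!row_mul E'E.1 row1 mxE eqxx /= -val_eqE.
have -> : inner (h p) (row i E) (row last E) = (i.+1 == n)%:R.
  rewrite -inner_rowE -!row_mul (_ : _ *m E^T = 1%:M) // row1 mxE eqxx /= -val_eqE /=.
  by rewrite -eqSS prednK // eq_sym.
case: (al == 0 :> nat); last by rewrite mulr0 !scale0r.
rewrite mulr1; have [iN|iN] := eqVneq i.+1 n; last by rewrite mulr0 scale0r addr0.
have -> : i = last by apply: val_inj; apply: succn_inj; rewrite /= prednK.
by rewrite mulr1 -{1}[row last E]scale1r -scalerDl scalerA addrC subrK mulrC.
Qed.

Lemma orthonormal_frame_sum p (E : 'M[R]_n) u : tangent_orthonormal f p E ->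
  u = \sum_i inner (h p) u (row i E) *: row i E.
Proof.
move=> EE; rewrite {1}(orthonormal_expansion (v := u) EE); last first.
  apply: submx_full; rewrite row_full_unit.
  by move: EE; rewrite /tangent_orthonormal -mulmxA => /mulmx1_unit[].
by rewrite mulmx_sum_row; apply: eq_bigr => i _; rewrite inner_rowE.
Qed.

Lemma shape_form_umbilical p (E : 'M[R]_n) (E' : 'M[R]_(d - n, d)) lam a :
  tangent_orthonormal f p E -> normal_frame f p E' -> shape_form f p E E' a (lam * a) ->
  exists e zeta, quasi_umbilical_at f p lam e zeta.
Proof.
move=> EE E'E S.
pose last : 'I_n := Ordinal (etrans (congr1 (fun k => (n.-1 < k)%N) (esym (prednK n0))) (ltnSn n.-1)).
have lastE (i : 'I_n) : (i.+1 == n) = (i == last).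
  by rewrite -val_eqE /= -[RHS]eqSS prednK.
pose t (al : 'I_(d - n)) : R := if al == 0 :> nat then a else 0.
have C := innerC (gM_spd f p).
exists (row last E), (\sum_al t al *: row al E'); split.
- by rewrite -inner_rowE -!row_mul (_ : _ *m E^T = 1%:M) // row1 mxE !eqxx.
- apply/tan_comp_eq0; rewrite mulmx_suml big1 // => al _; rewrite -scalemxAl.
  by have /tan_comp_eq0 -> := E'E.2 al; rewrite scaler0.
move=> u v; rewrite (normal_expansion E'E (tan_second_fund f p u v)) scaler_sumr.
apply: eq_bigr => al _; rewrite scalerA; congr (_ *: _).
have SE i : inner (g p) (II p (row i E) v) (row al E') =
    t al * (if i == last then lam else 1) * inner (h p) (row i E) v.
  rewrite -(weingarten_at (row i E) v (E'E.2 al)) S innerZl lastE /t.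
  by case: (al == 0 :> nat); case: (i == last); rewrite ?mul0r ?mulr1 // [lam * _]mulrC.
have L z : linear (fun u => second_fund f p u z) := second_fund_linear f p z.
transitivity (\sum_i inner (h p) u (row i E) * inner (g p) (II p (row i E) v) (row al E')).
  rewrite {1}(orthonormal_frame_sum u EE).
  pose fF := GRing.isLinear.Build _ _ _ _ _ (L v).
  pose ff : {linear 'rV[R]_n -> 'rV[R]_d} := HB.pack (fun u => second_fund f p u v) fF.
  rewrite -[II p _ v]/(ff _) linear_sum inner_suml; apply: eq_bigr => i _.
  by rewrite linearZ innerZl.
rewrite (eq_bigr (fun i => t al * (inner (h p) u (row i E) * inner (h p) v (row i E)
    + (if i == last then (lam - 1) * inner (h p) u (row i E) * inner (h p) v (row i E) else 0)))).
  rewrite -mulr_sumr mulrC; congr (_ * _); rewrite big_split /= -big_mkcond big_pred1_eq.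
  by rewrite -(parseval u EE) //; apply: submx_full; rewrite row_full_unit;
     move: EE; rewrite /tangent_orthonormal -mulmxA => /mulmx1_unit[].
move=> i _; rewrite SE (C v); case: (i == last); ring.
Qed.

Lemma umbilical_invariantly lam :
  (forall p, exists e zeta, quasi_umbilical_at f p lam e zeta) -> invariantly_quasi_umbilical f.
Proof.
move=> Q; rewrite /invariantly_quasi_umbilical => p; have [e [zeta Qp]] := Q p; have [e1 _ _] := Qp.
have N := nor_onb_frame f p; exists (nor_onb f p), e; split=> //.
  by apply: contra_eqN e1 => /eqP ->; rewrite inner0l eq_sym oner_eq0.
move=> al; pose b := inner (g p) zeta (row al (nor_onb f p)).
exists b, (b * lam); rewrite !(umbilical_shape _ Qp (N.2 al)); split.
  by rewrite e1 mulr1 -{1}[e]scale1r -scalerDl scalerA addrC subrK.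
move=> v ve; rewrite (umbilical_shape _ Qp (N.2 al)) ve mulr0 scale0r addr0 //.
Qed.

End UmbilicalFrames.

Section RankOne.
Context (R : realType) (n d : nat) (O : set 'rV[R]_d) (G : 'rV[R]_d -> 'M[R]_d).
Hypotheses (oO : open O) (sG : smooth_on O G) (spdG : forall x, O x -> spd (G x)).
Context (U : set 'rV[R]_n) (F : 'rV[R]_n -> 'rV[R]_d).
Hypotheses (oU : open U) (sF : smooth_on U F) (UO : forall x, U x -> O (F x)).
Hypothesis fF : forall x, U x -> row_free ('J F x).
Implicit Types (x u v w : 'rV[R]_n).

Local Notation tanp := (tan_part G F).
Local Notation II := (second_form G F).

(* Along a second fundamental form h = phi Z of rank one, the components of the
   covariant derivative of h normal to Z only involve the derivative of Z. *)
Lemma codazzi_rank_one (phi : 'rV[R]_n -> 'rV[R]_n -> 'rV[R]_n -> R)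
    (Z : 'rV[R]_n -> 'rV[R]_d) x u v w (nu : 'rV[R]_d) :
  smooth_on U Z -> (forall a b, smooth_on U (phi a b)) ->
  (forall y a b, U y -> II y a b = phi a b y *: Z y) ->
  U x -> tanp x nu = 0 -> inner (G (F x)) (Z x) nu = 0 ->
  inner (G (F x)) (curvature G (F x) (u *m 'J F x) (v *m 'J F x) (w *m 'J F x)) nu =
  phi v w x * inner (G (F x)) (cov G F Z x u) nu
  - phi u w x * inner (G (F x)) (cov G F Z x v) nu.
Proof.
move=> sZ sphi IIE Ux nu0 Znu.
have K a b : inner (G (F x)) (II x a b) nu = 0.
  by refine (etrans (congr1 (fun z => inner _ z nu) (IIE x a b Ux)) _); rewrite innerZl Znu mulr0.
have D a b e : inner (G (F x)) (cov G F (fun y => II y a b) x e) nu =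
    phi a b x * inner (G (F x)) (cov G F Z x e) nu.
  have E1 := @cov_near_eq _ _ _ G F _ _ x e (near_eq_open oU (fun y => IIE y a b) Ux).
  have E2 := covZ sG spdG UO e (sphi a b) sZ Ux.
  refine (etrans (congr1 (fun z => inner _ z nu) (etrans E1 E2)) _).
  by rewrite innerDl !innerZl Znu mulr0 add0r.
refine (etrans (codazzi_equation oO sG spdG oU sF UO fF u v w Ux nu0) _).
have alg (a b c e a' b' : R) : a = 0 -> b = 0 -> c = a' -> e = b' -> a - b + (c - e) = a' - b'.
  by clear; move=> -> -> -> ->; ring.
exact: alg (K _ _) (K _ _) (D _ _ _) (D _ _ _).
Qed.

End RankOne.

(** * The Codazzi equation for a quasi-umbilical second fundamental form *)

Section UmbilicalCodazzi.
Context (R : realType) (n d : nat) (M : manifold R n) (Mbar : riemannian R d).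
Context (f : immersion M Mbar) (lam : R).
Hypothesis lam0 : 0 < lam.
Hypothesis f_umbilical : forall p, exists e zeta, quasi_umbilical_at f p lam e zeta.
Implicit Types (p : M) (u v w e : 'rV[R]_n) (xi zeta nu : 'rV[R]_d).

Local Notation Gp p := (form_in (@Defs.metric R d Mbar) (f p)).
Local Notation Fp p := (local_rep f p).
Local Notation x0 p := (chart p p).
Local Notation g p := (Defs.metric (f p)).
Local Notation h p := (gM f p).
Local Notation hp p := (second_form (Gp p) (Fp p)).

(** A neighbouring point carries its umbilical data in its own chart; transported to the chart of
    [p] they still exhibit rank one, with factors whose dependence on [y] is arbitrary. *)
Lemma umbilical_rank_one p y : imm_dom f p y ->
  exists (b : 'rV[R]_n -> 'rV[R]_n -> R) zeta, forall u v, hp p y u v = b u v *: zeta.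
Proof.
move=> py; have [A [B [uA uB E]]] := second_fund_transport py.
have [e [zeta [_ _ IIE]]] := f_umbilical (chart_inv p y).
exists (fun u v => quasi_umbilical_form (h (chart_inv p y)) e lam (u *m invmx A) (v *m invmx A)).
exists (zeta *m invmx B) => a b.
by rewrite scalemxAl -IIE E !mulmxKV ?mulmxK.
Qed.

(** The rank-one Codazzi equation needs a smooth representation h = phi Z. With e constant in
    coordinates, Z = h(e, e) is smooth, equals lam zeta at p and stays nonzero nearby; phi is
    obtained by pairing h with Z. In the other alternative h vanishes everywhere and D = 0. *)
Lemma codazzi_umbilical p e zeta : quasi_umbilical_at f p lam e zeta ->
  zeta != 0 \/ (forall q u v, second_fund f q u v = 0) ->
  forall nu, tan_comp f p nu = 0 -> inner (g p) zeta nu = 0 ->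
  exists D : 'rV[R]_n -> R, forall x y z,
    inner (g p) (ambient_curv f p (df f p x) (df f p y) (df f p z)) nu =
    quasi_umbilical_form (h p) e lam y z * D x - quasi_umbilical_form (h p) e lam x z * D y.
Proof.
move=> [e1 zeta0 IIE] Hz nu nu0 znu.
have px0 := imm_dom_center f p; have oU : open (imm_dom f p) by exact: imm_dom_open.
have sF : smooth_on (imm_dom f p) (Fp p) by exact: imm_dom_smooth.
have K (U : set 'rV[R]_n) (phi : 'rV[R]_n -> 'rV[R]_n -> 'rV[R]_n -> R)
    (Z : 'rV[R]_n -> 'rV[R]_d) : open U -> U `<=` imm_dom f p ->
    smooth_on U Z -> (forall a b, smooth_on U (phi a b)) ->
    (forall y a b, U y -> hp p y a b = phi a b y *: Z y) -> U (x0 p) ->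
    inner (g p) (Z (x0 p)) nu = 0 ->
    forall x y z,
    inner (g p) (ambient_curv f p (df f p x) (df f p y) (df f p z)) nu =
    phi y z (x0 p) * inner (g p) (cov (Gp p) (Fp p) Z (x0 p) x) nu
    - phi x z (x0 p) * inner (g p) (cov (Gp p) (Fp p) Z (x0 p) y) nu.
  move=> oU' sub sZ sphi hE Ux0 Znu x y z.
  have sF' := smooth_subset sub sF.
  have := codazzi_rank_one (@imm_img_open _ _ _ _ _ f p) (@imm_metric_smooth _ _ _ _ _ f p) (@imm_metric_spd _ _ _ _ _ f p) oU' sF'
    (fun y Uy => imm_dom_sub (sub y Uy)) (fun y Uy => imm_dom_free (sub y Uy)) x y z sZ sphi hE Ux0 nu0.
  by rewrite metric_center local_rep_center; apply.
case: Hz => [z0|II0]; last first.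
  have hE y a b : imm_dom f p y -> hp p y a b = 0 *: 0.
    move=> py; have [A [B [uA uB E]]] := second_fund_transport py; rewrite scale0r.
    have := E (a *m invmx A) (b *m invmx A); rewrite !mulmxKV // II0 => H.
    by rewrite -[LHS](mulmxK uB) -H mul0mx.
  exists (fun=> 0) => x y z; rewrite !mulr0 subrr.
  have S0 : smooth_on (imm_dom f p) (fun=> 0 : 'rV[R]_d) by exact: smooth_cst.
  have S1 (a b : 'rV[R]_n) : smooth_on (imm_dom f p) (fun=> 0 : R) by exact: smooth_cst.
  rewrite (K _ (fun _ _ _ => 0) (fun=> 0) oU (@subset_refl _ _) S0 S1 hE px0) ?inner0l //.
  by rewrite !mul0r subrr.
pose Z y := hp p y e e.
have sh a b : smooth_on (imm_dom f p) (fun y => hp p y a b).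
  exact: (smooth_second_form (@imm_img_open _ _ _ _ _ f p) (@imm_metric_smooth _ _ _ _ _ f p) (@imm_metric_spd _ _ _ _ _ f p) oU sF
    (@imm_dom_sub _ _ _ _ _ f p) (@imm_dom_free _ _ _ _ _ f p)).
have oU' : open (imm_dom f p `&` Z @^-1` [set~ 0]).
  apply: open_smooth_preimage => //; first exact: sh.
  by apply: closed_openC; apply: accessible_closed_set1; exact: hausdorff_accessible (@norm_hausdorff _ _).
set U' := _ `&` _ in oU'.
have sub : U' `<=` imm_dom f p by move=> y [].
have UZ y : U' y -> Z y != 0 by move=> [_ /eqP].
have qe : quasi_umbilical_form (h p) e lam e e = lam.
  by rewrite /quasi_umbilical_form e1; ring.
have Zx0 : Z (x0 p) = lam *: zeta by rewrite -qe -IIE.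
have Ux0 : U' (x0 p).
  split=> //; rewrite /preimage /= Zx0; apply/eqP.
  by rewrite scaler_eq0 negb_or z0 gt_eqF.
have sG' : smooth_on U' (fun y => Gp p (Fp p y)).
  apply: (smooth_subset sub).
  exact: (smooth_metric_along (@imm_img_open _ _ _ _ _ f p) (@imm_metric_smooth _ _ _ _ _ f p) oU sF (@imm_dom_sub _ _ _ _ _ f p)).
have sh' a b : smooth_on U' (fun y => hp p y a b) := smooth_subset sub (sh a b).
have spdG y : U' y -> spd (Gp p (Fp p y)).
  by move=> Uy; apply: imm_metric_spd; exact: imm_dom_sub (sub _ Uy).
have ZZ y : U' y -> inner (Gp p (Fp p y)) (Z y) (Z y) != 0.
  by move=> Uy; rewrite gt_eqF //; apply: (spdG _ Uy).2; exact: UZ.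
pose phi a b y := inner (Gp p (Fp p y)) (hp p y a b) (Z y) * (inner (Gp p (Fp p y)) (Z y) (Z y))^-1.
have sphi a b : smooth_on U' (phi a b).
  apply: smoothM => //; first exact: (smooth_inner oU' sG' (sh' a b) (sh' e e)).
  by apply: smoothV => //; exact: (smooth_inner oU' sG' (sh' e e) (sh' e e)).
have hE y a b : U' y -> hp p y a b = phi a b y *: Z y.
  move=> Uy; have [k [xi hk]] := umbilical_rank_one (sub _ Uy).
  have ZE : Z y = k e e *: xi := hk e e.
  have := ZZ _ Uy; have := UZ _ Uy; rewrite /phi hk ZE.
  rewrite !innerZl !innerZr scaler_eq0 negb_or => /andP[k0 _].
  rewrite !mulf_eq0 !negb_or => /andP[_ /andP[_ xx]].
  rewrite scalerA; congr (_ *: _); move: (inner _ _ _) xx => q xx.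
  by field; rewrite xx k0.
have phi0 a b : phi a b (x0 p) * lam = quasi_umbilical_form (h p) e lam a b.
  have := hE _ a b Ux0; rewrite Zx0 -[LHS]/(second_fund f p a b) IIE scalerA => /eqP.
  by rewrite -subr_eq0 -scalerBl scaler_eq0 (negbTE z0) orbF subr_eq0 => /eqP ->.
(* At p the field Z is lam zeta and phi is the quasi-umbilical form divided by lam; the factor lam
   is moved into D. *)
exists (fun x => inner (g p) (cov (Gp p) (Fp p) Z (x0 p) x) nu / lam) => x y z.
rewrite (K U' phi Z oU' sub (sh' e e) sphi hE Ux0); last by rewrite Zx0 innerZl znu mulr0.
rewrite -!phi0; move: (phi _ _ _) (phi _ _ _) (inner _ _ _) (inner _ _ _) => a b q r.
by field; rewrite gt_eqF.
Qed.

End UmbilicalCodazzi.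

(** * Vanishing of c and of the normal curvature *)

Section FlatNormalConnection.
Context (R : realType) (n d : nat) (M : manifold R n) (Mbar : riemannian R d).
Context (sigma : Mbar -> set 'M[R]_d) (f : immersion M Mbar) (c theta lam : R).
Hypotheses (f_slant : slant_proper f sigma theta) (space_form : quaternionic_space_form sigma c).
Hypotheses (lam0 : 0 < lam) (lam1 : lam != 1).
Hypothesis f_umbilical : forall p, exists e zeta, quasi_umbilical_at f p lam e zeta.
Implicit Types (p : M) (u v w e : 'rV[R]_n) (xi zeta nu : 'rV[R]_d).

Local Notation g p := (Defs.metric (f p)).
Local Notation h p := (gM f p).

Let d0 : (0 < d)%N := leq_trans (codim_gt0 f_slant) (leq_subr _ _).

Lemma normal_component_eq0 p e zeta J nu : c != 0 ->
  quasi_umbilical_at f p lam e zeta ->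
  zeta != 0 \/ (forall q u v, second_fund f q u v = 0) ->
  canonical_basis sigma (f p) J ->
  tan_comp f p nu = 0 -> inner (g p) zeta nu = 0 ->
  forall a, inner (g p) (df f p e *m J a) nu = 0.
Proof.
move=> c0 Q Hz cJ nu0 znu a; have [e1 _ _] := Q.
have [D HD] := codazzi_umbilical lam0 f_umbilical Q Hz nu0 znu.
have aE (b : 'I_3) : b = 2 + (b + 1) by case: b => -[|[|[|]]] // k; exact/val_inj.
(* The obstruction concerns the third operator of the triple; this cyclic shift gives [J a] the
   index 2. *)
pose J' b := J (b + (a + 1)).
have cJ' : canonical_basis sigma (f p) J' := canonical_basis_shift (a + 1) cJ.
have -> : J a = J' 2.
  by rewrite /J' -aE.
have dfn u : inner (g p) (df f p u) nu = 0 by rewrite (innerC (metric_spd _)) inner_normal_df.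
have P b x y : inner (g p) (df f p x *m J' b) (df f p y) = inner (h p) y (slant_op f p (J' b) x).
  by rewrite -inner_slant_op (innerC (gM_spd f p)).
apply: (quasi_umbilical_obstruction (gM_spd f p) (slant_opP f_slant cJ') e1 lam0 lam1
  (kap := c / 4) (d := D) (f1 := fun x => inner (g p) (df f p x *m J' 0) nu)
  (f2 := fun x => inner (g p) (df f p x *m J' 1) nu)
  (f3 := fun x => inner (g p) (df f p x *m J' 2) nu)).
  by rewrite mulf_neq0 // invr_neq0 // pnatr_eq0.
move=> x y z; refine (etrans (esym (HD x y z)) _).
refine (etrans (space_form_curvatureE d0 space_form cJ' _ _ _ _) _).
by rewrite /model_curvature /qterm !dfn !P !mulr0 subrr add0r.
Qed.

(** As c is one constant for the whole space, a single good point suffices: one with zeta <> 0 if h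
    is not identically zero, and any point otherwise. *)
Lemma umbilical_flat_ambient : c = 0.
Proof.
apply/eqP; apply: contrapT => /negP c0.
have [p [e [zeta [Q Hz]]]] : exists p e zeta, quasi_umbilical_at f p lam e zeta /\
    (zeta != 0 \/ (forall q u v, second_fund f q u v = 0)).
  have [[q [u [v /eqP H]]]|H] := pselect (exists q u v, second_fund f q u v <> 0).
    have [e [zeta Q]] := f_umbilical q; exists q, e, zeta; split=> //; left.
    by case: Q => [_ _ E]; apply: contraNneq H => z0; rewrite E z0 scaler0.
  have [p _] := slant_witness f_slant.
  have [e [zeta Q]] := f_umbilical p; exists p, e, zeta; split=> //; right=> q u v.
  by apply: contrapT => H'; apply: H; exists q, u, v.
have [J cJ] := canonical_basis_exists f space_form.1.1 p; have [e1 zeta0 _] := Q.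
have C := innerC (metric_spd (f p)).
pose F a := nor_comp f p (df f p e *m J a).
(* Subtracting from F a its component along zeta leaves a normal vector nu orthogonal to zeta, to
   which J_a e is orthogonal by the Codazzi argument; so nu = 0. If zeta = 0 the formula reads F a =
   0, which [F0] excludes. *)
have FE a : F a = (inner (g p) (F a) zeta / inner (g p) zeta zeta) *: zeta.
  set k := _ / _; pose nu := F a - k *: zeta.
  have nu0 : tan_comp f p nu = 0.
    have N : tan_comp f p (F a) = 0 by exact: tan_nor_comp.
    apply/tan_comp_eq0; rewrite mulmxBl -scalemxAl.
    by have /tan_comp_eq0 -> := N; have /tan_comp_eq0 -> := zeta0; rewrite scaler0 subrr.
  have znu : inner (g p) zeta nu = 0.
    rewrite innerBr innerZr (C zeta (F a)) /k.
    have [->|z0] := eqVneq zeta 0; first by rewrite inner0r !inner0l mulr0 subrr.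
    by rewrite divfK ?subrr // gt_eqF //; apply: (metric_spd (f p)).2.
  have Fnu : inner (g p) (F a) nu = 0.
    by rewrite inner_nor_comp //; exact: (normal_component_eq0 c0 Q Hz cJ nu0 znu).
  have /(inner_eq0 (metric_spd _)) : inner (g p) nu nu = 0.
    by rewrite {1}/nu innerBl innerZl Fnu znu mulr0 subrr.
  by move=> /eqP; rewrite subr_eq0 => /eqP.
have FF a : inner (g p) (F a) (F a) = 1 - cos theta ^+ 2.
  by rewrite (slant_nor_norm f_slant a e cJ) e1 mulr1.
have F0 a : F a != 0.
  apply/eqP => Fa; have := FF a; rewrite Fa inner0l => /esym/eqP.
  by rewrite gt_eqF // subr_gt0 (slant_cos_lt1 f_slant).
(* J_0 e and J_1 e are orthogonal, and so are their tangential parts; hence the normal parts are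
   too. *)
have F01 : inner (g p) (F 0) (F 1) = 0.
  have N : tan_comp f p (F 1) = 0 by exact: tan_nor_comp.
  have [_ _ pos _ _] := cJ.
  have diag x : inner (g p) (x *m J 2) x = 0.
    have := canonical_skew cJ 2 x x; rewrite (C x).
    by move: (inner _ _ _) => r; lra.
  have E2 : inner (g p) (df f p e *m J 0) (df f p e *m J 1) = 0.
    have J10 : J 1 *m J 0 = J 2 by have := pos 0; rewrite !add0r.
    by rewrite (canonical_skew cJ) -mulmxA J10 C diag oppr0.
  rewrite inner_nor_comp // -[RHS]E2 [in RHS](tan_nor_compE f p (df f p e *m J 1)) innerDr.
  rewrite -[X in X + _](inner_slant_op f p (J 0) e) (slant_op_orthogonal f_slant e cJ) add0r.
  by [].
have := F01; rewrite (FE 0) (FE 1) innerZl innerZr.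
have z0 : zeta != 0 by apply: contraNneq (F0 0) => z0; rewrite FE z0 scaler0.
have ZZ : inner (g p) zeta zeta != 0 by rewrite gt_eqF //; apply: (metric_spd (f p)).2.
move/eqP; rewrite mulf_eq0 => /orP[/eqP k0|].
  by have := F0 0; rewrite FE k0 scale0r eqxx.
rewrite mulf_eq0 (negbTE ZZ) orbF => /eqP k0.
by have := F0 1; rewrite FE k0 scale0r eqxx.
Qed.

(** As c = 0, the ambient term of the Ricci equation vanishes. All shape operators are multiples of
    one self-adjoint operator, so they commute and the other two terms cancel. *)
Lemma umbilical_flat_normal_connection : trivial_normal_connection f.
Proof.
rewrite /trivial_normal_connection => p u v xi xi0.
have [e [zeta Q]] := f_umbilical p; have [e1 zeta0 IIE] := Q.
rewrite ricci_at // !(umbilical_shape _ Q xi0).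
have -> : ambient_curv f p (df f p u) (df f p v) xi = 0.
  have [J cJ] := canonical_basis_exists f space_form.1.1 p.
  apply: (inner_inj (metric_spd (f p))) => w.
  refine (etrans (space_form_curvatureE d0 space_form cJ _ _ _ _) _).
  by rewrite umbilical_flat_ambient mul0r mul0r inner0l.
rewrite !IIE -scalerBl.
have -> : nor_comp f p 0 = 0 by rewrite /nor_comp /nor_part /tan_part !mul0mx subr0.
rewrite add0r; apply/eqP; rewrite scaler_eq0; apply/orP; left; apply/eqP.
rewrite /quasi_umbilical_form !(innerZl, innerZr, innerDl, innerDr) !e1.
rewrite (innerC (gM_spd f p) v u).
move: (inner _ _ _) (inner _ _ _) (inner _ _ _) (inner _ _ _) => a b k q; ring.
Qed.

End FlatNormalConnection.

Theorem theorem3p1 (R : realType) (n m : nat) (m_gt0 : (0 < m)%N)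
    (M : manifold R n) (Mbar : riemannian R (4 * m))
    (sigma : Mbar -> set 'M[R]_(4 * m)) (c theta : R) (f : immersion M Mbar)
    (Mbar_form : quaternionic_space_form sigma c)
    (M_slant : slant_proper f sigma theta) :
  let N1 : R := n%:R * (n%:R - 1) in
  let bound := c / 4 * (1 + 9 / (n%:R - 1) * cos theta ^+ 2) in
  let equality_case (r : R) :=
    [/\ invariantly_quasi_umbilical f, trivial_normal_connection f &
        exists a : M -> R, forall p : M,
          exists (E : 'M[R]_n) (E' : 'M[R]_(4 * m - n, 4 * m)),
            [/\ tangent_orthonormal f p E, normal_frame f p E' &
                shape_form f p E E' (a p) (N1 / r * a p)]] in
  [/\ forall r : R, 0 < r -> r < N1 ->
        forall p : M, rho f p <= deltaC f r p / N1 + bound,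
      forall r : R, N1 < r ->
        forall p : M, rho f p <= deltaC_hat f r p / N1 + bound,
      forall r : R, 0 < r -> r < N1 ->
        ((forall p : M, rho f p = deltaC f r p / N1 + bound) <->
         equality_case r) &
      forall r : R, N1 < r ->
        ((forall p : M, rho f p = deltaC_hat f r p / N1 + bound) <->
         equality_case r)].
Proof.
move=> N1 bound equality_case.
have n2 : (1 < n)%N := slant_dim_gt1 M_slant.
have n0 : (0 < n)%N := ltnW n2.
have N10 : 0 < N1 by rewrite mulr_gt0 ?ltr0n // subr_gt0 ltr1n.
have dn0 := codim_gt0 M_slant.
(* Both ranges of r lead to the same pointwise condition, with lam = n(n-1) / r. *)
have equality r : 0 < r -> r != N1 ->
    (forall p, exists e zeta, quasi_umbilical_at f p (N1 / r) e zeta) <-> equality_case r.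
  move=> r0 rN; have lam0 : 0 < N1 / r by rewrite divr_gt0.
  (* The value r = n(n-1) between the two ranges corresponds to lam = 1, the totally umbilical case,
     to which the Codazzi obstruction does not apply. *)
  have lam1 : N1 / r != 1.
    by apply: contra_neq rN => E; have := divfK (lt0r_neq0 r0) N1; rewrite E mul1r.
  split=> [Q|[_ _ [a S] p]].
    split.
    - exact: umbilical_invariantly Q.
    - exact: (umbilical_flat_normal_connection M_slant Mbar_form lam0 lam1 Q).
    - have /choice[a Ha] p : exists (a : R) (E : 'M[R]_n) (E' : 'M[R]_(4 * m - n, 4 * m)),
          [/\ tangent_orthonormal f p E, normal_frame f p E' & shape_form f p E E' a (N1 / r * a)].
        by have [e [zeta Qp]] := Q p; exact: umbilical_shape_form Qp.
      by exists a.
  by have [E [E' [EE E'E SE]]] := S p; exact: shape_form_umbilical EE E'E SE.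
split=> [r r0 rN p|r rN p|r r0 rN|r rN].
- exact: (deltaC_inequality M_slant Mbar_form p r0).
- exact: (deltaC_hat_inequality M_slant Mbar_form p (lt_trans N10 rN)).
- rewrite -equality //; last by rewrite lt_eqF.
  by split=> H p; apply/(deltaC_equality M_slant Mbar_form p r0 rN).
- rewrite -equality ?(lt_trans N10 rN) //; last by rewrite gt_eqF.
  by split=> H p; apply/(deltaC_hat_equality M_slant Mbar_form p rN).
Qed.
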